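(* If $p\ge kq$, then $H^\ell(\mathfrak{so}(p,q), \mathrm{SO}(p)\times \mathrm{SO}(q); \mathcal{P}_k)$ is nonzero for $\ell=kq$ and for $\ell=pq$, and it is zero for every $\ell<kq$ and every $\ell>pq$. (No assertion is made for $kq<\ell<pq$.)
   Context: Let $p,q,k\ge 1$. Let $V=\mathbb{R}^{p,q}$ with orthogonal basis $e_1,\ldots,e_{p+q}$, $(e_\alpha,e_\alpha)=1$ for $1\le\alpha\le p$, $(e_\mu,e_\mu)=-1$ for $p+1\le\mu\le p+q$. Let $V_+=\mathrm{span}(e_\alpha)$, $V_-=\mathrm{span}(e_\mu)$, $K=\mathrm{SO}(p)\times\mathrm{SO}(q)$. Write $\mathfrak{so}(p,q)=\mathfrak{k}\oplus\mathfrak{p}_0$ (orthogonal for the Killing form); $\mathfrak{p}_0\cong V_+\otimes V_-$ as a $K$-module, with basis $e_{\alpha\mu}=-e_\alpha\wedge e_\mu$ and dual basis $\omega_{\alpha\mu}$ of $\mathfrak{p}_0^*$ (here $u\wedge v$ acts by $w\mapsto (u,w)v-(v,w)u$). $\mathcal{P}_k=\mathrm{Pol}((V\otimes\mathbb{C})^k)$ is the ring of complex polynomials in the coordinates $z_{\alpha i},z_{\mu i}$ ($1\le i\le k$) of $k$-tuples of vectors; it is the Fock model of the (suitably twisted) Weil representation, and $K$ acts by $(g f)(\mathbf{v})=f(g^{-1}\mathbf{v})$. The relative Lie algebra complex is $C^\ell=\big(\bigwedge^\ell\mathfrak{p}_0^*\otimes\mathcal{P}_k\big)^K$ with differential $$d=\sum_{i=1}^k\sum_{\alpha=1}^p\sum_{\mu=p+1}^{p+q}A(\omega_{\alpha\mu})\otimes\Big(\frac{\partial^2}{\partial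 z_{\alpha i}\partial z_{\mu i}}-z_{\alpha i}z_{\mu i}\Big),$$ where $A(\omega)$ is left exterior multiplication by $\omega$; $H^\ell(\mathfrak{so}(p,q),K;\mathcal{P}_k)$ is its cohomology. *)

(* Defs.v *)
From HB Require Import structures.
From mathcomp Require Import all_boot all_order all_algebra ring_quotient.
From mathcomp Require Import boolp reals complex mpoly.

Set Implicit Arguments.
Unset Strict Implicit.
Unset Printing Implicit Defensive.

Import Order.TTheory GRing.Theory Num.Theory.
Local Open Scope ring_scope.
Local Open Scope complex_scope.

(* The exterior algebra on a basis (omega_x)_(x : I), with coefficients in M:
   phi stands for \sum_S omega_S (x) phi S, where omega_S is the product
   omega_(x_1) /\ ... /\ omega_(x_l) for enum S = [:: x_1; ...; x_l].         *)
Section Exterior.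
Variables (F : comNzRingType) (I : finType) (M : lmodType F).

Definition ext := {ffun {set I} -> M}.
HB.instance Definition _ := GRing.Lmodule.on ext.

Definition ext_mono (S : {set I}) (f : M) : ext :=
  [ffun T => if T == S then f else 0].

Definition ext_homog (l : nat) (phi : ext) : Prop :=
  forall S : {set I}, #|S| != l -> phi S = 0.

(* Left exterior multiplication by omega_x. The sign counts the factors that
   omega_x crosses on the way to its place in the increasing product.         *)
Definition ext_mulb (x : I) (phi : ext) : ext :=
  [ffun T : {set I} => if x \in T then
     (-1) ^+ #|[set y in T | (enum_rank y < enum_rank x)%N]| *: phi (T :\ x)
   else 0].

(* Left exterior multiplication by the covector \sum_x c x *: omega_x.        *)
Definition ext_mul (c : I -> F) (phi : ext) : ext :=
  \sum_x c x *: ext_mulb x phi.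

(* The diagonal action of a group element that maps omega_x to
   \sum_y c x y *: omega_y and acts on M by rho; omega_S (x) f is sent to the
   product of the images of the factors of omega_S, with coefficient rho f.   *)
Definition ext_act (c : I -> I -> F) (rho : M -> M) (phi : ext) : ext :=
  \sum_(S : {set I})
    foldr (fun x => ext_mul (c x)) (ext_mono set0 (rho (phi S))) (enum S).

Lemma ext_mulb_is_linear x : linear (ext_mulb x).
Proof.
move=> a u v; apply/ffunP=> T; rewrite !ffunE.
case: ifP => _; last by rewrite scaler0 addr0.
by rewrite scalerDr !scalerA [_ * a]mulrC.
Qed.
HB.instance Definition _ x :=
  GRing.isLinear.Build F ext ext _ (ext_mulb x) (ext_mulb_is_linear x).

Lemma ext_mul_is_linear c : linear (ext_mul c).
Proof.
move=> a u v; rewrite /ext_mul scaler_sumr -big_split /=.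
by apply: eq_bigr => x _; rewrite linearP scalerDr !scalerA [_ * a]mulrC.
Qed.
HB.instance Definition _ c :=
  GRing.isLinear.Build F ext ext _ (ext_mul c) (ext_mul_is_linear c).

Lemma ext_mono_is_linear S : linear (ext_mono S).
Proof.
move=> a u v; apply/ffunP=> T; rewrite !ffunE.
by case: ifP => _ //; rewrite scaler0 addr0.
Qed.
HB.instance Definition _ S :=
  GRing.isLinear.Build F M ext _ (ext_mono S) (ext_mono_is_linear S).

Lemma ext_act_is_linear c (rho : {linear M -> M}) : linear (ext_act c rho).
Proof.
move=> a u v; rewrite /ext_act scaler_sumr -big_split /=.
apply: eq_bigr => S _; rewrite !ffunE.
by elim: (enum S) => [|x s IHs] /=; rewrite ?IHs linearP ?linearP.
Qed.

Lemma ext_mulbb x phi : ext_mulb x (ext_mulb x phi) = 0.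
Proof. by apply/ffunP=> T; rewrite !ffunE setD11 scaler0 if_same. Qed.

Lemma ext_mulbC x y phi :
  ext_mulb x (ext_mulb y phi) = - ext_mulb y (ext_mulb x phi).
Proof.
wlog lt_xy : x y / (enum_rank x < enum_rank y)%N => [wl|].
  case: (ltngtP (enum_rank x) (enum_rank y))
    => [|lt_yx|/ord_inj /enum_rank_inj ->]; first exact: wl.
  - by rewrite (wl y x) // opprK.
  - by rewrite ext_mulbb oppr0.
have neq_xy : x != y by apply: contraTneq lt_xy => ->; rewrite ltnn.
apply/ffunP=> T; rewrite !ffunE !in_setD1 neq_xy [y == x]eq_sym neq_xy /=.
case xT: (x \in T); case yT: (y \in T); rewrite ?scaler0 ?oppr0 //.
rewrite !scalerA -!exprD -scaleNr.
have -> : T :\ x :\ y = T :\ y :\ x by apply/setP=> z; rewrite !inE andbCA.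
have -> : [set z in T :\ y | (enum_rank z < enum_rank x)%N]
        = [set z in T | (enum_rank z < enum_rank x)%N].
  apply/setP=> z; rewrite !inE; case: eqP => // ->.
  by rewrite ltnNge (ltnW lt_xy) !andbF.
rewrite [in RHS](cardsD1 x [set z in T | (enum_rank z < enum_rank y)%N]).
rewrite inE xT lt_xy.
have -> : [set z in T | (enum_rank z < enum_rank y)%N] :\ x
        = [set z in T :\ x | (enum_rank z < enum_rank y)%N].
  by apply/setP=> z; rewrite !inE andbA.
by congr (_ *: _); rewrite !add1n !addSn exprS mulN1r opprK addnC.
Qed.

Lemma ext_monoE (S : {set I}) f :
  ext_mono S f = foldr ext_mulb (ext_mono set0 f) (enum S).
Proof.
have -> : ext_mono S f = ext_mono [set x in enum S] f.
  by congr ext_mono; apply/setP=> x; rewrite inE mem_enum.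
pose r := relpre (@enum_rank I) (fun i j => i < j)%N.
have r_tr : transitive r by move=> y x z; apply: ltn_trans.
have: sorted r (enum S).
  rewrite /enum_mem; apply: sorted_filter => //; rewrite -enumT.
  case E: (enum I) => [//|x0 s]; rewrite -E; apply/(sortedP x0) => i lt_i.
  rewrite -cardE in lt_i.
  have rk j (lt_j : (j < #|I|)%N) : enum_rank (nth x0 (enum I) j) = j :> nat.
    by rewrite -(enum_val_nth x0 (Ordinal lt_j)) enum_valK.
  by rewrite /r /= !rk // ltnW.
elim: (enum S) => [|x s IHs] /=.
  by move=> _; congr ext_mono; apply/setP=> x; rewrite !inE.
rewrite (path_sortedE r_tr) => /andP[/allP x_s /IHs <-].
have xs : x \notin s by apply/negP=> /x_s; rewrite /r /= ltnn.
apply/ffunP=> T; rewrite !ffunE.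
have [->|neqT] := eqVneq T [set y in x :: s].
  rewrite !inE eqxx /= (_ : _ :\ x = [set y in s]) ?eqxx; last first.
    apply/setP=> y; rewrite !inE; case: eqP => // ->.
    by rewrite (negbTE xs).
  rewrite (_ : [set _ in _ | _] = set0) ?cards0 ?expr0 ?scale1r //.
  apply/setP=> y; rewrite !inE; case: eqP => [->|_] /=; first by rewrite ltnn.
  by apply/negP=> /andP[/x_s /ltnW]; rewrite leqNgt => /negP.
case: ifP => // xT; case: eqP => [eqT|_]; last by rewrite scaler0.
case/eqP: neqT; rewrite -(setD1K xT) eqT; apply/setP=> y.
by rewrite !inE.
Qed.
End Exterior.

Section WeilComplex.
Variables (R : realType) (p q k : nat).

Definition Jpq : 'M[R]_(p + q) := block_mx 1%:M 0 0 (- 1%:M).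

Definition evec (i : 'I_(p + q)) : 'cV[R]_(p + q) := delta_mx i ord0.

(* u /\ v is the endomorphism w |-> (u, w) v - (v, w) u.                      *)
Definition wedge (u v : 'cV[R]_(p + q)) : 'M[R]_(p + q) :=
  v *m (u^T *m Jpq) - u *m (v^T *m Jpq).

Definition e_ (x : 'I_p * 'I_q) : 'M[R]_(p + q) :=
  - wedge (evec (lshift q x.1)) (evec (rshift p x.2)).

(* On p_0, the span of the e_ x, omega is the dual basis (p0E and omegaE).    *)
Definition omega (x : 'I_p * 'I_q) (X : 'M[R]_(p + q)) : R :=
  - X (lshift q x.1) (rshift p x.2).

Definition inSO n (a : 'M[R]_n) : Prop := a *m a^T = 1%:M /\ \det a = 1.

Definition inK (g : 'M[R]_(p + q)) : Prop :=
  exists (a : 'M[R]_p) (b : 'M[R]_q),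
    [/\ inSO a, inSO b & g = block_mx a 0 0 b].

(* P_k: the variable z_(i, j) is the i-th coordinate of the j-th vector; a
   k-tuple of vectors is the matrix of its columns, flattened by mxvec.       *)
Definition fock := {mpoly R[i][(p + q) * k]}.
HB.instance Definition _ := GRing.Lmodule.on fock.

Definition z_ (i : 'I_(p + q)) (j : 'I_k) : {mpoly R[i][(p + q) * k]} :=
  'X_(mxvec_index i j).

Definition zmx : 'M[{mpoly R[i][(p + q) * k]}]_(p + q, k) :=
  \matrix_(i, j) z_ i j.

(* (g f)(v) = f(g^-1 v), see fock_actE.                                       *)
Definition fock_act (g : 'M[R]_(p + q)) (f : fock) : fock :=
  f \mPo [tuple mxvec (map_mx (fun r : R => (r%:C)%:MP) (invmx g) *m zmx) ord0 j
         | j < (p + q) * k].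

(* As P_k is complex, the coefficients of the exterior algebra of the real dual
   of p_0 may be taken in R[i].                                               *)
Definition form := ext ('I_p * 'I_q)%type fock.

(* g omega_x = omega_x \o Ad(g^-1).                                           *)
Definition coad (g : 'M[R]_(p + q)) (x y : 'I_p * 'I_q) : R[i] :=
  (omega x (invmx g *m e_ y *m g))%:C.

Definition form_act (g : 'M[R]_(p + q)) : form -> form :=
  ext_act (coad g) (fock_act g).

Definition cochain (l : nat) (phi : form) : Prop :=
  ext_homog l phi /\ forall g, inK g -> form_act g phi = phi.

Definition weil_op (x : 'I_p * 'I_q) (j : 'I_k) (f : fock) : fock :=
  let a := lshift q x.1 in let m := rshift p x.2 in
  (f^`M(mxvec_index m j))^`M(mxvec_index a j) - z_ a j * z_ m j * f.

Definition weil_d (phi : form) : form :=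
  \sum_(j < k) \sum_(a < p) \sum_(m < q)
    ext_mulb (a, m) [ffun S => weil_op (a, m) j (phi S)].

Lemma fock_act_is_linear g : linear (fock_act g).
Proof. by move=> c u v; rewrite /fock_act linearP. Qed.
HB.instance Definition _ g :=
  GRing.isLinear.Build R[i] fock fock _ (fock_act g) (fock_act_is_linear g).

Lemma form_act_is_linear g : linear (form_act g).
Proof. exact: ext_act_is_linear. Qed.
HB.instance Definition _ g :=
  GRing.isLinear.Build R[i] form form _ (form_act g) (form_act_is_linear g).

Lemma weil_op_is_linear x j : linear (weil_op x j).
Proof.
move=> c u v; rewrite /weil_op !linearP /= mulrDr -scalerAr opprD.
by rewrite scalerBr addrACA.
Qed.

Lemma weil_d_is_linear : linear weil_d.
Proof.
move=> c u v; rewrite /weil_d scaler_sumr -big_split; apply: eq_bigr => j _ /=.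
rewrite scaler_sumr -big_split; apply: eq_bigr => a _ /=.
rewrite scaler_sumr -big_split; apply: eq_bigr => m _ /=.
rewrite -linearP; congr ext_mulb; apply/ffunP=> S.
by rewrite !ffunE weil_op_is_linear.
Qed.
HB.instance Definition _ :=
  GRing.isLinear.Build R[i] form form _ weil_d weil_d_is_linear.

Lemma fock_actE g f (v : 'M[R[i]]_(p + q, k)) :
  (fock_act g f).@[mxvec v ord0] =
  f.@[mxvec (map_mx (real_complex R) (invmx g) *m v) ord0].
Proof.
rewrite comp_mpoly_meval; apply: meval_eq => j; rewrite tnth_mktuple.
case/mxvec_indexP: j => i j; rewrite !mxvecE !mxE rmorph_sum /=.
apply: eq_bigr => l _; rewrite !mxE mevalM mevalC mevalXU.
by rewrite mxvecE.
Qed.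

Lemma e_E x :
  e_ x = block_mx 0 (- delta_mx x.1 x.2) (- delta_mx x.2 x.1) 0.
Proof.
rewrite /e_ /wedge /evec !trmx_delta -!rowE.
have -> : row (lshift q x.1) Jpq = delta_mx ord0 (lshift q x.1).
  apply/rowP=> j; rewrite mxE [RHS]mxE eqxx /=.
  case: (splitP j) => i /= E.
    have -> : j = lshift q i by apply: val_inj.
    by rewrite block_mxEul mxE eq_lshift eq_sym.
  have -> : j = rshift p i by apply: val_inj.
  by rewrite block_mxEur mxE eq_rlshift.
have -> : row (rshift p x.2) Jpq = - delta_mx ord0 (rshift p x.2).
  apply/rowP=> j; rewrite mxE [RHS]mxE [in RHS]mxE eqxx /=.
  case: (splitP j) => i /= E.
    have -> : j = lshift q i by apply: val_inj.
    by rewrite block_mxEdl mxE eq_lrshift oppr0.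
  have -> : j = rshift p i by apply: val_inj.
  by rewrite block_mxEdr !mxE eq_rshift eq_sym.
rewrite mulmxN !mul_delta_mx opprK; apply/matrixP=> i j.
rewrite -(splitK i) -(splitK j).
by case: (split i) => i'; case: (split j) => j' /=;
  rewrite ?(block_mxEul, block_mxEur, block_mxEdl, block_mxEdr) !mxE
    ?(eq_lshift, eq_rshift, eq_lrshift, eq_rlshift) ?andbF ?addr0 ?add0r ?oppr0.
Qed.

Lemma omegaE x y : omega x (e_ y) = (x == y)%:R.
Proof.
by case: x y => [a m] [b n]; rewrite /omega e_E block_mxEur !mxE opprK.
Qed.

Lemma p0E (X : 'M[R]_(p + q)) :
  X = \sum_x omega x X *: e_ x <->
  exists B : 'M[R]_(p, q), X = block_mx 0 B B^T 0.
Proof.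
pose S (B : 'M[R]_(p, q)) := block_mx 0 B B^T 0.
have eS x : e_ x = S (- delta_mx x.1 x.2).
  by rewrite e_E /S linearN /= trmx_delta.
have S_sum c : \sum_x c x *: e_ x = S (\matrix_(a, m) - c (a, m)).
  have -> : \matrix_(a, m) - c (a, m) = \sum_x c x *: - delta_mx x.1 x.2.
    rewrite [LHS]matrix_sum_delta pair_bigA; apply: eq_bigr => -[a m] _ /=.
    by rewrite mxE scalerN scaleNr.
  rewrite (big_morph S (id1 := 0) (op1 := +%R)) => [|B B'|].
  - by apply: eq_bigr => x _; rewrite eS /S scale_block_mx !scaler0 linearZ.
  - by rewrite /S add_block_mx !addr0 linearD.
  - by rewrite /S trmx0 block_mx0.
split=> [->|[B ->]]; first by rewrite S_sum; eexists.
rewrite S_sum; congr S; apply/matrixP=> a m.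
by rewrite mxE /omega block_mxEur opprK.
Qed.

Lemma coadE (a : 'M[R]_p) (b : 'M[R]_q) x y : inSO a -> inSO b ->
  coad (block_mx a 0 0 b) x y = (a y.1 x.1 * b y.2 x.2)%:C.
Proof.
move=> [aa _] [bb _].
have invE : invmx (block_mx a 0 0 b) = block_mx a^T 0 0 b^T.
  have gg : block_mx a 0 0 b *m block_mx a^T 0 0 b^T = 1%:M.
    rewrite mulmx_block !(mulmx0, mul0mx) aa bb !addr0 !add0r.
    by rewrite -scalar_mx_block.
  have [gU _] := mulmx1_unit gg.
  by rewrite -[RHS](mulKmx gU) gg mulmx1.
rewrite /coad /omega e_E invE !mulmx_block !(mulmx0, mul0mx, addr0, add0r).
rewrite block_mxEur mulmxN mulNmx mxE opprK; congr (_%:C).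
rewrite -(mul_delta_mx (ord0 : 'I_1)) mulmxA -colE -mulmxA -rowE.
by rewrite mxE big_ord1 !mxE.
Qed.

Lemma cochain_closed l (c : R[i]) (u v : form) :
  cochain l u -> cochain l v -> cochain l (c *: u + v).
Proof.
move=> [uh uK] [vh vK]; split=> [S hS|g gK].
  by rewrite !ffunE uh // vh // scaler0 addr0.
by rewrite linearP /= uK // vK.
Qed.

Lemma cochain0 l : cochain l 0.
Proof. by split=> [S _|g _]; rewrite ?ffunE ?linear0. Qed.

Section Cohomology.
Variable l : nat.

Definition is_cocycle : {pred form} :=
  fun phi => `[< cochain l phi /\ weil_d phi = 0 >].

Lemma is_cocycle_closed : submod_closed is_cocycle.
Proof.
split=> [|c u v]; rewrite !unfold_in.
  by apply/asboolP; split; [exact: cochain0 | exact: linear0].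
move=> /asboolP[uC du] /asboolP[vC dv]; apply/asboolP; split.
  exact: cochain_closed.
by rewrite linearP /= du dv scaler0 addr0.
Qed.
HB.instance Definition _ :=
  GRing.isSubmodClosed.Build R[i] form is_cocycle is_cocycle_closed.

Record cocycles := Cocycle { cocycle_val :> form; _ : is_cocycle cocycle_val }.
HB.instance Definition _ := [isSub for cocycle_val].
HB.instance Definition _ := [Choice of cocycles by <:].
HB.instance Definition _ := [SubChoice_isSubLmodule of cocycles by <:].

(* weil_d maps cochains to cocycles, so these are all the coboundaries.       *)
Definition is_coboundary : {pred cocycles} := fun phi =>
  `[< if l is m.+1 then exists2 psi : form, cochain m psi & weil_d psi = phi
      else phi = 0 >].

Lemma is_coboundary_closed : zmod_closed is_coboundary.
Proof.
rewrite /is_coboundary; case: l => [|m].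
  split=> [|u v]; rewrite !unfold_in; first exact/asboolP.
  by move=> /asboolP-> /asboolP->; apply/asboolP; rewrite subrr.
split=> [|u v]; rewrite !unfold_in.
  by apply/asboolP; exists 0; [exact: cochain0 | exact: linear0].
move=> /asboolP[f fC fu] /asboolP[g gC gv]; apply/asboolP.
exists (f - g); last by rewrite linearB /= fu gv.
by rewrite addrC -scaleN1r; apply: cochain_closed.
Qed.
HB.instance Definition _ :=
  GRing.isZmodClosed.Build cocycles is_coboundary is_coboundary_closed.

Definition cohomology := {ideal_quot is_coboundary}.
HB.instance Definition _ := GRing.Zmodule.on cohomology.
End Cohomology.

End WeilComplex.

(* Main.v *)
(* Write d = delta - kappa, where delta is the part of order 2 and kappa is
   multiplication by the quadrics r_(alpha, mu) = \sum_j z_(alpha, j) z_(mu, j);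
   kappa is the differential of the Koszul complex of the pq quadrics, and the
   leading part of d for the polynomial degree. If kq <= p, then kq of the
   quadrics have pairwise coprime leading monomials for a suitable weight, so
   kappa is exact below degree kq. The Laplacian of kappa for the Fischer inner
   product then provides K-invariant primitives, and induction on the polynomial
   degree gives the vanishing for l < kq.
   In degree kq, the product of the kq one-forms
   \sum_alpha z_(alpha, j) omega_(alpha, mu) is killed by kappa and by delta. It
   has a term without any variable z_(mu, j), which kappa cannot reach; a
   primitive could be taken of low polynomial degree, so there is none.
   In degree pq, a Gaussian integral kills the coboundaries by integration by
   parts, but not the volume form.                                            *)

From HB Require Import structures.
From mathcomp Require Import all_boot all_order all_algebra ring_quotient.
From mathcomp Require Import boolp reals complex mpoly ssrcomplements.
From mathcomp Require Import zify ring lra.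
Require Import Defs.

Set Implicit Arguments.
Unset Strict Implicit.
Unset Printing Implicit Defensive.

Import Order.TTheory GRing.Theory Num.Theory.
Local Open Scope ring_scope.
Local Open Scope complex_scope.

(** * Exterior algebra and anticommuting operators *)

(** The hypothesis kq <= p gives each pair (j, m) a row jq + m of its own, so that the leading
    monomials z_(jq+m, j) z_(m, j) are pairwise coprime. The main obstacle is invariance. Primitives
    found by dividing by leading monomials depend on that choice and need not be K-invariant, and no
    averaging over K is performed: a primitive that comes from a polynomial in the Laplacian is
    invariant for algebraic reasons, because the Laplacian commutes with K. A second obstacle is
    that d squares to zero only on invariant forms, while the induction on the degree replaces psi
    by psi - d chi and must not change d psi. The anticommutator of delta and kappa involves the Lie
    algebra of K, but invariance is given for the group; the passage uses curves of rotations with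
    rational entries, for which a bound on the second-order remainder replaces differentiation. The
    two explicit classes are invariant because K acts on the volume form, and on each block of q
    one-forms, through determinants. *)

Section ExteriorContraction.
Variables (F : comNzRingType) (I : finType) (M : lmodType F).
Implicit Types (phi : ext I M) (S T : {set I}).

Definition ext_below (x : I) (T : {set I}) : nat :=
  #|[set y in T | (enum_rank y < enum_rank x)%N]|.

Lemma ext_belowU1 x y T : y \notin T ->
  ext_below x (y |: T) = ((enum_rank y < enum_rank x) + ext_below x T)%N.
Proof.
move=> yT; rewrite /ext_below; case lt_yx: (enum_rank y < enum_rank x)%N.
  rewrite (cardsD1 y) !inE eqxx lt_yx /=; congr (_ + _)%N.
  apply: eq_card => w; rewrite !inE; case: eqP => //= ->.
  by rewrite (negbTE yT).
apply: eq_card => w; rewrite !inE; case: eqP => //= ->.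
by rewrite lt_yx andbF.
Qed.

(** Contraction with the vector dual to [omega_x], as the transpose of [ext_mulb x]; both carry the
    same sign because [x] does not count itself in [ext_below]. *)
Definition ext_iotab (x : I) phi : ext I M :=
  [ffun T : {set I} => if x \in T then 0
     else (-1) ^+ ext_below x T *: phi (x |: T)].

Lemma ext_iotab_is_linear x : linear (ext_iotab x).
Proof.
move=> a u v; apply/ffunP=> T; rewrite !ffunE.
case: ifP => _; first by rewrite scaler0 addr0.
by rewrite scalerDr !scalerA [_ * a]mulrC.
Qed.
HB.instance Definition _ x :=
  GRing.isLinear.Build F (ext I M) (ext I M) _ (ext_iotab x)
    (ext_iotab_is_linear x).

(** The Clifford relation. For distinct [x] and [y], only the one of larger rank sees the other in
    its sign, so exchanging them costs exactly one sign. *)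
Lemma ext_iotab_mulb x y phi :
  ext_iotab x (ext_mulb y phi) =
  (x == y)%:R *: phi - ext_mulb y (ext_iotab x phi).
Proof.
apply/ffunP=> T; rewrite !ffunE -/(ext_below _ _) !inE.
have [<-{y}|neq_xy] := eqVneq x y.
  rewrite scale1r; case: ifP => xT /=.
    rewrite -/(ext_below _ _); have -> : ext_below x T = ext_below x (T :\ x).
      by rewrite -[in LHS](setD1K xT) ext_belowU1 ?setD11 // ltnn.
    by rewrite setD1K // scalerA -expr2 sqrr_sign scale1r subrr.
  rewrite -/(ext_below _ _) ext_belowU1 ?xT // ltnn add0n scalerA -expr2.
  by rewrite sqrr_sign scale1r setU1K ?xT // subr0.
rewrite scale0r sub0r /= -!/(ext_below _ _).
case: (boolP (x \in T)) => xT; case: (boolP (y \in T)) => yT;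
  rewrite ?scaler0 ?oppr0 //.
rewrite -!/(ext_below _ _) !scalerA -!exprD -scaleNr.
have -> : (x |: T) :\ y = x |: T :\ y.
  apply/setP=> w; rewrite !inE; case: (eqVneq w y) => [->|] //=.
  by rewrite eq_sym (negbTE neq_xy).
congr (_ *: _); rewrite ext_belowU1 //.
rewrite -{1}(setD1K yT) (@ext_belowU1 x y) ?setD11 //.
have : enum_rank x != enum_rank y by rewrite (inj_eq enum_rank_inj).
rewrite -(inj_eq (@ord_inj _)) /=; case: ltngtP => // _ _; rewrite /= ?addn0 ?add0n.
  by rewrite add1n addSn exprS mulN1r addnC.
by rewrite addnCA add1n exprS mulN1r addnC.
Qed.

Definition ext_map (u : M -> M) phi : ext I M := [ffun S => u (phi S)].

Lemma ext_map_is_linear (u : {linear M -> M}) : linear (ext_map u).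
Proof. by move=> a f h; apply/ffunP=> T; rewrite !ffunE linearP. Qed.
HB.instance Definition _ (u : {linear M -> M}) :=
  GRing.isLinear.Build F (ext I M) (ext I M) _ (ext_map u)
    (ext_map_is_linear u).

Lemma ext_map_mulb (u : {linear M -> M}) x phi :
  ext_map u (ext_mulb x phi) = ext_mulb x (ext_map u phi).
Proof.
by apply/ffunP=> T; rewrite !ffunE; case: ifP; rewrite ?linearZ ?linear0.
Qed.

Lemma ext_map_iotab (u : {linear M -> M}) x phi :
  ext_map u (ext_iotab x phi) = ext_iotab x (ext_map u phi).
Proof.
by apply/ffunP=> T; rewrite !ffunE; case: ifP; rewrite ?linearZ ?linear0.
Qed.

Lemma ext_map_mono (u : {linear M -> M}) S f :
  ext_map u (ext_mono S f) = ext_mono S (u f) :> ext I M.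
Proof. by apply/ffunP=> T; rewrite !ffunE; case: ifP; rewrite ?linear0. Qed.

Lemma ext_iotab_mono0 x f : ext_iotab x (ext_mono set0 f : ext I M) = 0.
Proof.
apply/ffunP=> T; rewrite !ffunE; case: ifP => // _.
by rewrite (_ : (_ == _) = false) ?scaler0 //; apply/eqP/setP=> /(_ x); rewrite !inE eqxx.
Qed.

Lemma ext_sum_mono phi : phi = \sum_S ext_mono S (phi S).
Proof.
apply/ffunP=> T; rewrite sum_ffunE (bigD1 T) //= ffunE eqxx.
by rewrite big1 ?addr0 // => S; rewrite ffunE eq_sym => /negbTE ->.
Qed.

(** The one-forms generate the exterior algebra over the scalars, so an identity of linear operators
    can be checked through its commutation with [ext_mulb], without enumerating subsets. *)
Lemma ext_ind (P : ext I M -> Prop) :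
    (forall c phi psi, P phi -> P psi -> P (c *: phi + psi)) ->
    (forall f, P (ext_mono set0 f)) ->
    (forall x phi, P phi -> P (ext_mulb x phi)) ->
  forall phi, P phi.
Proof.
move=> Plin P0 Pmul phi; rewrite (ext_sum_mono phi).
have Pz : P 0 by have := P0 0; rewrite linear0.
apply: (big_rec P) => // S psi _ Ppsi.
rewrite -[ext_mono _ _]scale1r; apply: Plin => //.
by rewrite ext_monoE; elim: (enum S) => //= x s IHs; apply: Pmul.
Qed.

End ExteriorContraction.

Section Anticommuting.
Variables (F : comNzRingType) (W : lmodType F).

(** Both conditions are kept because [F] is an arbitrary commutative ring: where 2 is a zero
    divisor, anticommutation does not force squares to vanish. *)
Definition anticomm (I : Type) (X : I -> {linear W -> W}) : Prop :=
  (forall x w, X x (X x w) = 0) /\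
  (forall x y w, X x (X y w) = - X y (X x w)).

Lemma anticomm_comp (I J : Type) (X : I -> {linear W -> W}) (f : J -> I) :
  anticomm X -> anticomm (X \o f).
Proof. by case=> XX XC; split=> *; [apply: XX | apply: XC]. Qed.

Lemma anticomm_foldr_comm (I : Type) (X : I -> {linear W -> W}) (Y : {linear W -> W}) s w :
  (forall x w, Y (X x w) = - X x (Y w)) ->
  Y (foldr X w s) = (-1) ^+ size s *: foldr X (Y w) s.
Proof.
move=> YX; elim: s => [|x s IHs] /=; first by rewrite scale1r.
by rewrite YX IHs linearZ -scaleNr exprS mulN1r.
Qed.

Lemma anticomm_foldr_insert (I : Type) (X : I -> {linear W -> W}) x s1 s2 w :
  anticomm X ->
  foldr X w (x :: s1 ++ s2) = (-1) ^+ size s1 *: foldr X w (s1 ++ x :: s2).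
Proof. by case=> XX XC; rewrite /= !foldr_cat (anticomm_foldr_comm (X := X)). Qed.

Lemma anticomm_foldr_mem (I : eqType) (X : I -> {linear W -> W}) x s w :
  anticomm X -> x \in s -> X x (foldr X w s) = 0.
Proof.
case=> XX XC; case/splitPr: s / => s1 s2.
rewrite foldr_cat (anticomm_foldr_comm (X := X)) //= XX.
have foldr0 : foldr X 0 s1 = 0 by elim: s1 => //= y s ->; rewrite linear0.
by rewrite foldr0 scaler0.
Qed.

(** The exponent [b] is chosen before [X] and [w], so that one sign serves two families of operators
    at once. *)
Lemma perm_foldr_sign (I : eqType) (s t : seq I) :
  perm_eq s t ->
  exists b : nat, forall (X : I -> {linear W -> W}) w,
    anticomm X -> foldr X w s = (-1) ^+ b *: foldr X w t.
Proof.
elim: s t => [|x s IHs] t eq_st.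
  by move: eq_st; rewrite perm_sym => /perm_nilP ->; exists 0%N => X w _; rewrite scale1r.
have: x \in t by rewrite -(perm_mem eq_st) mem_head.
move=> xt; case/splitPr: t / xt eq_st => t1 t2.
rewrite perm_sym perm_catC /= perm_cons perm_catC perm_sym => /IHs[b fE].
exists (b + size t1)%N => X w aX.
rewrite /= fE // linearZ /= -[X x _]/(foldr X w (x :: _)).
by rewrite anticomm_foldr_insert // scalerA exprD.
Qed.

(* A word in anticommuting operators is, up to sign, an increasing product or
   zero; the sign and the set of letters do not depend on the operators.      *)
Lemma anticomm_foldr_normal (I : finType) (s : seq I) :
  exists (c : F) (S : {set I}), forall (X : I -> {linear W -> W}) w,
    anticomm X -> foldr X w s = c *: foldr X w (enum S).
Proof.
elim: s => [|x s [c [S IHs]]].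
  by exists 1, set0 => X w _; rewrite enum_set0 scale1r.
have [xS|xS] := boolP (x \in S).
  exists 0, S => X w aX; rewrite /= IHs // linearZ /= anticomm_foldr_mem ?mem_enum //.
  by rewrite scaler0 scale0r.
have /perm_foldr_sign[b fE] : perm_eq (x :: enum S) (enum (x |: S)).
  apply: uniq_perm; rewrite /= ?mem_enum ?xS ?enum_uniq // => y.
  by rewrite inE !mem_enum !inE.
exists (c * (-1) ^+ b), (x |: S) => X w aX.
by rewrite /= IHs // linearZ -scalerA -fE.
Qed.

(** The letters in front of [b] are counted by [size s1]; this is the sign of the cofactor in
    [foldr_det]. *)
Lemma map_lift_enum n (b : 'I_n.+1) :
  exists s1 s2, [/\ size s1 = b, enum 'I_n.+1 = s1 ++ b :: s2
    & [seq lift b c | c <- enum 'I_n] = s1 ++ s2].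
Proof.
exists (take b (enum 'I_n.+1)), (drop b.+1 (enum 'I_n.+1)); split.
- by rewrite size_takel // size_enum_ord ltnW.
- rewrite -{1}(cat_take_drop b (enum 'I_n.+1)); congr (_ ++ _).
  by rewrite (drop_nth b) ?size_enum_ord // nth_ord_enum.
apply: (inj_map val_inj); rewrite map_cat map_take map_drop.
have -> : [seq val i | i <- [seq lift b c | c <- enum 'I_n]] =
          [seq bump b i | i <- [seq val c | c <- enum 'I_n]] by rewrite -!map_comp.
rewrite !val_enum_ord.
have le_bn : (b <= n)%N by rewrite -ltnS.
rewrite take_iota drop_iota (minn_idPl _); last exact: leqW.
have -> : iota 0 n = iota 0 b ++ iota b (n - b) by rewrite -iotaD subnKC.
rewrite map_cat add0n subSS; congr (_ ++ _).
  rewrite -[RHS]map_id; apply/eq_in_map => i; rewrite mem_iota /= /bump.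
  by rewrite ltnNge; case: leqP.
rewrite -[in RHS]add1n (iotaDl 1); apply/eq_in_map => i.
by rewrite mem_iota /bump => /andP[-> _].
Qed.

(** Expansion along the first row. Once [X b] is outermost, every other occurrence of [X b] is
    killed, so column [b] may be deleted from the remaining rows and a minor is left. *)
Lemma foldr_det n (X : 'I_n -> {linear W -> W}) (A : 'M[F]_n) w :
  anticomm X ->
  foldr (fun a v => \sum_b A a b *: X b v) w (enum 'I_n) =
  \det A *: foldr X w (enum 'I_n).
Proof.
elim: n X A w => [|n IHn] X A w aX.
  by rewrite !enum_ord0 /= det_mx00 scale1r.
have [XX XC] := aX.
rewrite {1}enum_ordSl /= (expand_det_row _ ord0) scaler_suml.
apply: eq_bigr => b _; rewrite -scalerA; congr (_ *: _).
rewrite foldr_map.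
pose X' c : {linear W -> W} := X (lift b c).
have dropb (s : seq 'I_n) v :
    X b (foldr (fun a v => \sum_b' A (lift ord0 a) b' *: X b' v) v s)
  = X b (foldr (fun a v => \sum_c row' ord0 (col' b A) a c *: X' c v) v s).
  elim: s => //= a s IHs.
  rewrite (bigD1_ord b) //= linearD linearZ /= XX scaler0 add0r.
  rewrite !linear_sum; apply: eq_bigr => c _; rewrite !mxE !linearZ /=.
  by rewrite XC IHs -XC.
rewrite dropb IHn; last exact: anticomm_comp.
rewrite linearZ /= /cofactor add0n mulrC -scalerA; congr (_ *: _).
have [s1 [s2 [<- enumE liftE]]] := map_lift_enum b.
rewrite -(foldr_map (lift b) X) liftE enumE -[LHS]/(foldr X w (b :: _)).
by rewrite anticomm_foldr_insert.
Qed.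
End Anticommuting.

(** * The action of a linear substitution on the exterior algebra *)

Section ExtAction.
Variables (F : comNzRingType) (I : finType) (M : lmodType F).
Local Notation E := (ext I M).
Implicit Types (phi : E) (c : I -> F).

Lemma ext_mulb_anticomm :
  anticomm (fun x => (ext_mulb x : {linear E -> E})).
Proof. by split=> [x w|x y w] /=; [apply: ext_mulbb | apply: ext_mulbC]. Qed.

Lemma ext_mul_mulb c x phi :
  ext_mul c (ext_mulb x phi) = - ext_mulb x (ext_mul c phi).
Proof.
rewrite /ext_mul linear_sum -sumrN; apply: eq_bigr => y _ /=.
by rewrite ext_mulbC linearZ /= scalerN.
Qed.

Lemma ext_map_mul (u : {linear M -> M}) c phi :
  ext_map u (ext_mul c phi) = ext_mul c (ext_map u phi).
Proof.
rewrite (linear_sum (ext_map u : {linear E -> E})); apply: eq_bigr => y _.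
by rewrite linearZ /= ext_map_mulb.
Qed.

Lemma ext_mulNC c (u : {linear E -> E}) phi :
    (forall x psi, u (ext_mulb x psi) = - ext_mulb x (u psi)) ->
  u (ext_mul c phi) = - ext_mul c (u phi).
Proof.
move=> uN; rewrite /ext_mul linear_sum -sumrN; apply: eq_bigr => y _ /=.
by rewrite linearZ /= uN scalerN.
Qed.

Lemma ext_mul_anticomm (J : Type) (c : J -> I -> F) :
  anticomm (fun x => (ext_mul (c x) : {linear E -> E})).
Proof.
split=> [x w|x y w] /=; last first.
  by apply: ext_mulNC => z psi; apply: ext_mul_mulb.
rewrite {1}/ext_mul.
pose u r psi := \sum_(y <- r) c x y *: ext_mulb y psi : E.
have uC r y psi : u r (ext_mulb y psi) = - ext_mulb y (u r psi).
  rewrite /u linear_sum -sumrN; apply: eq_bigr => z _ /=.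
  by rewrite ext_mulbC linearZ /= scalerN.
have uu r : u r (u r w) = 0.
  elim: r => [|y r IHr]; first by rewrite /u big_nil.
  have uE psi : u (y :: r) psi = c x y *: ext_mulb y psi + u r psi.
    by rewrite /u big_cons.
  have uZ a psi psi' : u r (a *: psi + psi') = a *: u r psi + u r psi'.
    rewrite /u scaler_sumr -big_split; apply: eq_bigr => z _.
    by rewrite linearP /= scalerDr !scalerA mulrC.
  rewrite !uE uZ IHr uC linearP /= ext_mulbb scaler0 add0r addr0 scalerN.
  by rewrite subrr.
exact: uu.
Qed.

Definition ext_iota c phi : E := \sum_x c x *: ext_iotab x phi.

Lemma ext_iota_is_linear c : linear (ext_iota c).
Proof.
move=> a u v; rewrite /ext_iota scaler_sumr -big_split /=.
by apply: eq_bigr => x _; rewrite linearP scalerDr !scalerA [_ * a]mulrC.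
Qed.
HB.instance Definition _ c :=
  GRing.isLinear.Build F E E _ (ext_iota c) (ext_iota_is_linear c).

Lemma ext_iota_mulb c x phi :
  ext_iota c (ext_mulb x phi) = c x *: phi - ext_mulb x (ext_iota c phi).
Proof.
rewrite /ext_iota (bigD1 x) //= [in RHS](bigD1 x) //=.
rewrite ext_iotab_mulb eqxx scale1r scalerBr [ext_mulb x (_ + _)]linearD /=.
rewrite [ext_mulb x (_ *: _)]linearZ /= opprD addrA.
congr (_ + _); rewrite [ext_mulb x (\sum_(i | _) _)]linear_sum -sumrN /=.
apply: eq_bigr => y neq_yx.
by rewrite ext_iotab_mulb (negbTE neq_yx) scale0r sub0r scalerN [ext_mulb x (_ *: _)]linearZ.
Qed.

Lemma ext_iota_mul c c' phi :
  ext_iota c (ext_mul c' phi) =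
  (\sum_x c x * c' x) *: phi - ext_mul c' (ext_iota c phi).
Proof.
rewrite {1}/ext_mul linear_sum /= scaler_suml.
rewrite /ext_mul -sumrB; apply: eq_bigr => x _.
by rewrite linearZ /= ext_iota_mulb scalerBr scalerA mulrC.
Qed.

Section Action.
Variables (c : I -> I -> F) (rho : {linear M -> M}).
Local Notation act := (ext_act c rho).

Lemma ext_act_mono S f : act (ext_mono S f) =
  foldr (fun x => ext_mul (c x)) (ext_mono set0 (rho f)) (enum S).
Proof.
rewrite /ext_act (bigD1 S) //= ffunE eqxx big1 ?addr0 // => T neq_TS.
rewrite ffunE (negbTE neq_TS) !linear0.
by elim: (enum T) => //= x s ->; rewrite linear0.
Qed.

HB.instance Definition _ :=
  GRing.isLinear.Build F E E _ act (ext_act_is_linear c rho).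

(** [ext_act] is defined on increasing products only. Reordering [x :: enum S] gives the same
    coefficient and the same set for the original and for the transformed one-forms, because both
    families anticommute. *)
Lemma ext_act_mulb x phi :
  act (ext_mulb x phi) = ext_mul (c x) (act phi).
Proof.
suffices actE S f : act (ext_mulb x (ext_mono S f)) =
    ext_mul (c x) (act (ext_mono S f)).
  rewrite (ext_sum_mono phi) (linear_sum (act : {linear E -> E})).
  rewrite !(linear_sum (ext_mulb x : {linear E -> E})).
  rewrite !(linear_sum (act : {linear E -> E})).
  by rewrite (linear_sum (ext_mul (c x) : {linear E -> E})); apply: eq_bigr => S _; apply: actE.
rewrite [in LHS]ext_monoE ext_act_mono.
have [a [T sE]] := @anticomm_foldr_normal _ E _ (x :: enum S).
have := sE _ (ext_mono set0 f) ext_mulb_anticomm; rewrite /= => ->.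
rewrite -ext_monoE linearZ /= ext_act_mono.
by have := sE _ (ext_mono set0 (rho f)) (ext_mul_anticomm c); rewrite /= => ->.
Qed.

Lemma ext_act_foldr s phi :
  act (foldr (@ext_mulb F I M) phi s) =
  foldr (fun x => ext_mul (c x)) (act phi) s.
Proof. by elim: s => //= x s <-; rewrite ext_act_mulb. Qed.

Lemma ext_act_mono0 f : act (ext_mono set0 f) = ext_mono set0 (rho f).
Proof. by rewrite ext_act_mono enum_set0. Qed.

Lemma ext_act_map (J : finType) (a : J -> F) (u : {linear M -> M})
    (v : J -> {linear M -> M}) phi :
    (forall f, rho (u f) = \sum_y a y *: v y (rho f)) ->
  act (ext_map u phi) = \sum_y a y *: ext_map (v y) (act phi).
Proof.
move=> uE; elim/ext_ind: phi => [d phi psi IH1 IH2|f|x phi IH].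
- rewrite !linearP /= IH1 IH2 scaler_sumr -big_split; apply: eq_bigr => y _.
  by rewrite linearP /= scalerDr !scalerA mulrC.
- rewrite ext_map_mono !ext_act_mono0 uE linear_sum; apply: eq_bigr => y _.
  by rewrite ext_map_mono linearZ.
rewrite ext_map_mulb !ext_act_mulb IH (linear_sum (ext_mul (c x) : {linear E -> E})).
by apply: eq_bigr => y _ /=; rewrite linearZ /= ext_map_mul.
Qed.

Lemma ext_map_act (J : finType) (a : J -> F) (u : {linear M -> M})
    (v : J -> {linear M -> M}) phi :
    (forall f, u (rho f) = \sum_y a y *: rho (v y f)) ->
  ext_map u (act phi) = \sum_y a y *: act (ext_map (v y) phi).
Proof.
move=> uE; elim/ext_ind: phi => [d phi psi IH1 IH2|f|x phi IH].
- rewrite !linearP /= IH1 IH2 scaler_sumr -big_split; apply: eq_bigr => y _.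
  by rewrite !linearP /=.
- rewrite ext_act_mono0 ext_map_mono uE linear_sum; apply: eq_bigr => y _.
  by rewrite ext_map_mono linearZ /= ext_act_mono0.
rewrite ext_act_mulb ext_map_mul IH (linear_sum (ext_mul (c x) : {linear E -> E})).
by apply: eq_bigr => y _ /=; rewrite linearZ /= ext_map_mulb ext_act_mulb.
Qed.

(** A contraction transforms by the contragredient of [c]; orthonormality of the rows of [c]
    identifies it with [c]. *)
Lemma ext_iota_act x phi :
    (forall x y, \sum_w c x w * c y w = (x == y)%:R) ->
  ext_iota (c x) (act phi) = act (ext_iotab x phi).
Proof.
move=> cc; elim/ext_ind: phi => [d phi psi IH1 IH2|f|y phi IH].
- by rewrite !linearP /= IH1 IH2.
- rewrite ext_iotab_mono0 linear0 ext_act_mono0 /ext_iota big1 // => y _.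
  by rewrite ext_iotab_mono0 scaler0.
rewrite ext_act_mulb ext_iota_mul cc IH ext_iotab_mulb linearB linearZ /=.
by rewrite ext_act_mulb.
Qed.

End Action.
End ExtAction.

(** * The oscillator operators and their equivariance *)

Section MpolyLinear.
Variables (n : nat) (K : fieldType).
Implicit Types (f g : {mpoly K[n]}) (i j : 'I_n) (m : 'X_{1..n}).

Lemma mpoly_ind_lin (P : {mpoly K[n]} -> Prop) :
    (forall c f g, P f -> P g -> P (c *: f + g)) ->
    P 1 -> (forall i f, P f -> P ('X_i * f)) ->
  forall f, P f.
Proof.
move=> Plin P1 PX f.
have P0 : P 0 by rewrite -(subrr 1) -[- 1]scaleN1r addrC; apply: Plin.
elim/mpolyind: f => // c m f _ _ Pf; apply: Plin => // {f Pf}.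
elim: {m}(mdeg m) {-2}m (erefl (mdeg m)) => [|d IHd] m md.
  by move/eqP: md; rewrite mdeg_eq0 => /eqP ->; rewrite mpolyX0.
have /existsP[i mi] : [exists i, (m i != 0)%N].
  apply: contra_eqT md; rewrite negb_exists => /forallP m0.
  by rewrite mdegE big1 // => i _; apply/eqP; move: (m0 i); rewrite negbK.
have le_im : (U_(i) <= m)%MM by rewrite lep1mP.
rewrite -(submK le_im) addmC mpolyXD; apply: PX; apply: IHd.
by move: md; rewrite -{1}(submK le_im) mdegD mdeg1 addn1 => -[].
Qed.

Lemma mcoeff_XM i f m :
  ('X_i * f)@_m = if m i == 0%N then 0 else f@_(m - U_(i)).
Proof.
rewrite mulrC; case: eqP => [mi0|/eqP mi].
  apply/memN_msupp_eq0/negP; rewrite (perm_mem (msuppMX _ _)).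
  by case/mapP=> m' _ mE; move: mi0; rewrite mE mnmDE mnm1E eqxx.
by rewrite -{1}(@submK _ U_(i)%MM m) ?lep1mP // addmC mcoeffMX.
Qed.

Lemma mderiv_XM i j f :
  ('X_i * f)^`M(j) = (i == j)%:R *: f + 'X_i * f^`M(j).
Proof.
rewrite mderivM mderivX mnm1E; congr (_ + _).
case: eqP => [->|_]; last by rewrite !scale0r mul0r.
have -> : (U_(j) - U_(j) = 0 :> 'X_{1..n})%MM by apply/mnmP=> l; rewrite mnmBE mnm0E subnn.
by rewrite mpolyX0 scale1r mul1r scale1r.
Qed.

Lemma mcoeff_pihomog d f m :
  (pihomog mdeg d f)@_m = if mdeg m == d then f@_m else 0.
Proof.
rewrite {2}(mpolyE f) /pihomog !raddf_sum /= big_mkcond /=.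
case: ifP => md.
  apply: eq_bigr => m' _; rewrite !mcoeffZ !mcoeffX.
  by case: (eqVneq m' m) => [->|_]; rewrite ?md // mulr0 if_same.
apply: big1 => m' _; rewrite !mcoeffZ !mcoeffX.
by case: (eqVneq m' m) => [->|_]; rewrite ?md // mulr0 if_same.
Qed.

Lemma pihomog_XM d i f :
  pihomog mdeg d.+1 ('X_i * f) = 'X_i * pihomog mdeg d f.
Proof.
apply/mpolyP=> m; rewrite mcoeff_pihomog !mcoeff_XM mcoeff_pihomog.
case: (eqVneq (m i) 0%N) => [_|mi]; first by rewrite if_same.
by rewrite -{1}(@submK _ U_(i)%MM m) ?lep1mP // mdegD mdeg1 addn1.
Qed.

Lemma pihomog0_XM i f : pihomog mdeg 0 ('X_i * f) = 0.
Proof.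
apply/mpolyP=> m; rewrite mcoeff_pihomog mcoeff_XM mcoeff0 mdeg_eq0.
by case: (eqVneq m 0%MM) => // ->; rewrite mnm0E.
Qed.

Lemma pihomog1 d : pihomog mdeg d (1 : {mpoly K[n]}) = if d == 0%N then 1 else 0.
Proof. by rewrite -mpolyX0 pihomogX /= mdeg0 eq_sym. Qed.

Section Lift.
Variables (V : lmodType K) (F : 'X_{1..n} -> V).

(** Linear extension from the monomials; it yields division by a variable, the Fischer product and
    the Gaussian functional. *)
Definition mlift f : V := \sum_(m <- msupp f) f@_m *: F m.

Lemma mliftE d f : (msize f <= d)%N ->
  mlift f = \sum_(m : 'X_{1..n < d}) f@_m *: F m.
Proof.
move=> le_fd; rewrite /mlift (big_mksub 'X_{1..n < d}) ?msupp_uniq //=; first last.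
  by move=> x /msize_mdeg_lt /leq_trans; apply.
by rewrite big_rmcond //= => j /memN_msupp_eq0 ->; rewrite scale0r.
Qed.

Lemma mlift_is_linear : linear mlift.
Proof.
move=> c f g; pose d := maxn (msize (c *: f + g)) (maxn (msize f) (msize g)).
rewrite !(@mliftE d) ?leq_max ?leqnn ?orbT // scaler_sumr -big_split /=.
by apply: eq_bigr => m _; rewrite linearP /= scalerDl scalerA.
Qed.
HB.instance Definition _ :=
  GRing.isLinear.Build K {mpoly K[n]} V _ mlift mlift_is_linear.

Lemma mliftX m : mlift 'X_[m] = F m.
Proof. by rewrite /mlift msuppX big_seq1 mcoeffX eqxx scale1r. Qed.
End Lift.

(** A left inverse of multiplication by ['X_i]. *)
Definition mquo i : {mpoly K[n]} -> {mpoly K[n]} :=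
  mlift (fun m => if m i == 0%N then 0 else 'X_[m - U_(i)]).
HB.instance Definition _ i := GRing.Linear.on (mquo i).

Lemma mcoeff_mquo i f m : (mquo i f)@_m = f@_(m + U_(i)).
Proof.
rewrite {2}(mpolyE f) /mquo /mlift !raddf_sum /=.
apply: eq_bigr => m' _; rewrite !mcoeffZ mcoeffX; congr (_ * _).
case: eqP => [m'i|/eqP m'i]; last first.
  rewrite mcoeffX -(eqm_add2r U_(i)%MM) submK // lep1mP //.
rewrite mcoeff0; case: eqP => // m'E.
by move: m'i; rewrite m'E mnmDE mnm1E eqxx addn1.
Qed.

End MpolyLinear.

Section Equivariance.
Variables (R : realType) (p q k : nat).
Local Notation P := (fock R p q k).
Local Notation I := ('I_p * 'I_q)%type.
Implicit Types (g : 'M[R]_(p + q)) (f : P) (x y : I).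

(* Operators on forms and polynomials are locked because unification would
   otherwise unfold multivariate polynomials and diverge.                     *)
Fact zmul_key : unit. Proof. exact: tt. Qed.
Definition zmul : 'I_(p + q) -> 'I_k -> P -> P :=
  locked_with zmul_key (fun i j f => z_ R i j * f : P).
Fact zder_key : unit. Proof. exact: tt. Qed.
Definition zder : 'I_(p + q) -> 'I_k -> P -> P :=
  locked_with zder_key (fun i j f => f^`M(mxvec_index i j) : P).

Lemma zmulE i j f : zmul i j f = z_ R i j * f.
Proof. by rewrite /zmul unlock. Qed.

Lemma zderE i j f : zder i j f = f^`M(mxvec_index i j).
Proof. by rewrite /zder unlock. Qed.

Lemma zmulC i j i' j' f : zmul i j (zmul i' j' f) = zmul i' j' (zmul i j f).
Proof. by rewrite !zmulE; apply: mulrCA. Qed.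

Lemma zmul_is_linear i j : linear (zmul i j).
Proof. by move=> c u v; rewrite !zmulE mulrDr scalerAr. Qed.
HB.instance Definition _ i j :=
  GRing.isLinear.Build R[i] P P _ (zmul i j) (zmul_is_linear i j).

Lemma zder_is_linear i j : linear (zder i j).
Proof. by move=> c u v; rewrite !zderE linearP. Qed.
HB.instance Definition _ i j :=
  GRing.isLinear.Build R[i] P P _ (zder i j) (zder_is_linear i j).

(** The common shape of the quadrics and of the dual second-order operators, so that commutation and
    equivariance are proved once for both. *)
Definition contract (O : 'I_(p + q) -> 'I_k -> {linear P -> P}) x f : P :=
  \sum_j O (lshift q x.1) j (O (rshift p x.2) j f).

Lemma contract_is_linear O x : linear (contract O x).
Proof.
move=> c u v; rewrite /contract scaler_sumr -big_split /=.
by apply: eq_bigr => j _; rewrite !linearP.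
Qed.
HB.instance Definition _ O x :=
  GRing.isLinear.Build R[i] P P _ (contract O x) (contract_is_linear O x).

Lemma contractC (O : 'I_(p + q) -> 'I_k -> {linear P -> P}) x y f :
    (forall i j i' j' h, O i j (O i' j' h) = O i' j' (O i j h)) ->
  contract O x (contract O y f) = contract O y (contract O x f).
Proof.
move=> OC; rewrite /contract.
under eq_bigr => j _ do rewrite !linear_sum.
under [RHS]eq_bigr => j _ do rewrite !linear_sum.
rewrite exchange_big; apply: eq_bigr => j _; apply: eq_bigr => i _ /=.
rewrite [O (rshift p x.2) _ (O (lshift q y.1) _ _)]OC.
rewrite [O (lshift q x.1) _ (O (lshift q y.1) _ _)]OC.
by congr (O _ _ _); rewrite [O (rshift p x.2) _ (O _ _ _)]OC OC.
Qed.

Definition qmul x : P -> P := contract zmul x.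
Definition lap x : P -> P := contract zder x.
HB.instance Definition _ x := GRing.Linear.on (qmul x).
HB.instance Definition _ x := GRing.Linear.on (lap x).

Lemma inK_inv g : inK g -> invmx g = g^T.
Proof.
move=> [a [b [[aa _] [bb _] ->]]].
have gg : block_mx a 0 0 b *m (block_mx a 0 0 b)^T = 1%:M.
  rewrite tr_block_mx !trmx0 mulmx_block !(mulmx0, mul0mx) aa bb !addr0 !add0r.
  by rewrite -scalar_mx_block.
by have [gU _] := mulmx1_unit gg; rewrite -[RHS](mulKmx gU) gg mulmx1.
Qed.

Lemma inK_unit g : inK g -> g *m g^T = 1%:M.
Proof.
move=> [a [b [[aa _] [bb _] ->]]].
rewrite tr_block_mx !trmx0 mulmx_block !(mulmx0, mul0mx) aa bb !addr0 !add0r.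
by rewrite -scalar_mx_block.
Qed.

Lemma inK_row g l l' : inK g -> \sum_i g l i * g l' i = (l == l')%:R.
Proof.
move=> /inK_unit gg; have := congr1 (fun M : 'M_(p + q) => M l l') gg.
by rewrite !mxE => <-; apply: eq_bigr => i _; rewrite mxE.
Qed.

Lemma fock_act1 g : fock_act g 1 = 1 :> P.
Proof. exact: comp_mpoly1. Qed.

Lemma fock_actM g (f h : P) :
  fock_act g (f * h : {mpoly R[i][(p + q) * k]}) =
  fock_act g f * fock_act g h :> {mpoly R[i][(p + q) * k]}.
Proof. exact: rmorphM. Qed.

Lemma fock_act_z g i j : inK g ->
  fock_act g (z_ R i j) = \sum_l (g l i)%:C *: z_ R l j :> P.
Proof.
move=> gK; rewrite /fock_act /z_ comp_mpolyXU -tnth_nth tnth_mktuple mxvecE mxE.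
by apply: eq_bigr => l _; rewrite inK_inv // !mxE mul_mpolyC.
Qed.

Lemma fock_act_zmul g i j f : inK g ->
  fock_act g (zmul i j f) = \sum_l (g l i)%:C *: zmul l j (fock_act g f).
Proof.
move=> gK; rewrite zmulE fock_actM fock_act_z // mulr_suml.
by apply: eq_bigr => l _; rewrite zmulE -scalerAl.
Qed.

Lemma fock_ind (Q : P -> Prop) :
    (forall c f h, Q f -> Q h -> Q (c *: f + h)) ->
    Q 1 -> (forall i j f, Q f -> Q (zmul i j f)) ->
  forall f, Q f.
Proof.
move=> Qlin Q1 QX; apply: mpoly_ind_lin => // l f Qf.
by case/mxvec_indexP: l => i j; rewrite -[_ * _]zmulE; apply: QX.
Qed.

Lemma zder_zmul i j l j' f : zder l j' (zmul i j f) =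
  ((i == l) && (j == j'))%:R *: f + zmul i j (zder l j' f).
Proof.
rewrite !zderE !zmulE mderiv_XM; congr (_%:R *: _ + _).
by rewrite (inj_eq (can_inj (cast_ordK _))) (inj_eq enum_rank_inj) xpair_eqE.
Qed.

Lemma zder1 i j : zder i j 1 = 0.
Proof. by rewrite zderE -mpolyC1 mderivC. Qed.

(** The law is stated with [O] applied after [U], the form that [mulop_act] and [iotaop_act] ask of
    coefficient operators. *)
Definition covariant (g : 'M[R]_(p + q)) (U : P -> P)
    (O : 'I_(p + q) -> 'I_k -> P -> P) : Prop :=
  forall l j f, O l j (U f) = \sum_i (g l i)%:C *: U (O i j f).

Section Covariance.
Variables (g : 'M[R]_(p + q)) (U : {linear P -> P}).
Hypothesis gg : forall l l', \sum_i g l i * g l' i = (l == l')%:R.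
Hypothesis U1 : U 1 = 1.
Hypothesis UZ : forall i j f,
  U (zmul i j f) = \sum_l (g l i)%:C *: zmul l j (U f).

Lemma zmul_covariant : covariant g U zmul.
Proof.
move=> l j f.
under eq_bigr => i _.
  rewrite UZ scaler_sumr.
  under eq_bigr => l' _ do rewrite scalerA -rmorphM.
  over.
rewrite exchange_big (bigD1 l) //= [X in _ + X]big1 ?addr0 => [|l' neq_l'].
  by rewrite -scaler_suml -rmorph_sum /= gg // eqxx scale1r.
rewrite -scaler_suml -rmorph_sum /= gg //.
by rewrite eq_sym (negbTE neq_l') scale0r.
Qed.

(** The chain rule for a linear substitution, propagated from 1 through the commutator
    [zder_zmul]. *)
Lemma zder_covariant : covariant g U zder.
Proof.
move=> l j f; elim/fock_ind: f => [c f h IHf IHh||i' j' f IH].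
- rewrite !linearP /= IHf IHh [c *: (\sum_i _)]scaler_sumr -big_split.
  by apply: eq_bigr => i _; rewrite !linearP /=.
- rewrite U1 zder1 big1 // => i _.
  by rewrite zder1 linear0 scaler0.
rewrite UZ linear_sum /=.
under eq_bigr => l' _ do rewrite linearZ /= zder_zmul IH scalerDr.
rewrite big_split /=.
under [RHS]eq_bigr => i _ do rewrite zder_zmul linearD linearZ scalerDr.
rewrite big_split /=; congr (_ + _).
  rewrite (bigD1 l) //= [X in _ + X]big1 ?addr0 => [|l' neq_l']; last first.
    by rewrite (negbTE neq_l') scale0r scaler0.
  rewrite [RHS](bigD1 i') //= [X in _ = _ + X]big1 ?addr0 => [|i neq_i].
    by rewrite !eqxx.
  by rewrite eq_sym (negbTE neq_i) scale0r scaler0.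
under eq_bigr => l' _ do rewrite linear_sum scaler_sumr.
rewrite exchange_big; apply: eq_bigr => i _ /=.
under eq_bigr => l' _ do rewrite linearZ /= scalerA mulrC -scalerA.
by rewrite -scaler_sumr UZ.
Qed.
End Covariance.

Lemma zmul_act g : inK g -> covariant g (fock_act g) zmul.
Proof.
move=> gK; apply: zmul_covariant => [l l'|i j f]; first exact: inK_row.
exact: fock_act_zmul.
Qed.

Lemma zder_act g : inK g -> covariant g (fock_act g) zder.
Proof.
move=> gK; apply: zder_covariant => [|i j f]; first exact: fock_act1.
exact: fock_act_zmul.
Qed.

Lemma coad_orth g x y : inK g ->
  \sum_w coad g x w * coad g y w = (x == y)%:R.
Proof.
move=> [a [b [aS bS ->]]].
have orth n (c : 'M[R]_n) i j : inSO c -> \sum_l c l i * c l j = (i == j)%:R.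
  move=> [/mulmx1C cc _]; have := congr1 (fun M : 'M_n => M i j) cc.
  by rewrite !mxE => <-; apply: eq_bigr => l _; rewrite mxE.
under eq_bigr => w _ do rewrite !coadE // -rmorphM /= mulrACA.
rewrite -rmorph_sum /= -(pair_bigA _ (fun i j => a i x.1 * a i y.1 * (b j x.2 * b j y.2))) /=.
under eq_bigr => i _ do rewrite -mulr_sumr orth //.
rewrite -mulr_suml orth // -natrM mulnb -[RHS](rmorph_nat (real_complex R)).
by case: x y => [x1 x2] [y1 y2]; rewrite xpair_eqE.
Qed.

(** Since [g] is block diagonal, the two factors mix only left, respectively right indices, and the
    product of the two entries is an entry of [coad g]. *)
Lemma contract_act (O : _ -> _ -> {linear P -> P}) g (U : {linear P -> P}) y f :
    covariant g U O -> inK g ->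
  contract O y (U f) = \sum_x coad g x y *: U (contract O x f).
Proof.
move=> Ocov gK; have [a [b [aS bS gE]]] := gK.
rewrite -(pair_bigA _ (fun i j => coad g (i, j) y *: U (contract O (i, j) f))) /=.
rewrite /contract /=.
under [RHS]eq_bigr => i _ do under eq_bigr => m _ do rewrite linear_sum scaler_sumr.
under [RHS]eq_bigr => i _ do rewrite exchange_big.
rewrite [RHS]exchange_big; apply: eq_bigr => j _ /=.
rewrite Ocov big_split_ord /= [X in X + _]big1 ?add0r => [|i _]; last first.
  by rewrite gE block_mxEdl mxE scale0r.
rewrite linear_sum [RHS]exchange_big; apply: eq_bigr => m _ /=.
rewrite linearZ /= Ocov big_split_ord /= [X in _ + X]big1 ?addr0 => [|i _]; last first.
  by rewrite gE block_mxEur mxE scale0r.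
rewrite scaler_sumr; apply: eq_bigr => i _.
by rewrite gE coadE // block_mxEul block_mxEdr scalerA -rmorphM mulrC.
Qed.
End Equivariance.

(** * Hodge theory for equivariant primitives *)

Section InjectiveSurjective.
Variables (K : fieldType) (V : lmodType K) (T : {linear V -> V}).

(** A polynomial in [T], with coefficients [s] from the constant term up, applied to [v]. *)
Definition horner_op (s : seq K) (v : V) : V :=
  foldr (fun c w => c *: v + T w) 0 s.

Lemma horner_opE s v :
  horner_op s v = \sum_(i < size s) s`_i *: iter i T v.
Proof.
elim: s => [|c s IHs] /=; first by rewrite big_ord0.
rewrite big_ord_recl /= IHs linear_sum; congr (_ + _).
by apply: eq_bigr => i _; rewrite linearZ.
Qed.

Lemma horner_op_closed (Q : V -> Prop) s v :
    (forall c u w, Q u -> Q w -> Q (c *: u + w)) ->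
    (forall u, Q u -> Q (T u)) ->
  Q v -> Q (horner_op s v).
Proof.
move=> Qlin QT Qv; elim: s => [|c s IHs] /=; last by apply: Qlin => //; apply: QT.
by rewrite -(subrr v) -[- v]scaleN1r addrC; apply: Qlin.
Qed.

(** The iterates of [v] under [T] lie in the span of [b], so they satisfy a linear relation.
    Injectivity strips powers of [T] from it until the constant coefficient is nonzero; solving for
    [v] then inverts [T]. *)
Lemma exists_horner_op_inverse (X : V -> Prop) (b : seq V) v :
    (forall u, X u -> exists c : 'I_(size b) -> K, u = \sum_i c i *: b`_i) ->
    (forall c u w, X u -> X w -> X (c *: u + w)) ->
    (forall u, X u -> X (T u)) ->
    (forall u, X u -> T u = 0 -> u = 0) ->
  X v -> exists s, v = T (horner_op s v).
Proof.
move=> Xspan Xlin XT Tinj Xv.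
have Xiter i : X (iter i T v) by elim: i => //= i; apply: XT.
have [A AE] : exists A : 'M[K]_((size b).+1, size b), forall i : 'I_(size b).+1,
    iter i T v = \sum_j A i j *: b`_j.
  have [A AE] := choice (fun i : 'I_(size b).+1 => Xspan _ (Xiter i)).
  exists (\matrix_(i, j) A i j) => i; rewrite AE.
  by apply: eq_bigr => j _; rewrite mxE.
(* There is one more iterate than spanning vectors, so the coordinate matrix has a nonzero left
   kernel. *)
have /rowV0Pn[u /sub_kermxP uA u_neq0] : kermx A != 0.
  rewrite kermx_eq0 /row_free; apply: contraTneq (rank_leq_col A) => ->.
  by rewrite ltnn.
pose s := [seq u ord0 i | i <- enum 'I_(size b).+1].
have s_neq0 : has (fun c => c != 0) s.
  apply: contra_neqT u_neq0; rewrite -all_predC => /allP s0.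
  apply/rowP=> i; rewrite mxE; apply/eqP; rewrite -[_ == _]negbK; apply: s0.
  by apply/mapP; exists i; rewrite ?mem_enum.
have sE : horner_op s v = 0.
  rewrite horner_opE size_map size_enum_ord.
  transitivity (\sum_i u ord0 i *: \sum_j A i j *: b`_j).
    apply: eq_bigr => i _; rewrite -AE (nth_map ord0) ?size_enum_ord //.
    by rewrite nth_ord_enum.
  under eq_bigr => i _ do rewrite scaler_sumr.
  rewrite exchange_big big1 // => j _ /=.
  under eq_bigr => i _ do rewrite scalerA.
  have := congr1 (fun M : 'rV_(size b) => M ord0 j) uA.
  by rewrite -scaler_suml !mxE => ->; rewrite scale0r.
elim: s s_neq0 sE => //= c s IHs.
have [->|c0] /= := eqVneq c 0.
  rewrite scale0r add0r => s_neq0 /Tinj s0; apply: IHs => //; apply: s0.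
  exact: horner_op_closed.
move=> _ /eqP; rewrite addr_eq0 => /eqP cvE.
exists [seq - c^-1 * a | a <- s].
have -> : horner_op [seq - c^-1 * a | a <- s] v = - c^-1 *: horner_op s v.
  elim: (s) => /= [|a r ->]; first by rewrite scaler0.
  by rewrite scalerDr scalerA linearZ.
by rewrite linearZ /= scaleNr -scalerN -cvE scalerA mulVf // scale1r.
Qed.
End InjectiveSurjective.

Section Hodge.
Variables (C : numFieldType) (V : lmodType C) (d ds : {linear V -> V}).
Variable ip : V -> V -> C.
Hypothesis ipD : forall u v w, ip (u + v) w = ip u w + ip v w.
Hypothesis ip_ge0 : forall v, 0 <= ip v v.
Hypothesis ip_eq0 : forall v, ip v v = 0 -> v = 0.
Hypothesis ipd : forall u v, ip (d u) v = ip u (ds v).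
Hypothesis ipds : forall u v, ip (ds u) v = ip u (d v).
Hypothesis dd : forall v, d (d v) = 0.

Lemma ip0 w : ip 0 w = 0.
Proof. by apply: (addrI (ip 0 w)); rewrite -ipD !addr0. Qed.

Definition hodge v := d (ds v) + ds (d v).

Lemma hodge_is_linear : linear hodge.
Proof.
by move=> c u v; rewrite /hodge !linearP /= scalerDr addrACA.
Qed.
HB.instance Definition _ := GRing.isLinear.Build C V V _ hodge hodge_is_linear.

Lemma hodge_eq0 v : hodge v = 0 -> d v = 0 /\ ds v = 0.
Proof.
move=> hv; have : ip (hodge v) v == 0 by rewrite hv ip0.
rewrite /hodge ipD (ipd (ds v)) (ipds (d v)) paddr_eq0 // => /andP[/eqP/ip_eq0 -> /eqP/ip_eq0 ->].
by [].
Qed.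

(* On a finite-dimensional space on which every d-cocycle is exact, the
   Laplacian is injective, hence invertible by a polynomial in itself; so the
   primitive of v obtained from it inherits all the invariance of v.          *)
Lemma hodge_primitive (X : V -> Prop) (b : seq V) v :
    (forall u, X u -> exists c : 'I_(size b) -> C, u = \sum_i c i *: b`_i) ->
    (forall c u w, X u -> X w -> X (c *: u + w)) ->
    (forall u, X u -> X (hodge u)) ->
    (forall u, X u -> d u = 0 -> exists w, u = d w) ->
    X v -> d v = 0 ->
  exists2 w, v = d (ds w) & forall Q : V -> Prop,
    (forall c u w, Q u -> Q w -> Q (c *: u + w)) ->
    (forall u, Q u -> Q (hodge u)) -> Q v -> Q w.
Proof.
move=> Xspan Xlin Xhodge exact_d Xv dv.
have hodge_inj u : X u -> hodge u = 0 -> u = 0.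
  move=> Xu /hodge_eq0[du dsu]; apply: ip_eq0.
  have [w uE] := exact_d u Xu du.
  by rewrite {2}uE -ipds dsu ip0.
have [s vE] := @exists_horner_op_inverse _ _ hodge X b v Xspan Xlin Xhodge hodge_inj Xv.
exists (horner_op hodge s v); last first.
  by move=> Q Qlin Qh Qv; apply: horner_op_closed.
move: (horner_op _ s v) vE => w /= vE; rewrite {1}vE /hodge.
suff -> : ds (d w) = 0 by rewrite addr0.
(* Applying [d] to the equation for [v] leaves [d (ds (d w)) = 0], and the product of [ds (d w)]
   with itself equals that of [d (ds (d w))] with [d w]. *)
apply: ip_eq0; rewrite -ipd.
by move: dv; rewrite vE /hodge linearD dd add0r /= => ->; rewrite ip0.
Qed.
End Hodge.

(** * Exterior multiplications and contractions with operator coefficients *)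

Section ExtOperators.
Variables (F : comNzRingType) (I : finType) (M : lmodType F).
Variable D : I -> {linear M -> M}.
Local Notation E := (ext I M).
Implicit Types (phi : E).

(** The common form of [kappa], [delta] and [eta]; its companion [iotaop] gives [kappa_adj]. *)
Definition mulop phi : E := \sum_x ext_mulb x (ext_map (D x) phi).
Definition iotaop phi : E := \sum_x ext_iotab x (ext_map (D x) phi).

Lemma mulop_is_linear : linear mulop.
Proof.
move=> a u v; rewrite /mulop scaler_sumr -big_split /=.
by apply: eq_bigr => x _; rewrite !linearP.
Qed.
HB.instance Definition _ := GRing.isLinear.Build F E E _ mulop mulop_is_linear.

Lemma iotaop_is_linear : linear iotaop.
Proof.
move=> a u v; rewrite /iotaop scaler_sumr -big_split /=.
by apply: eq_bigr => x _; rewrite !linearP.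
Qed.
HB.instance Definition _ :=
  GRing.isLinear.Build F E E _ iotaop iotaop_is_linear.

Lemma mulop_homog l phi : ext_homog l phi -> ext_homog l.+1 (mulop phi).
Proof.
move=> phil S Sl; rewrite sum_ffunE big1 // => x _; rewrite ffunE.
case: ifP => // xS; rewrite ffunE phil ?linear0 ?scaler0 //.
by apply: contraNneq Sl => <-; rewrite (cardsD1 x S) xS.
Qed.

Lemma iotaop_homog l phi : ext_homog l.+1 phi -> ext_homog l (iotaop phi).
Proof.
move=> phil S Sl; rewrite sum_ffunE big1 // => x _; rewrite ffunE.
case: ifP => // xS; rewrite ffunE phil ?linear0 ?scaler0 //.
by rewrite cardsU1 xS eqSS.
Qed.

Lemma iotaop_homog0 phi : ext_homog 0 phi -> iotaop phi = 0.
Proof.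
move=> phi0; apply/ffunP=> S; rewrite sum_ffunE ffunE big1 // => x _.
rewrite ffunE; case: ifP => // xS; rewrite ffunE phi0 ?linear0 ?scaler0 //.
by rewrite cardsU1 xS.
Qed.

Lemma mulop_act (c : I -> I -> F) (rho : {linear M -> M}) phi :
    (forall y f, D y (rho f) = \sum_x c x y *: rho (D x f)) ->
  mulop (ext_act c rho phi) = ext_act c rho (mulop phi).
Proof.
move=> Dact; rewrite /mulop (linear_sum (ext_act c rho : {linear E -> E})) /=.
under eq_bigr => y _ do rewrite (ext_map_act _ _ (Dact y)) linear_sum.
rewrite exchange_big; apply: eq_bigr => x _ /=.
by rewrite ext_act_mulb /ext_mul; apply: eq_bigr => y _; rewrite linearZ.
Qed.

Lemma iotaop_act (c : I -> I -> F) (rho : {linear M -> M}) phi :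
    (forall y f, D y (rho f) = \sum_x c x y *: rho (D x f)) ->
    (forall x y, \sum_w c x w * c y w = (x == y)%:R) ->
  iotaop (ext_act c rho phi) = ext_act c rho (iotaop phi).
Proof.
move=> Dact cc; rewrite /iotaop (linear_sum (ext_act c rho : {linear E -> E})) /=.
under eq_bigr => y _ do rewrite (ext_map_act _ _ (Dact y)) linear_sum.
rewrite exchange_big; apply: eq_bigr => x _ /=.
rewrite -ext_iota_act // /ext_iota; apply: eq_bigr => y _.
by rewrite linearZ.
Qed.
End ExtOperators.

Section ExtOperatorProducts.
Variables (F : comNzRingType) (I : finType) (M : lmodType F).
Local Notation E := (ext I M).
Implicit Types (phi : E) (D : I -> {linear M -> M}).

Lemma mulop_mulop D D' phi : mulop D (mulop D' phi) =
  \sum_x \sum_y ext_mulb x (ext_mulb y (ext_map (D x) (ext_map (D' y) phi))).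
Proof.
apply: eq_bigr => x _; rewrite /mulop !linear_sum; apply: eq_bigr => y _.
by rewrite /= ext_map_mulb.
Qed.

Lemma mulop_anticomm D D' phi :
  mulop D (mulop D' phi) + mulop D' (mulop D phi) =
  \sum_x \sum_y ext_mulb x (ext_mulb y
    (ext_map (D x) (ext_map (D' y) phi) - ext_map (D' y) (ext_map (D x) phi))).
Proof.
have -> : mulop D' (mulop D phi) = \sum_x \sum_y
    - ext_mulb x (ext_mulb y (ext_map (D' y) (ext_map (D x) phi))).
  rewrite mulop_mulop exchange_big; apply: eq_bigr => x _.
  by apply: eq_bigr => y _; apply: ext_mulbC.
rewrite mulop_mulop -big_split; apply: eq_bigr => x _.
by rewrite -big_split; apply: eq_bigr => y _; rewrite !linearB.
Qed.

(** For [u] a division operator, this computes how far contraction combined with division is from a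
    homotopy for [mulop D]: the first term comes from the Clifford relation, the sum measures the
    failure of [u] to commute with [D]. *)
Lemma mulop_iotab_anticomm D (u : {linear M -> M}) x phi :
  mulop D (ext_iotab x (ext_map u phi)) + ext_iotab x (ext_map u (mulop D phi)) =
  ext_map u (ext_map (D x) phi) +
  \sum_y ext_mulb y (ext_iotab x
    (ext_map (D y) (ext_map u phi) - ext_map u (ext_map (D y) phi))).
Proof.
have -> : ext_iotab x (ext_map u (mulop D phi)) =
    \sum_y ((x == y)%:R *: ext_map u (ext_map (D y) phi)
      - ext_mulb y (ext_iotab x (ext_map u (ext_map (D y) phi)))).
  rewrite /mulop !linear_sum; apply: eq_bigr => y _ /=.
  by rewrite ext_map_mulb ext_iotab_mulb.
rewrite sumrB (bigD1 x) //= eqxx scale1r [X in _ + (_ + X - _)]big1 ?addr0.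
  rewrite addrCA -sumrB; congr (_ + _); apply: eq_bigr => y _.
  by rewrite ext_map_iotab !linearB.
by move=> y neq_y; rewrite eq_sym (negbTE neq_y) scale0r.
Qed.

End ExtOperatorProducts.

Section AlternatingSquare.
Variables (C : numFieldType) (I : finType) (M : lmodType C).
Variable D : I -> {linear M -> M}.

Lemma mulop_sq0 (phi : ext I M) :
  (forall x y f, D x (D y f) = D y (D x f)) -> mulop D (mulop D phi) = 0.
Proof.
move=> DC; have kN : mulop D (mulop D phi) = - mulop D (mulop D phi).
  rewrite {1}mulop_mulop exchange_big mulop_mulop -sumrN; apply: eq_bigr => x _.
  rewrite -sumrN; apply: eq_bigr => y _.
  rewrite ext_mulbC; congr (- ext_mulb _ (ext_mulb _ _)).
  by apply/ffunP=> S; rewrite !ffunE.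
apply/eqP; move/eqP: kN; rewrite -addr_eq0 -mulr2n -scaler_nat scaler_eq0.
by rewrite pnatr_eq0.
Qed.
End AlternatingSquare.

(** * Exactness of the Koszul differential *)

Section Telescope.
Variables (K : nzRingType) (V : lmodType K) (d : {linear V -> V}).
Hypothesis dd : forall v, d (d v) = 0.
Implicit Types (s : {linear V -> V}) (L : seq {linear V -> V}).

(** A map homotopic to the identity; applying several in turn gives another one, as
    [total_homotopyE] records. *)
Definition homotopy_defect s v := v - (d (s v) + s (d v)).

Fixpoint total_defect L v :=
  if L is s :: L' then total_defect L' (homotopy_defect s v) else v.

Fixpoint total_homotopy L v :=
  if L is s :: L' then s v + total_homotopy L' (homotopy_defect s v) else 0.

Lemma total_homotopyE L v :
  v = total_defect L v + (d (total_homotopy L v) + total_homotopy L (d v)).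
Proof.
elim: L v => [|s L IHL] v /=; first by rewrite linear0 !addr0.
have comm : d (homotopy_defect s v) = homotopy_defect s (d v).
  by rewrite /homotopy_defect linearB linearD !dd linear0 add0r addr0.
rewrite -comm linearD addrACA.
transitivity (homotopy_defect s v + (d (s v) + s (d v))).
  by rewrite /homotopy_defect subrK.
by rewrite {1}(IHL (homotopy_defect s v)) -[LHS]addrA; congr (_ + _); rewrite addrC.
Qed.
End Telescope.

Section Koszul.
Variables (R : realType) (p q k : nat).
Hypothesis le_kq_p : (k * q <= p)%N.
Local Notation P := (fock R p q k).
Local Notation I := ('I_p * 'I_q)%type.
Local Notation B := ('I_k * 'I_q)%type.
Local Notation E := (ext I P).
Implicit Types (x y : I) (b : B) (S T : {set I}) (f : P) (phi : E).
Implicit Type m : 'X_{1..(p + q) * k}.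

Fact kappa_key : unit. Proof. exact: tt. Qed.
Definition kappa : E -> E := locked_with kappa_key (mulop (@qmul R p q k)).

Lemma kappaE phi : kappa phi = mulop (@qmul R p q k) phi.
Proof. by rewrite /kappa unlock. Qed.

Lemma kappa_is_linear : linear kappa.
Proof. by move=> c u v; rewrite !kappaE linearP. Qed.
HB.instance Definition _ := GRing.isLinear.Build R[i] E E _ kappa kappa_is_linear.

Lemma diag_subproof b : (b.1 * q + b.2 < p)%N.
Proof.
apply: leq_trans le_kq_p; case: b => i n /=.
by rewrite -addnS (leq_trans (leq_add (leqnn _) (ltn_ord n))) // -mulSnr leq_mul2r ltn_ord orbT.
Qed.

Definition diag b : I := (Ordinal (diag_subproof b), b.2).

Lemma diag_div b : ((diag b).1 %/ q = b.1)%N.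
Proof.
have q_gt0 : (0 < q)%N by case: b => i [n /= /(leq_trans _)]; apply.
by rewrite /= divnMDl // divn_small ?addn0.
Qed.

Lemma diag_inj : injective diag.
Proof.
move=> b b' eq_b; have e2 := congr1 snd eq_b; have e1 := diag_div b.
rewrite eq_b diag_div in e1; case: b b' e1 e2 {eq_b} => [i n] [i' n'] /= e1 ->.
by congr (_, _); apply: val_inj.
Qed.

Definition diagonal : {set I} := [set diag b | b : B].

Lemma card_diagonal : #|diagonal| = (k * q)%N.
Proof. by rewrite card_imset ?card_prod ?card_ord //; apply: diag_inj. Qed.

Definition zidx2 x (j : 'I_k) : 'X_{1..(p + q) * k} :=
  (U_(mxvec_index (lshift q x.1) j) + U_(mxvec_index (rshift p x.2) j))%MM.

Lemma mcoeff_qmul x f m : (qmul x f)@_m =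
  \sum_j if (zidx2 x j <= m)%MM then f@_(m - zidx2 x j) else 0.
Proof.
rewrite /qmul /contract raddf_sum /=; apply: eq_bigr => j _.
rewrite !zmulE !mcoeff_XM.
have neq_idx : mxvec_index (lshift q x.1) j != mxvec_index (rshift p x.2) j.
  rewrite (inj_eq (can_inj (cast_ordK _))) (inj_eq enum_rank_inj) xpair_eqE.
  by rewrite eq_lrshift.
rewrite submDA mnmBE mnm1E (negbTE neq_idx) subn0.
set u := mxvec_index _ _ in neq_idx *; set v := mxvec_index _ _ in neq_idx *.
have -> : (zidx2 x j <= m)%MM = (m u != 0%N) && (m v != 0%N).
  apply/mnm_lepP/andP => [le_m|[mu mv] i].
    split; rewrite -lt0n; apply: leq_trans (le_m _); rewrite mnmDE !mnm1E eqxx //.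
    by rewrite addn1.
  rewrite mnmDE !mnm1E -/u -/v.
  case: (eqVneq u i) => [<-|_]; last by case: eqVneq => [<-|] //=; rewrite lt0n.
  by rewrite eq_sym (negbTE neq_idx) addn0 lt0n.
by case: eqP; case: eqP.
Qed.

(* Division by z_(jq + m, j) z_(m, j), for b = (j, m): monomials that are not
   multiples of it are sent to 0.                                             *)
Definition udiv b f : P :=
  mquo (mxvec_index (lshift q (diag b).1) b.1)
    (mquo (mxvec_index (rshift p (diag b).2) b.1) f).

Lemma udiv_is_linear b : linear (udiv b).
Proof. by move=> c f h; rewrite /udiv !linearP. Qed.
HB.instance Definition _ b :=
  GRing.isLinear.Build R[i] P P _ (udiv b) (udiv_is_linear b).

Lemma mcoeff_udiv b f m : (udiv b f)@_m = f@_(m + zidx2 (diag b) b.1).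
Proof. by rewrite !mcoeff_mquo -addmA. Qed.

(** Weight 2 marks, in row [jq + m], the variable of column [j]; this makes the summand [j] of the
    diagonal quadric the leading one. *)
Definition var_weight (i : 'I_(p + q)) (j : 'I_k) : nat :=
  (1 + ((i < p) && (i %/ q == j)))%N.

Definition mnm_weight m : nat :=
  (\sum_i \sum_j m (mxvec_index i j) * var_weight i j)%N.

Lemma mnm_weightD m m' :
  mnm_weight (m + m')%MM = (mnm_weight m + mnm_weight m')%N.
Proof.
rewrite /mnm_weight -big_split; apply: eq_bigr => i _.
rewrite -big_split; apply: eq_bigr => j _ /=.
by rewrite mnmDE mulnDl.
Qed.

Lemma mnm_weight1 i j : mnm_weight U_(mxvec_index i j) = var_weight i j.
Proof.
have idxE i' j' :
    U_(mxvec_index i j)%MM (mxvec_index i' j') = ((i == i') && (j == j')) :> nat.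
  rewrite mnm1E (inj_eq (can_inj (cast_ordK _))) (inj_eq enum_rank_inj).
  by rewrite xpair_eqE.
rewrite /mnm_weight (bigD1 i) //= (bigD1 j) //= idxE !eqxx mul1n.
rewrite big1 => [|j' neq_j]; last by rewrite idxE [j == _]eq_sym (negbTE neq_j) andbF.
rewrite big1 ?addn0 // => i' neq_i; rewrite big1 // => j' _.
by rewrite idxE eq_sym (negbTE neq_i).
Qed.

Lemma weight_zidx2 x j :
  mnm_weight (zidx2 x j) = (2 + (x.1 %/ q == j :> nat))%N.
Proof.
rewrite mnm_weightD !mnm_weight1 /var_weight /= ltn_ord.
by rewrite ltnNge leq_addr addn0 addnC addnA.
Qed.

(** The cost sits on the elements outside [S], so that joining [S] lowers the weight while all
    values remain natural numbers. *)
Definition set_weight S : nat :=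
  (\sum_y if y \in S then (y \in diagonal : nat) else 4)%N.

Lemma set_weightU1 y S : y \notin S ->
  (set_weight (y |: S) + 4 = set_weight S + (y \in diagonal))%N.
Proof.
move=> yS; rewrite /set_weight !(bigD1 y (P := xpredT)) //= setU11 (negbTE yS).
rewrite [LHS]addnC [RHS]addnC addnCA; congr (_ + (_ + _))%N.
by apply: eq_bigr => w neq_w; rewrite !inE (negbTE neq_w).
Qed.

(* The monomial z_(a, j) z_(m, j) of the quadric of (a, m) has weight 3 if
   a %/ q = j, and 2 otherwise; moving y into S lowers set_weight by 3 if y is
   diagonal, and by 4 otherwise. So kappa does not raise the weight, and only
   the monomials z_(jq + m, j) z_(m, j) of diagonal quadrics can preserve it.  *)
Definition weight S m : nat := (mnm_weight m + set_weight S)%N.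

Definition weight_lt (W : nat) phi : Prop :=
  forall S m, (W <= weight S m)%N -> (phi S)@_m = 0.

Lemma weight_lt_exists phi : exists W, weight_lt W phi.
Proof.
exists (\max_S \max_(m <- msupp (phi S)) (weight S m).+1)%N => S m leW.
apply/memN_msupp_eq0/negP => mS.
have := leq_trans (leq_trans (leq_bigmax_seq _ mS isT) (leq_bigmax S)) leW.
by rewrite ltnn.
Qed.

Lemma kappa_coef phi S m : (kappa phi S)@_m =
  \sum_(y in S) (-1) ^+ ext_below y S *
    \sum_j if (zidx2 y j <= m)%MM then (phi (S :\ y))@_(m - zidx2 y j) else 0.
Proof.
rewrite kappaE /mulop sum_ffunE raddf_sum /= [RHS]big_mkcond /=.
apply: eq_bigr => y _; rewrite !ffunE; case: ifP => _; last by rewrite mcoeff0.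
by rewrite mcoeffZ mcoeff_qmul.
Qed.

Lemma weight_setD1 y S : y \in S ->
  (set_weight S + 4 = set_weight (S :\ y) + (y \in diagonal))%N.
Proof. by move=> yS; rewrite -set_weightU1 ?setD11 // setD1K. Qed.

Lemma mem_diagonal b : diag b \in diagonal.
Proof. exact: imset_f. Qed.

Lemma kappa_weight_lt W phi : weight_lt W phi -> weight_lt W (kappa phi).
Proof.
move=> phiW S m leW; rewrite kappa_coef big1 // => y yS.
rewrite big1 ?mulr0 // => j _; case: ifP => // le_m.
apply: phiW; apply: leq_trans leW _; rewrite /weight.
have := weight_setD1 yS; have := weight_zidx2 y j.
have := mnm_weightD (m - zidx2 y j) (zidx2 y j); rewrite submK // => -> ->.
move: (set_weight S) (set_weight (S :\ y)) (mnm_weight _) => a b c.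
by case: (y.1 %/ q == j :> nat)%N; case: (y \in diagonal) => /=; lia.
Qed.

Lemma kappa_kappa phi : kappa (kappa phi) = 0.
Proof.
rewrite !kappaE; apply: mulop_sq0 => x y f.
by apply: contractC => *; apply: zmulC.
Qed.

(** If the quadric of [b] were just its leading monomial, this would be the standard homotopy of its
    Koszul factor, up to the terms that this monomial does not divide. *)
Definition sop b phi : E := ext_iotab (diag b) (ext_map (udiv b) phi).

Lemma sop_is_linear b : linear (sop b).
Proof. by move=> c u v; rewrite /sop !linearP. Qed.
HB.instance Definition _ b :=
  GRing.isLinear.Build R[i] E E _ (sop b) (sop_is_linear b).

Lemma sop_coef b phi S m : (sop b phi S)@_m =
  if diag b \in S then 0
  else (-1) ^+ ext_below (diag b) S *
    (phi (diag b |: S))@_(m + zidx2 (diag b) b.1).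
Proof.
rewrite /sop !ffunE; case: ifP => _; first by rewrite mcoeff0.
by rewrite mcoeffZ mcoeff_udiv.
Qed.

(** The leading monomial weighs 3, exactly what [diag b] loses on entering the set; so the homotopy
    preserves the weight. *)
Lemma weight_diag b S m : diag b \notin S ->
  weight (diag b |: S) (m + zidx2 (diag b) b.1) = weight S m.
Proof.
move=> bS; rewrite /weight mnm_weightD weight_zidx2 diag_div eqxx.
have := set_weightU1 bS; rewrite mem_diagonal.
by move: (set_weight (_ |: _)) (set_weight S) (mnm_weight m) => a c d /=; lia.
Qed.

Lemma sop_weight_lt W b phi : weight_lt W phi -> weight_lt W (sop b phi).
Proof.
move=> phiW S m leW; rewrite sop_coef; case: (boolP (_ \in S)) => // bS.
by rewrite phiW ?mulr0 // weight_diag.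
Qed.

Lemma sop_homog l b phi : ext_homog l.+1 phi -> ext_homog l (sop b phi).
Proof.
move=> phil S Sl; rewrite !ffunE; case: ifP => // bS.
by rewrite phil ?linear0 ?scaler0 // cardsU1 bS eqSS.
Qed.

Lemma sop_homog0 b phi : ext_homog 0 phi -> sop b phi = 0.
Proof.
move=> phi0; apply/ffunP=> S; rewrite !ffunE; case: ifP => // bS.
by rewrite phi0 ?linear0 ?scaler0 // cardsU1 bS.
Qed.

Local Notation defect b := (homotopy_defect kappa (sop b)).

Lemma defectE b phi : defect b phi =
  phi - ext_map (udiv b) (ext_map (@qmul R p q k (diag b)) phi) -
  \sum_y ext_mulb y (ext_iotab (diag b)
    (ext_map (qmul y) (ext_map (udiv b) phi)
       - ext_map (udiv b) (ext_map (qmul y) phi))).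
Proof.
rewrite /homotopy_defect -[RHS]addrA -opprD; congr (_ - _).
by rewrite /= !kappaE; apply: mulop_iotab_anticomm.
Qed.

(** Multiplying by a monomial v before or after dividing by u makes a difference only where v
    divides u m without dividing m; coprime monomials never produce such a term. *)
Lemma mcoeff_comm y b f m :
  (qmul y (udiv b f) - udiv b (qmul y f))@_m =
  - \sum_j if (zidx2 y j <= m + zidx2 (diag b) b.1)%MM && ~~ (zidx2 y j <= m)%MM
      then f@_(m + zidx2 (diag b) b.1 - zidx2 y j) else 0.
Proof.
rewrite mcoeffB mcoeff_qmul mcoeff_udiv mcoeff_qmul -sumrB -sumrN.
apply: eq_bigr => j _; rewrite mcoeff_udiv.
case: (boolP (zidx2 y j <= m)%MM) => [le_m|_]; last by rewrite sub0r andbT.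
rewrite (lepm_trans le_m (lem_addr _ _)) andbF oppr0.
by rewrite [(m - _ + _)%MM]addmC addmBA // [(_ + m)%MM]addmC subrr.
Qed.

(** Two leading monomials share no variable: the rows [jq + m] are distinct, and so are the pairs
    [(m, j)]. *)
Lemma diag_disjoint b b' m : b != b' ->
  (zidx2 (diag b') b'.1 <= m + zidx2 (diag b) b.1)%MM ->
  (zidx2 (diag b') b'.1 <= m)%MM.
Proof.
move=> neq_b /mnm_lepP le_m; apply/mnm_lepP => i; have := le_m i.
rewrite !mnmDE !mnm1E; case/mxvec_indexP: i => r c.
rewrite !(inj_eq (can_inj (cast_ordK _))) !(inj_eq enum_rank_inj) !xpair_eqE.
have neq2 : ~~ ((b.1 == b'.1) && (b.2 == b'.2)).
  by rewrite -xpair_eqE -!surjective_pairing.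
have neq1 : (diag b).1 != (diag b').1.
  apply: contra neq2 => /eqP e1.
  have e2 : b.1 = b'.1 :> nat by rewrite -diag_div -(diag_div b') e1.
  have := congr1 val e1; rewrite /= e2 => /addnI e3.
  by apply/andP; split; apply/eqP/val_inj.
case: (split_ordP r) => [a ->|n ->].
  rewrite !eq_lshift !eq_rlshift /= !addn0.
  case: eqP => [<-|_] //=; rewrite (negbTE neq1) /= addn0.
  by case: eqP.
rewrite !eq_rshift !eq_lrshift /= !add0n.
case: eqP => [<-|_] //=; case: eqP => [<-|_] //=.
by rewrite andbC (negbTE neq2) addn0.
Qed.

(* On terms of top weight, kappa (sop b) + (sop b) kappa is the identity, except
   on those with diag b in S whose monomial the leading monomial of the quadric
   of b does not divide. When this holds for all b, S contains the diagonal.  *)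
Lemma defect_coef W b phi S m :
    weight_lt W.+1 phi -> (W <= weight S m)%N ->
  (defect b phi S)@_m =
  if (diag b \in S) && ~~ (zidx2 (diag b) b.1 <= m)%MM then (phi S)@_m else 0.
Proof.
move=> phiW leW; pose u := zidx2 (diag b) b.1.
have wu : mnm_weight u = 3%N by rewrite weight_zidx2 diag_div eqxx.
(* Trading the leading summand of the quadric for another one raises the weight by 1, beyond the
   range where [phi] has coefficients. *)
have low j T : (zidx2 (diag b) j <= m + u)%MM -> j != b.1 -> T = S ->
    (phi T)@_(m + u - zidx2 (diag b) j) = 0.
  move=> le_z neq_j ->; apply: phiW; apply: leq_trans (_ : (weight S m).+1 <= _)%N.
    by rewrite ltnS.
  rewrite /weight; have := mnm_weightD (m + u - zidx2 (diag b) j) (zidx2 (diag b) j).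
  rewrite submK // mnm_weightD wu weight_zidx2 diag_div.
  rewrite [b.1 == j :> nat]eq_sym (negbTE (neq_j : (j != b.1 :> nat))).
  by move: (mnm_weight _) (mnm_weight _) (set_weight _) => w1 w2 w3 /=; lia.
rewrite defectE !ffunE sum_ffunE !mcoeffB mcoeff_udiv mcoeff_qmul -/u.
rewrite (bigD1 b.1) //= lem_addl addmK big1 ?addr0 => [|j neq_j]; last first.
  by case: ifP => // le_z; apply: low.
rewrite subrr sub0r raddf_sum /= (bigD1 (diag b)) //= [X in _ + X]big1 ?addr0.
  rewrite !ffunE; case: (boolP (_ \in S)) => bS /=; last by rewrite mcoeff0 oppr0.
  rewrite setD11 setD1K // scalerA.
  have -> : #|[set y in S | (enum_rank y < enum_rank (diag b))%N]| =
      ext_below (diag b) (S :\ diag b).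
    rewrite -/(ext_below _ _) -[in LHS](setD1K bS) ext_belowU1 ?setD11 //.
    by rewrite ltnn.
  rewrite -expr2 sqrr_sign scale1r mcoeff_comm opprK (bigD1 b.1) //= -/u.
  rewrite lem_addl addmK big1 ?addr0 => [|j neq_j] /=; first by case: ifP.
  by case: ifP => // /andP[le_z _]; apply: low.
move=> y neq_y; rewrite !ffunE; case: ifP => yS; last by rewrite mcoeff0.
rewrite in_setD1 eq_sym neq_y /=; case: ifP => bS; first by rewrite scaler0 mcoeff0.
rewrite scalerA mcoeffZ mcoeff_comm big1 ?oppr0 ?mulr0 // => j _.
case: ifP => // /andP[le_z not_z]; apply: phiW.
apply: leq_trans (_ : (weight S m).+1 <= _)%N; first by rewrite ltnS.
(* Both conditions together would make the [j]-th monomial of [y] the leading monomial of another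
   diagonal quadric, which is coprime to [u]. With at most one of them, the weight increases. *)
have noteq : ((y.1 %/ q == j :> nat) + (y \in diagonal) <= 1)%N.
  case: (boolP (y \in diagonal)) => [/imsetP[b' _ yE]|_]; last by case: (_ == _).
  case: eqP => //= yj; case/negP: not_z.
  have b'j : b'.1 = j by apply: val_inj; rewrite /= -diag_div -yE yj.
  rewrite -b'j yE; apply: (@diag_disjoint b); last by rewrite -yE b'j.
  by apply: contraNneq neq_y => ->; rewrite yE.
have bT : diag b \notin S :\ y by rewrite !inE bS andbF.
rewrite /weight; have := mnm_weightD (m + u - zidx2 y j) (zidx2 y j).
rewrite submK // mnm_weightD wu weight_zidx2.
have := weight_setD1 yS; have := set_weightU1 bT; rewrite mem_diagonal.
move: noteq; move: (mnm_weight _) (mnm_weight _) (set_weight _) (set_weight _) (set_weight _).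
by move=> w1 w2 w3 w4 w5; case: (_ == _); case: (y \in _) => /=; lia.
Qed.

Lemma defect_at b phi S :
  defect b phi S = phi S - (kappa (sop b phi) S + sop b (kappa phi) S).
Proof.
by rewrite /homotopy_defect /=; move: (kappa _) (sop b _) => u v; rewrite !ffunE.
Qed.

Lemma defect_homog l b phi : ext_homog l phi -> ext_homog l (defect b phi).
Proof.
move=> phil S Sl; rewrite defect_at phil // sub0r.
have kl : ext_homog l.+1 (kappa phi) by rewrite kappaE; apply: mulop_homog.
rewrite (sop_homog (l := l) b kl) // addr0.
case: l phil Sl {kl} => [|l] phil Sl.
  by rewrite sop_homog0 // linear0 ffunE oppr0.
have ks : ext_homog l.+1 (kappa (sop b phi)).
  by rewrite kappaE; apply: mulop_homog; apply: sop_homog.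
by rewrite ks // oppr0.
Qed.

Lemma defect_weight_lt W b phi : weight_lt W phi -> weight_lt W (defect b phi).
Proof.
move=> phiW S m leW.
have sk := sop_weight_lt b (kappa_weight_lt phiW).
have ks := kappa_weight_lt (sop_weight_lt b phiW).
by rewrite defect_at linearB linearD /= phiW // sk // ks // addr0 subr0.
Qed.

(** In top weight each defect merely discards coefficients, keeping none without [diag b] in [S]; so
    the constraints accumulate along [bs]. *)
Lemma total_defect_support W l (bs : seq B) phi :
    ext_homog l phi -> weight_lt W.+1 phi ->
  let psi := total_defect kappa [seq (sop b : {linear E -> E}) | b <- bs] phi in
  [/\ ext_homog l psi, weight_lt W.+1 psi
    & forall S m, (W <= weight S m)%N -> (psi S)@_m != 0 ->
      (phi S)@_m != 0 /\ forall b, b \in bs -> diag b \in S].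
Proof.
elim: bs phi => [|b bs IHbs] phi phil phiW /=; first by split.
have [psil psiW psiS] := IHbs _ (defect_homog b phil) (defect_weight_lt b phiW).
split=> // S m leW /(psiS _ _ leW)[]; rewrite (defect_coef b phiW leW).
case: ifP => [/andP[bS _] phi0 inS|_]; last by rewrite eqxx.
by split=> // b'; rewrite inE => /predU1P[->|/inS].
Qed.

Lemma total_homotopy0 (L : seq {linear E -> E}) :
  total_homotopy kappa L 0 = 0.
Proof.
elim: L => //= s L IHL.
by rewrite /homotopy_defect !linear0 addr0 subr0 IHL addr0.
Qed.

(** Induction on the weight. A coefficient of top weight that survives all defects would sit at a
    set containing the diagonal, which has kq > l elements; hence the total defect has smaller
    weight, and it differs from [phi] by a boundary. *)
Lemma koszul_exact l phi : (l < k * q)%N -> ext_homog l phi ->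
  kappa phi = 0 -> exists chi, phi = kappa chi.
Proof.
move=> lt_l phil kphi; have [W phiW] := weight_lt_exists phi.
elim: W phi phiW phil kphi => [|W IHW] phi phiW phil kphi.
  exists 0; rewrite linear0; apply/ffunP=> S; rewrite ffunE.
  by apply/mpolyP=> m; rewrite phiW // mcoeff0.
pose L := [seq (sop b : {linear E -> E}) | b <- enum {: B}].
have /= [psil psiW psiS] := total_defect_support (enum {: B}) phil phiW.
have phiE := total_homotopyE (d := kappa) kappa_kappa L phi.
rewrite -/L in psil psiW psiS; clearbody L.
rewrite /= kphi total_homotopy0 addr0 in phiE.
move: (total_defect _ L phi) psil psiW psiS phiE => psi psil psiW psiS phiE.
have kpsi : kappa psi = 0.
  have := congr1 kappa phiE.
  by rewrite kphi (linearD (kappa : {linear E -> E})) /= kappa_kappa addr0.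
have psiW' : weight_lt W psi.
  move=> S m leW; apply/eqP; apply: contraTT lt_l => /[dup] psi0 /(psiS _ _ leW)[_ inS].
  rewrite -leqNgt -card_diagonal.
  have /eqP <- : #|S| == l.
    by apply: contraNT psi0 => /psil ->; rewrite mcoeff0.
  apply/subset_leq_card/subsetP => x /imsetP[b _ ->].
  by apply: inS; rewrite mem_enum.
have [chi chiE] := IHW psi psiW' psil kpsi.
exists (chi + total_homotopy kappa L phi).
by rewrite (linearD (kappa : {linear E -> E})) /= -chiE -phiE.
Qed.
End Koszul.
Arguments kappa {R p q k}.

(** * Invariant primitives for the Koszul differential *)

Section Fischer.
Variables (n : nat) (C : numClosedFieldType).
Implicit Types (f g h : {mpoly C[n]}) (i : 'I_n) (m : 'X_{1..n}).

Definition mnm_fact m : C := \prod_i ((m i)`!)%:R.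

Lemma mnm_factD1 m i : mnm_fact (m + U_(i)) = (m i).+1%:R * mnm_fact m.
Proof.
rewrite /mnm_fact (bigD1 i) //= [in RHS](bigD1 i) //= mulrA.
rewrite mnmDE mnm1E eqxx addn1 factS natrM; congr (_ * _).
by apply: eq_bigr => j neq_j; rewrite mnmDE mnm1E eq_sym (negbTE neq_j) addn0.
Qed.

(* The inner product for which multiplication by 'X_i is adjoint to d/dX_i.  *)
Definition fischer f h : C :=
  mlift (fun m => mnm_fact m * (h@_m)^* : C^o) f.

Lemma fischerP c f g h : fischer (c *: f + g) h = c * fischer f h + fischer g h.
Proof. by rewrite /fischer linearP. Qed.

Lemma fischerDr f g h : fischer f (g + h) = fischer f g + fischer f h.
Proof.
rewrite /fischer /mlift -big_split; apply: eq_bigr => m _ /=.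
by rewrite mcoeffD rmorphD mulrDr scalerDr.
Qed.

Lemma fischerX m h : fischer 'X_[m] h = mnm_fact m * (h@_m)^*.
Proof. by rewrite /fischer mliftX. Qed.

Lemma fischer0l h : fischer 0 h = 0.
Proof. by rewrite /fischer linear0. Qed.

Lemma fischer_adjoint (u : {mpoly C[n]} -> {mpoly C[n]}) f h h' : linear u ->
    (forall m, fischer (u 'X_[m]) h = fischer 'X_[m] h') ->
  fischer (u f) h = fischer f h'.
Proof.
move=> ulin uv; have u0 : u 0 = 0.
  by have := ulin (-1) 0 0; rewrite scaler0 addr0 scaleN1r addNr.
rewrite (mpolyE f).
elim: (msupp f) => [|m s IHs]; first by rewrite !big_nil u0 !fischer0l.
by rewrite !big_cons ulin !fischerP uv IHs.
Qed.

Lemma fischer_XM i f h : fischer ('X_i * f) h = fischer f h^`M(i).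
Proof.
apply: (fischer_adjoint (u := *%R 'X_i)) => [c g g'|m] /=.
  by rewrite mulrDr scalerAr.
rewrite -mpolyXD !fischerX addmC mnm_factD1 mcoeff_mderiv rmorphMn /=.
by rewrite mulrnAr -[RHS]mulr_natl mulrA.
Qed.

Lemma fischer_mderiv i f h : fischer f^`M(i) h = fischer f ('X_i * h).
Proof.
apply: (fischer_adjoint (u := mderiv i)) => [|m]; first exact: mderiv_is_linear.
rewrite mderivX fischerX mcoeff_XM -[_ *: _]addr0 fischerP fischer0l addr0 fischerX.
case: eqP => [->|/eqP mi]; first by rewrite mul0r rmorph0 mulr0.
have -> : mnm_fact m = (m i)%:R * mnm_fact (m - U_(i)).
  rewrite -{1}(@submK _ U_(i)%MM m) ?lep1mP // mnm_factD1.
  by rewrite mnmBE mnm1E eqxx subn1 prednK // lt0n.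
by rewrite mulrA.
Qed.

Lemma mnm_fact_gt0 m : 0 < mnm_fact m.
Proof. by apply: prodr_gt0 => i _; rewrite ltr0n fact_gt0. Qed.

Lemma fischer_ge0 f : 0 <= fischer f f.
Proof.
apply: sumr_ge0 => m _; rewrite /GRing.scale /= mulrCA -normCK.
by rewrite mulr_ge0 ?exprn_ge0 // ltW ?mnm_fact_gt0.
Qed.

Lemma fischer_eq0 f : fischer f f = 0 -> f = 0.
Proof.
move=> /eqP; rewrite psumr_eq0 => [/allP f0|m _]; last first.
  rewrite /GRing.scale /= mulrCA -normCK.
  by rewrite mulr_ge0 ?exprn_ge0 // ltW ?mnm_fact_gt0.
apply/mpolyP=> m; rewrite mcoeff0; apply/eqP; rewrite mcoeff_eq0.
apply/negP=> /[dup] mf /f0 /=; rewrite /GRing.scale /= mulrCA -normCK.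
rewrite mulf_eq0 (gt_eqF (mnm_fact_gt0 m)) /= expf_eq0 /= normr_eq0.
by rewrite mcoeff_eq0 mf.
Qed.
End Fischer.

(** * The inner product on forms and its adjoint pairs *)

Section FormProduct.
Variables (R : realType) (p q k : nat).
Local Notation P := (fock R p q k).
Local Notation I := ('I_p * 'I_q)%type.
Local Notation E := (ext I P).
Implicit Types (x : I) (f h : P) (phi psi : E).

Fact ip_fock_key : unit. Proof. exact: tt. Qed.
Definition ip_fock f h : R[i] := locked_with ip_fock_key (@fischer ((p + q) * k) R[i]) f h.

Lemma ip_fockE f h : ip_fock f h = fischer f h.
Proof. by rewrite /ip_fock unlock. Qed.

Lemma ip_fockP c f g h : ip_fock (c *: f + g) h = c * ip_fock f h + ip_fock g h.
Proof. by rewrite !ip_fockE fischerP. Qed.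

Lemma ip_fockDr f g h : ip_fock f (g + h) = ip_fock f g + ip_fock f h.
Proof. by rewrite !ip_fockE fischerDr. Qed.

Lemma ip_fockDl f g h : ip_fock (f + g) h = ip_fock f h + ip_fock g h.
Proof. by rewrite -{1}[f]scale1r ip_fockP mul1r. Qed.

Lemma ip_fock0l h : ip_fock 0 h = 0.
Proof. by rewrite ip_fockE fischer0l. Qed.

Lemma ip_fock0r f : ip_fock f 0 = 0.
Proof. by apply: (addrI (ip_fock f 0)); rewrite -ip_fockDr !addr0. Qed.

Lemma ip_fock_sum n (F G : 'I_n -> P) f h :
    (forall j, ip_fock (F j) h = ip_fock f (G j)) ->
  ip_fock (\sum_j F j) h = ip_fock f (\sum_j G j).
Proof.
move=> FG; rewrite (big_morph (ip_fock^~ h) (fun a b => ip_fockDl a b h) (ip_fock0l h)).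
rewrite (big_morph (ip_fock f) (ip_fockDr f) (ip_fock0r f)).
exact: eq_bigr.
Qed.

Lemma ip_fock_zmul i j f h : ip_fock (zmul i j f) h = ip_fock f (zder i j h).
Proof. by rewrite !ip_fockE zmulE zderE fischer_XM. Qed.

Lemma ip_fock_zder i j f h : ip_fock (zder i j f) h = ip_fock f (zmul i j h).
Proof. by rewrite !ip_fockE zmulE zderE fischer_mderiv. Qed.

Lemma zderC i j i' j' f : zder i j (zder i' j' f) = zder i' j' (zder i j f) :> P.
Proof. by rewrite !zderE mderiv_comm. Qed.

Lemma ip_fock_qmul x f h : ip_fock (qmul x f) h = ip_fock f (lap x h).
Proof.
apply: ip_fock_sum => j /=; rewrite !ip_fock_zmul.
by rewrite zderC.
Qed.

Lemma ip_fock_lap x f h : ip_fock (lap x f) h = ip_fock f (qmul x h).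
Proof.
apply: ip_fock_sum => j /=; rewrite !ip_fock_zder.
by rewrite zmulC.
Qed.

Definition ip_form phi psi : R[i] := \sum_S ip_fock (phi S) (psi S).

Lemma ip_formDl phi phi' psi :
  ip_form (phi + phi') psi = ip_form phi psi + ip_form phi' psi.
Proof.
rewrite /ip_form -big_split; apply: eq_bigr => S _ /=.
by rewrite -ip_fockDl !ffunE.
Qed.

Lemma ip_formDr phi psi psi' :
  ip_form phi (psi + psi') = ip_form phi psi + ip_form phi psi'.
Proof.
rewrite /ip_form -big_split; apply: eq_bigr => S _ /=.
by rewrite -ip_fockDr !ffunE.
Qed.

Lemma ip_form0l phi : ip_form 0 phi = 0.
Proof. by apply: (addrI (ip_form 0 phi)); rewrite -ip_formDl !addr0. Qed.

Lemma ip_form0r phi : ip_form phi 0 = 0.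
Proof. by apply: (addrI (ip_form phi 0)); rewrite -ip_formDr !addr0. Qed.

Lemma ip_form_ge0 phi : 0 <= ip_form phi phi.
Proof. by apply: sumr_ge0 => S _; rewrite ip_fockE fischer_ge0. Qed.

Lemma ip_form_eq0 phi : ip_form phi phi = 0 -> phi = 0.
Proof.
move=> /eqP; rewrite psumr_eq0 => [/allP phi0|S _]; last first.
  by rewrite ip_fockE fischer_ge0.
apply/ffunP=> S; rewrite ffunE; apply: fischer_eq0.
by apply/eqP; rewrite -ip_fockE; apply: phi0; rewrite mem_index_enum.
Qed.

(** The product is conjugate linear in its second argument; the only scalars moved out of it are
    signs, for which additivity is enough. *)
Lemma ip_fock_signr n f h :
  ip_fock f ((-1) ^+ n *: h) = (-1) ^+ n * ip_fock f h.
Proof.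
rewrite -signr_odd; case: (odd n); rewrite ?expr1 ?expr0 ?scale1r ?mul1r //.
rewrite scaleN1r mulN1r; apply/eqP; rewrite -addr_eq0 -ip_fockDr addNr.
by rewrite ip_fock0r.
Qed.

Lemma ip_form_mulb x phi psi :
  ip_form (ext_mulb x phi) psi = ip_form phi (ext_iotab x psi).
Proof.
rewrite /ip_form (bigID (fun S : {set I} => x \in S)) /=.
rewrite [X in _ + X]big1 ?addr0 => [|S xS]; last first.
  by rewrite ffunE (negbTE xS) ip_fock0l.
rewrite [RHS](bigID (fun S : {set I} => x \in S)) /=.
rewrite [X in _ = X + _]big1 ?add0r => [|S xS]; last first.
  by rewrite ffunE xS ip_fock0r.
rewrite (reindex_onto (fun S => x |: S) (fun S => S :\ x)) => [|S xS]; last first.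
  exact: setD1K.
rewrite [LHS](eq_bigl (fun S : {set I} => x \notin S)) => [|S]; last first.
  rewrite setU11 /=; apply/eqP/idP => [<-|xS]; last by rewrite setU1K.
  by rewrite setD11.
apply: eq_bigr => S xS; rewrite !ffunE setU11 (negbTE xS) setU1K //.
rewrite -/(ext_below _ _) ext_belowU1 // ltnn add0n ip_fock_signr.
by rewrite -[_ *: _]addr0 ip_fockP ip_fock0l addr0.
Qed.

Lemma ip_form_iotab x phi psi :
  ip_form (ext_iotab x phi) psi = ip_form phi (ext_mulb x psi).
Proof.
rewrite /ip_form [RHS](bigID (fun S : {set I} => x \in S)) /=.
rewrite [X in _ = _ + X]big1 ?addr0 => [|S xS]; last first.
  by rewrite ffunE (negbTE xS) ip_fock0r.
rewrite (bigID (fun S : {set I} => x \in S)) /=.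
rewrite [X in X + _]big1 ?add0r => [|S xS]; last first.
  by rewrite ffunE xS ip_fock0l.
rewrite [RHS](reindex_onto (fun S => x |: S) (fun S => S :\ x)) => [|S xS]; last first.
  exact: setD1K.
rewrite [RHS](eq_bigl (fun S : {set I} => x \notin S)) => [|S]; last first.
  rewrite setU11 /=; apply/eqP/idP => [<-|xS]; last by rewrite setU1K.
  by rewrite setD11.
apply: eq_bigr => S xS; rewrite !ffunE setU11 (negbTE xS) setU1K //.
rewrite -/(ext_below _ _) ext_belowU1 // ltnn add0n ip_fock_signr.
by rewrite -[_ *: _]addr0 ip_fockP ip_fock0l addr0.
Qed.

Lemma ip_form_map (u v : P -> P) phi psi :
    (forall f h, ip_fock (u f) h = ip_fock f (v h)) ->
  ip_form (ext_map u phi) psi = ip_form phi (ext_map v psi).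
Proof. by move=> uv; apply: eq_bigr => S _; rewrite !ffunE uv. Qed.

Lemma ip_form_mulop (D D' : I -> {linear P -> P}) phi psi :
    (forall x f h, ip_fock (D x f) h = ip_fock f (D' x h)) ->
  ip_form (mulop D phi) psi = ip_form phi (iotaop D' psi).
Proof.
move=> DD'; rewrite /mulop /iotaop.
rewrite (big_morph (ip_form^~ psi) (fun a b => ip_formDl a b psi) (ip_form0l psi)).
rewrite (big_morph (ip_form phi) (ip_formDr phi) (ip_form0r phi)).
apply: eq_bigr => x _; rewrite ip_form_mulb (ip_form_map _ _ (DD' x)).
by rewrite ext_map_iotab.
Qed.

Lemma ip_form_iotaop (D D' : I -> {linear P -> P}) phi psi :
    (forall x f h, ip_fock (D x f) h = ip_fock f (D' x h)) ->
  ip_form (iotaop D phi) psi = ip_form phi (mulop D' psi).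
Proof.
move=> DD'; rewrite /mulop /iotaop.
rewrite (big_morph (ip_form^~ psi) (fun a b => ip_formDl a b psi) (ip_form0l psi)).
rewrite (big_morph (ip_form phi) (ip_formDr phi) (ip_form0r phi)).
apply: eq_bigr => x _; rewrite ip_form_iotab (ip_form_map _ _ (DD' x)).
by rewrite ext_map_mulb.
Qed.
End FormProduct.

Section InvariantPrimitive.
Variables (R : realType) (p q k : nat).
Local Notation P := (fock R p q k).
Local Notation I := ('I_p * 'I_q)%type.
Local Notation E := (ext I P).
Implicit Types (x : I) (f h : P) (phi psi : E).

Definition invariant phi : Prop := forall g, inK g -> form_act g phi = phi.

Fact kappa_adj_key : unit. Proof. exact: tt. Qed.
Definition kappa_adj : E -> E := locked_with kappa_adj_key (iotaop (@lap R p q k)).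

Lemma kappa_adjE phi : kappa_adj phi = iotaop (@lap R p q k) phi.
Proof. by rewrite /kappa_adj unlock. Qed.

Lemma kappa_adj_is_linear : linear kappa_adj.
Proof. by move=> c u v; rewrite !kappa_adjE linearP. Qed.
HB.instance Definition _ :=
  GRing.isLinear.Build R[i] E E _ kappa_adj kappa_adj_is_linear.

Lemma qmul_act g y f : inK g ->
  qmul y (fock_act g f) = \sum_x coad g x y *: fock_act g (qmul x f).
Proof. by move=> gK; apply: contract_act => //; apply: zmul_act. Qed.

Lemma lap_act g y f : inK g ->
  lap y (fock_act g f) = \sum_x coad g x y *: fock_act g (lap x f).
Proof. by move=> gK; apply: contract_act => //; apply: zder_act. Qed.

Lemma kappa_act g phi : inK g -> kappa (form_act g phi) = form_act g (kappa phi).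
Proof.
by move=> gK; rewrite !kappaE; apply: mulop_act => y f; apply: qmul_act.
Qed.

Lemma kappa_adj_act g phi : inK g ->
  kappa_adj (form_act g phi) = form_act g (kappa_adj phi).
Proof.
move=> gK; rewrite !kappa_adjE; apply: iotaop_act => [y f|x y].
  exact: lap_act.
exact: coad_orth.
Qed.

(* The shift a records a homogeneous degree N - a without truncated subtraction. *)
Definition pol_homog (a N : nat) phi : Prop :=
  forall S (m : 'X_{1..(p + q) * k}), (mdeg m + a != N)%N -> (phi S)@_m = 0.

Lemma mdeg_zidx2 x j : mdeg (zidx2 x j : 'X_{1..(p + q) * k}) = 2%N.
Proof. by rewrite mdegD !mdeg1. Qed.

Lemma kappa_pol_homog a N phi :
  pol_homog a N phi -> pol_homog a N.+2 (kappa phi).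
Proof.
move=> phiN S m mN; rewrite kappa_coef big1 // => y yS.
rewrite big1 ?mulr0 // => j _; case: ifP => // le_m; apply: phiN.
apply: contra mN => /eqP <-; rewrite -{1}(submK le_m) mdegD mdeg_zidx2.
by rewrite addn2 !addSn.
Qed.

Lemma kappa_adj_pol_homog a N phi :
  pol_homog a N phi -> pol_homog a.+2 N (kappa_adj phi).
Proof.
move=> phiN S m mN; rewrite kappa_adjE /iotaop sum_ffunE raddf_sum big1 // => x _.
rewrite !ffunE /=; case: ifP => _; first by rewrite mcoeff0.
rewrite mcoeffZ /lap /contract raddf_sum big1 ?mulr0 // => j _ /=.
rewrite !zderE !mcoeff_mderiv phiN ?mul0rn //.
by rewrite !mdegD !mdeg1 !addn1 !addSn -!addnS.
Qed.

Lemma pol_homogSS a N phi : pol_homog a.+2 N.+2 phi -> pol_homog a N phi.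
Proof. by move=> phiN S m mN; apply: phiN; rewrite !addnS !eqSS. Qed.

Lemma pol_homogP a N c phi psi :
  pol_homog a N phi -> pol_homog a N psi -> pol_homog a N (c *: phi + psi).
Proof.
move=> phiN psiN S m mN; rewrite !ffunE linearP /=.
by rewrite phiN // psiN // mulr0 addr0.
Qed.

Lemma ext_homogP l c phi psi :
  ext_homog l phi -> ext_homog l psi -> ext_homog l (c *: phi + psi).
Proof.
by move=> phil psil S Sl; rewrite !ffunE phil // psil // scaler0 addr0.
Qed.

Lemma invariantP c phi psi :
  invariant phi -> invariant psi -> invariant (c *: phi + psi).
Proof.
by move=> phiK psiK g gK; rewrite [LHS]form_act_is_linear phiK // psiK.
Qed.

Lemma kappa_homog l phi : ext_homog l phi -> ext_homog l.+1 (kappa phi).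
Proof. by rewrite kappaE; apply: mulop_homog. Qed.

Lemma kappa_adj_homog l phi :
  ext_homog l.+1 phi -> ext_homog l (kappa_adj phi).
Proof. by rewrite kappa_adjE; apply: iotaop_homog. Qed.

Lemma kappa_adj_homog0 phi : ext_homog 0 phi -> kappa_adj phi = 0.
Proof. by rewrite kappa_adjE; apply: iotaop_homog0. Qed.

(** Finite dimensionality in the shape of a spanning list. It holds for a fixed polynomial degree,
    which is why primitives are sought degree by degree. *)
Lemma form_span N : exists b : seq E, forall phi, pol_homog 0 N phi ->
  exists c : 'I_(size b) -> R[i], phi = \sum_i c i *: b`_i.
Proof.
pose T := ({set I} * 'X_{1..((p + q) * k) < N.+1})%type.
pose v (t : T) : E := ext_mono t.1 ('X_[t.2] : P).
pose t0 : T := (set0, @mpoly.bm0 ((p + q) * k) N).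
exists [seq v t | t <- enum {: T}] => phi phiN.
pose c (t : T) := (phi t.1)@_(t.2).
have phiE : phi = \sum_t c t *: v t.
  rewrite {1}(ext_sum_mono phi) -(pair_bigA _ (fun S m => c (S, m) *: v (S, m))) /=.
  apply: eq_bigr => S _.
  have {1}-> : phi S = \sum_(m : 'X_{1..((p + q) * k) < N.+1}) (phi S)@_m *: 'X_[m].
    apply: mpolywE; rewrite msizeE; apply/bigmax_leqP_seq => m mS _.
    rewrite ltnS; apply: contraTT mS => mN; rewrite -mcoeff_eq0 phiN //.
    by rewrite addn0; apply: contra mN => /eqP ->.
  rewrite (linear_sum (ext_mono S : {linear P -> E})); apply: eq_bigr => m _.
  by rewrite /c /v /= linearZ.
exists (fun i => c (nth t0 (enum {: T}) i)).
rewrite {1}phiE -big_enum (big_nth t0) big_mkord size_map.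
by apply: eq_bigr => i _; rewrite (nth_map t0 _ _ (ltn_ord i)).
Qed.

(** The Laplacian preserves exterior and polynomial degree and commutes with K, so the polynomial in
    it that produces [w] keeps all three properties; [kappa_adj] then lowers the polynomial degree
    by 2. *)
Lemma invariant_primitive l N phi : (k * q <= p)%N -> (l < k * q)%N ->
    ext_homog l phi -> pol_homog 0 N phi -> invariant phi -> kappa phi = 0 ->
  exists chi, [/\ phi = kappa chi, pol_homog 2 N chi, invariant chi
    & if l is l'.+1 then ext_homog l' chi else chi = 0].
Proof.
move=> le_kq_p lt_l phil phiN phiK kphi.
pose X psi := ext_homog l psi /\ pol_homog 0 N psi.
have ipk u v : ip_form (kappa u) v = ip_form u (kappa_adj v).
  rewrite kappaE kappa_adjE; apply: ip_form_mulop => x f h.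
  exact: ip_fock_qmul.
have ipks u v : ip_form (kappa_adj u) v = ip_form u (kappa v).
  rewrite kappaE kappa_adjE; apply: ip_form_iotaop => x f h.
  exact: ip_fock_lap.
pose lapl := hodge (@kappa R p q k : {linear E -> E}) (kappa_adj : {linear E -> E}).
have laplX l' psi : ext_homog l' psi -> pol_homog 0 N psi ->
    ext_homog l' (lapl psi) /\ pol_homog 0 N (lapl psi).
  move=> psil psiN; rewrite /lapl /hodge /= -[kappa (kappa_adj psi)]scale1r.
  split; last first.
    apply: pol_homogP; first by apply/pol_homogSS/kappa_pol_homog/kappa_adj_pol_homog.
    by apply/pol_homogSS/kappa_adj_pol_homog/kappa_pol_homog.
  apply: ext_homogP; last by apply/kappa_adj_homog/kappa_homog.
  case: l' psil => [|l'] psil; last by apply/kappa_homog/kappa_adj_homog.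
  by rewrite kappa_adj_homog0 // linear0 => S _; rewrite ffunE.
have laplK psi : invariant psi -> invariant (lapl psi).
  move=> psiK; rewrite /lapl /hodge /= -[kappa (kappa_adj psi)]scale1r.
  by apply: invariantP => g gK; rewrite -?kappa_act -?kappa_adj_act
    -?kappa_act -?kappa_adj_act // psiK.
have [b bspan] := form_span N.
have [w phiE wQ] : exists2 w, phi = kappa (kappa_adj w) & forall Q : E -> Prop,
    (forall c u w, Q u -> Q w -> Q (c *: u + w)) ->
    (forall u, Q u -> Q (lapl u)) -> Q phi -> Q w.
  apply: (@hodge_primitive _ _ (@kappa R p q k : {linear E -> E})
    (kappa_adj : {linear E -> E}) _ (@ip_formDl R p q k) (@ip_form_ge0 R p q k)
    (@ip_form_eq0 R p q k) ipk ipks (@kappa_kappa R p q k) X b phi) => //.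
  - by move=> u [_ uN]; apply: bspan.
  - by move=> c u w [ul uN] [wl wN]; split; [apply: ext_homogP|apply: pol_homogP].
  - by move=> u [ul uN]; apply: laplX.
  by move=> u [ul uN] ku; apply: koszul_exact lt_l ul ku.
have [wl wN] : X w.
  apply: wQ => //= [c u v [ul uN] [vl vN]|u [ul uN]]; last exact: laplX.
  by split; [apply: ext_homogP|apply: pol_homogP].
have wK : invariant w by apply: wQ => //; apply: invariantP.
exists (kappa_adj w); split=> //.
- exact: kappa_adj_pol_homog.
- by move=> g gK; rewrite -kappa_adj_act // wK.
by case: (l) wl => [|l'] wl; [apply: kappa_adj_homog0|apply: kappa_adj_homog].
Qed.
End InvariantPrimitive.

(** * First-order expansions with bounded remainder *)

Section FirstOrder.
Variables (R : realType).
Implicit Types (c : R -> R[i]) (t : R).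

(** A bound on (0, 1] takes the place of limits at 0, so that the comparison of first-order terms
    stays algebraic. *)
Definition bounded01 c : Prop :=
  exists M : R, forall t, 0 < t -> t <= 1 -> `|c t| <= M%:C.

Lemma bounded01_cst a : bounded01 (fun=> a).
Proof.
exists (complex.Re `|a|) => t _ _; rewrite RRe_real //.
by rewrite ger0_real ?normr_ge0.
Qed.

Lemma bounded01_id : bounded01 (fun t => t%:C).
Proof.
exists 1 => t t0 t1; rewrite ger0_norm ?lecR //.
exact: ltW.
Qed.

Lemma bounded01D c c' :
  bounded01 c -> bounded01 c' -> bounded01 (fun t => c t + c' t).
Proof.
move=> [M cM] [M' c'M']; exists (M + M') => t t0 t1.
rewrite rmorphD /=; apply: le_trans (ler_normD _ _) _.
by rewrite lerD ?cM ?c'M'.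
Qed.

Lemma bounded01M c c' :
  bounded01 c -> bounded01 c' -> bounded01 (fun t => c t * c' t).
Proof.
move=> [M cM] [M' c'M']; exists (M * M') => t t0 t1.
by rewrite rmorphM normrM /= ler_pM ?normr_ge0 ?cM ?c'M'.
Qed.

Lemma bounded01_eq0 a c : bounded01 c ->
  (forall t, 0 < t -> t <= 1 -> a + t%:C * c t = 0) -> a = 0.
Proof.
move=> [M cM] aE; apply: normr0_eq0.
have [r rE] : exists r : R, `|a| = r%:C.
  by exists (complex.Re `|a|); rewrite RRe_real // ger0_real ?normr_ge0.
have r_ge0 : 0 <= r by have := normr_ge0 a; rewrite rE lecR.
have M_ge0 : 0 <= M.
  by rewrite -lecR; exact: le_trans (normr_ge0 _) (cM 1 ltr01 (lexx _)).
have rM t : 0 < t -> t <= 1 -> r <= t * M.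
  move=> t0 t1; have /eqP := aE t t0 t1; rewrite addr_eq0 => /eqP aE'.
  rewrite -lecR -rE aE' normrN normrM rmorphM /= ler_pM ?normr_ge0 ?cM //.
  by rewrite ger0_norm ?lecR // ltW.
rewrite rE; move: r_ge0; rewrite le_eqVlt => /predU1P[<-//|r0].
have d0 : 0 < r + M + 1 by lra.
(* This [t] lies in (0, 1] even when [M = 0], and makes [t M] smaller than [r]. *)
have t0 : 0 < r / (r + M + 1) by rewrite divr_gt0.
have t1 : r / (r + M + 1) <= 1 by rewrite ler_pdivrMr //; lra.
have := rM _ t0 t1; rewrite mulrAC ler_pdivlMr // ler_pM2l // => le_M.
by exfalso; clear aE rE cM rM; lra.
Qed.

Variable W : lmodType R[i].
Variable bd : (R -> W) -> Prop.
Hypothesis bdD : forall u v, bd u -> bd v -> bd (fun t => u t + v t).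
Hypothesis bdZ : forall c u, bounded01 c -> bd u -> bd (fun t => c t *: u t).
Hypothesis bd_cst : forall u, bd (fun=> u).

(** The derivative at 0 of a curve that is only evaluated at positive [t]. *)
Definition first_order (G : R -> W -> W) (v v' : W) : Prop :=
  exists2 r, bd r & forall t, 0 < t -> t <= 1 ->
    G t v = v + t%:C *: v' + (t%:C ^+ 2) *: r t.

Lemma bd_sum (L : Type) (s : seq L) (F : L -> R -> W) :
  (forall i, bd (F i)) -> bd (fun t => \sum_(i <- s) F i t).
Proof.
move=> bF; elim: s => [|l s IHs].
  have -> : (fun t => \sum_(i <- [::]) F i t) = fun=> 0.
    by apply/funext => t; rewrite big_nil.
  exact: bd_cst.
have -> : (fun t => \sum_(i <- l :: s) F i t) =
    fun t => F l t + \sum_(i <- s) F i t.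
  by apply/funext => t; rewrite big_cons.
exact: bdD.
Qed.

Lemma first_orderP G (a : R[i]) u u' v v' :
    (forall t, linear (G t)) ->
    first_order G u u' -> first_order G v v' ->
  first_order G (a *: u + v) (a *: u' + v').
Proof.
move=> Glin [r br rE] [s bs sE]; exists (fun t => a *: r t + s t).
  by apply: bdD => //; apply: (bdZ (c := fun=> a)) => //; apply: bounded01_cst.
move=> t t0 t1; rewrite Glin rE // sE // !scalerDr !scalerA.
by rewrite ![a * _]mulrC !addrA [LHS](ACl (1*4*2*5*3*6)).
Qed.

(* The Leibniz rule for v and the operator X l0. *)
Lemma first_order_step (L : finType) (l0 : L) (X : L -> {linear W -> W})
    (G : R -> W -> W) (c : R -> L -> R[i]) (gamma : L -> R[i])
    (beta : R -> L -> R[i]) v v' :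
    (forall l u, bd u -> bd (fun t => X l (u t))) ->
    (forall l, bounded01 (beta^~ l)) ->
    (forall t l, 0 < t -> t <= 1 ->
      c t l = (l == l0)%:R + t%:C * gamma l + t%:C ^+ 2 * beta t l) ->
    (forall t, 0 < t -> t <= 1 ->
      G t (X l0 v) = \sum_l c t l *: X l (G t v)) ->
    first_order G v v' ->
  first_order G (X l0 v) (X l0 v' + \sum_l gamma l *: X l v).
Proof.
move=> bX bbeta cE GX [r br rE].
exists (fun t => \sum_l (beta t l *: X l v + (gamma l + t%:C * beta t l) *: X l v'
  + ((l == l0)%:R + t%:C * (gamma l + t%:C * beta t l)) *: X l (r t))).
  apply: bd_sum => l; apply: bdD; first apply: bdD.
  - by apply: bdZ => //; apply: bd_cst.
  - apply: bdZ => //; apply: bounded01D; first exact: bounded01_cst.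
    by apply: bounded01M => //; apply: bounded01_id.
  apply: bdZ; last exact: bX.
  apply: bounded01D; first exact: bounded01_cst.
  apply: bounded01M; first exact: bounded01_id.
  apply: bounded01D; first exact: bounded01_cst.
  by apply: bounded01M => //; apply: bounded01_id.
move=> t t0 t1; rewrite GX //.
have pick u : X l0 u = \sum_l (l == l0)%:R *: X l u.
  rewrite (bigD1 l0) //= eqxx scale1r big1 ?addr0 // => l /negbTE ->.
  by rewrite scale0r.
rewrite scalerDr !pick !scaler_sumr -!big_split /=; apply: eq_bigr => l _.
rewrite cE // rE // !linearD !linearZ /=.
move: (X l v) (X l v') (X l (r t)) => A A' Ar.
rewrite ?scalerDr ?scalerA !addrA [RHS](ACl ((1*3*4)*(2*5)*6)) /= -!scalerDl.
by congr (_ *: _ + _ *: _ + _ *: _); ring.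
Qed.
End FirstOrder.

(** * Infinitesimal invariance *)

Section ExtDerivation.
Variables (F : comNzRingType) (I : finType) (M : lmodType F) (a : I -> I -> F).
Local Notation E := (ext I M).
Implicit Types (x y : I) (phi : E).

(** The derivation of the exterior algebra that extends the endomorphism [a] of the one-forms. *)
Definition ext_deriv phi : E :=
  \sum_x \sum_y a x y *: ext_mulb y (ext_iotab x phi).

Lemma ext_deriv_is_linear : linear ext_deriv.
Proof.
move=> c u v; rewrite /ext_deriv scaler_sumr -big_split; apply: eq_bigr => x _ /=.
rewrite scaler_sumr -big_split; apply: eq_bigr => y _ /=.
rewrite [ext_iotab x _]linearP [ext_mulb y _]linearP /= scalerDr.
by rewrite !scalerA mulrC.
Qed.
HB.instance Definition _ :=
  GRing.isLinear.Build F E E _ ext_deriv ext_deriv_is_linear.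

Lemma ext_deriv_mono0 f : ext_deriv (ext_mono set0 f) = 0.
Proof.
rewrite /ext_deriv big1 // => x _; rewrite big1 // => y _.
by rewrite ext_iotab_mono0 linear0 scaler0.
Qed.

Lemma ext_deriv_mulb x phi : ext_deriv (ext_mulb x phi) =
  ext_mulb x (ext_deriv phi) + \sum_y a x y *: ext_mulb y phi.
Proof.
rewrite /ext_deriv.
under eq_bigr => x' _ do under eq_bigr => y _ do
  rewrite ext_iotab_mulb linearB linearZ /= scalerBr.
under eq_bigr => x' _ do rewrite sumrB.
rewrite sumrB addrC; congr (_ + _).
  rewrite [RHS]linear_sum -sumrN; apply: eq_bigr => x' _ /=.
  rewrite [RHS]linear_sum -sumrN; apply: eq_bigr => y _ /=.
  by rewrite ext_mulbC scalerN opprK [RHS]linearZ.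
rewrite (bigD1 x) //= [X in _ + X]big1 ?addr0 => [|x' neq_x]; last first.
  by rewrite big1 // => y _; rewrite (negbTE neq_x) scale0r scaler0.
by apply: eq_bigr => y _; rewrite eqxx scale1r.
Qed.

End ExtDerivation.

Section Infinitesimal.
Variables (R : realType) (p q k : nat).
Local Notation P := (fock R p q k).
Local Notation I := ('I_p * 'I_q)%type.
Local Notation E := (ext I P).
Implicit Types (x y : I) (f h : P) (phi psi : E).

(** The polarization operator by which the matrix unit [(l, i)] acts on polynomials. *)
Definition euler (l i : 'I_(p + q)) f : P := \sum_j zmul l j (zder i j f).

Lemma euler_is_linear l i : linear (euler l i).
Proof.
move=> c u v; rewrite /euler scaler_sumr -big_split /=.
by apply: eq_bigr => j _; rewrite !linearP.
Qed.
HB.instance Definition _ l i :=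
  GRing.isLinear.Build R[i] P P _ (euler l i) (euler_is_linear l i).

Lemma euler_zmul l i i0 j0 f : euler l i (zmul i0 j0 f) =
  zmul i0 j0 (euler l i f) + (i0 == i)%:R *: zmul l j0 f.
Proof.
rewrite /euler; under eq_bigr => j _ do rewrite zder_zmul linearD linearZ /=.
rewrite big_split /= addrC; congr (_ + _).
  by rewrite linear_sum; apply: eq_bigr => j _; rewrite zmulC.
rewrite (bigD1 j0) //= eqxx andbT big1 ?addr0 // => j neq_j.
by rewrite [j0 == j]eq_sym (negbTE neq_j) andbF scale0r.
Qed.

Lemma euler1 l i : euler l i 1 = 0.
Proof. by rewrite /euler big1 // => j _; rewrite zder1 linear0. Qed.

Variable J : 'M[R]_(p + q).

(* The derivative of coad at the identity in the direction J. *)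
Definition p0_deriv x y : R[i] :=
  (J (lshift q y.1) (lshift q x.1) * (y.2 == x.2)%:R +
   (y.1 == x.1)%:R * J (rshift p y.2) (rshift p x.2))%:C.

Definition lie_ext : E -> E := ext_deriv p0_deriv.
HB.instance Definition _ := GRing.Linear.on lie_ext.

Definition lie_fock f : P := \sum_l \sum_i (J l i)%:C *: euler l i f.

Lemma lie_fock_is_linear : linear lie_fock.
Proof.
move=> c u v; rewrite /lie_fock scaler_sumr -big_split; apply: eq_bigr => l _ /=.
rewrite scaler_sumr -big_split; apply: eq_bigr => i _ /=.
by rewrite [euler l i _]linearP /= scalerDr !scalerA mulrC.
Qed.
HB.instance Definition _ :=
  GRing.isLinear.Build R[i] P P _ lie_fock lie_fock_is_linear.

Definition lie_form phi : E := ext_map lie_fock phi + lie_ext phi.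

Lemma lie_form_is_linear : linear lie_form.
Proof.
move=> c u v; rewrite /lie_form [ext_map _ _]linearP [lie_ext _]linearP /=.
by rewrite scalerDr addrACA.
Qed.

Lemma lie_form_mulb x phi : lie_form (ext_mulb x phi) =
  ext_mulb x (lie_form phi) + \sum_y p0_deriv x y *: ext_mulb y phi.
Proof.
by rewrite /lie_form ext_map_mulb /lie_ext ext_deriv_mulb linearD addrA.
Qed.

Lemma lie_fock_zmul i j f : lie_fock (zmul i j f) =
  zmul i j (lie_fock f) + \sum_l (J l i)%:C *: zmul l j f.
Proof.
rewrite /lie_fock.
under eq_bigr => l _ do under eq_bigr => i' _ do rewrite euler_zmul scalerDr.
under eq_bigr => l _ do rewrite big_split.
rewrite big_split; congr (_ + _).
  rewrite linear_sum; apply: eq_bigr => l _; rewrite linear_sum.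
  by apply: eq_bigr => i' _; rewrite linearZ.
apply: eq_bigr => l _; rewrite (bigD1 i) //= eqxx scale1r big1 ?addr0 // => i' neq_i.
by rewrite eq_sym (negbTE neq_i) scale0r scaler0.
Qed.

Lemma lie_form_mono0 f :
  lie_form (ext_mono set0 f) = ext_mono set0 (lie_fock f).
Proof.
by rewrite /lie_form ext_map_mono /lie_ext ext_deriv_mono0 addr0.
Qed.

(** Each coefficient has its own bound: first-order terms are compared one coefficient at a time. *)
Definition bounded_form (Psi : R -> E) : Prop :=
  forall S (m : 'X_{1..(p + q) * k}), bounded01 (fun t => (Psi t S)@_m).

Lemma bounded_formD (u v : R -> E) : bounded_form u -> bounded_form v ->
  bounded_form (fun t => u t + v t).
Proof.
move=> bu bv S m.
have -> : (fun t => ((u t + v t) S)@_m) = fun t => (u t S)@_m + (v t S)@_m.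
  by apply/funext => t; rewrite ffunE mcoeffD.
exact: bounded01D.
Qed.

Lemma bounded_formZ (c : R -> R[i]) (u : R -> E) : bounded01 c -> bounded_form u ->
  bounded_form (fun t => c t *: u t).
Proof.
move=> bc bu S m.
have -> : (fun t => ((c t *: u t) S)@_m) = fun t => c t * (u t S)@_m.
  by apply/funext => t; rewrite ffunE mcoeffZ.
exact: bounded01M.
Qed.

Lemma bounded_form_cst phi : bounded_form (fun=> phi).
Proof. by move=> S m; apply: bounded01_cst. Qed.

Lemma bounded_form_mulb x (u : R -> E) :
  bounded_form u -> bounded_form (fun t => ext_mulb x (u t)).
Proof.
move=> bu S m; case: (boolP (x \in S)) => xS.
  have -> : (fun t => (ext_mulb x (u t) S)@_m) =
      fun t => (-1) ^+ ext_below x S * (u t (S :\ x))@_m.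
    by apply/funext => t; rewrite ffunE xS mcoeffZ.
  by apply: bounded01M => //; apply: bounded01_cst.
have -> : (fun t => (ext_mulb x (u t) S)@_m) = fun=> 0.
  by apply/funext => t; rewrite ffunE (negbTE xS) mcoeff0.
exact: bounded01_cst.
Qed.

Lemma bounded_form_zmul i j (u : R -> E) :
  bounded_form u -> bounded_form (fun t => ext_map (zmul i j) (u t)).
Proof.
move=> bu S m.
have -> : (fun t => (ext_map (zmul i j) (u t) S)@_m) = fun t =>
    if m (mxvec_index i j) == 0%N then 0 else (u t S)@_(m - U_(mxvec_index i j)).
  by apply/funext => t; rewrite ffunE zmulE mcoeff_XM.
by case: (m _ == 0%N) => //; apply: bounded01_cst.
Qed.

Variables (g beta : R -> 'M[R]_(p + q)).
Hypothesis gK : forall t, 0 < t -> t <= 1 -> inK (g t).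
Hypothesis gE : forall t l i,
  g t l i = (l == i)%:R + t * J l i + t ^+ 2 * beta t l i.
Hypothesis bbeta : forall l i, bounded01 (fun t => (beta t l i)%:C).

Local Notation expands := (first_order bounded_form (fun t => form_act (g t))).

Lemma coad_first_order x y : exists2 b : R -> R[i], bounded01 b &
  forall t, 0 < t -> t <= 1 ->
    coad (g t) x y = (y == x)%:R + t%:C * p0_deriv x y + t%:C ^+ 2 * b t.
Proof.
pose d1 : R := (y.1 == x.1)%:R; pose d2 : R := (y.2 == x.2)%:R.
pose J1 := J (lshift q y.1) (lshift q x.1); pose J2 := J (rshift p y.2) (rshift p x.2).
pose b1 t := beta t (lshift q y.1) (lshift q x.1).
pose b2 t := beta t (rshift p y.2) (rshift p x.2).
(* The part of order at least 2 of (d1 + t J1 + t^2 b1) (d2 + t J2 + t^2 b2), divided by t^2. *)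
exists (fun t => d1%:C * (b2 t)%:C + (b1 t)%:C * d2%:C + J1%:C * J2%:C
   + t%:C * (J1%:C * (b2 t)%:C + (b1 t)%:C * J2%:C)
   + t%:C * (t%:C * ((b1 t)%:C * (b2 t)%:C))).
  have b1b := bbeta (lshift q y.1) (lshift q x.1).
  have b2b := bbeta (rshift p y.2) (rshift p x.2).
  have cb := bounded01_cst; have tb := bounded01_id R.
  by repeat (apply: bounded01D || apply: bounded01M).
move=> t t0 t1; have [a [b [aS bS gab]]] := gK t0 t1.
rewrite gab coadE //.
have -> : a y.1 x.1 = g t (lshift q y.1) (lshift q x.1) by rewrite gab block_mxEul.
have -> : b y.2 x.2 = g t (rshift p y.2) (rshift p x.2) by rewrite gab block_mxEdr.
rewrite !gE eq_lshift eq_rshift -/d1 -/d2 -/J1 -/J2 -/(b1 t) -/(b2 t).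
have -> : (y == x)%:R = (d1 * d2)%:C.
  rewrite /d1 /d2 -natrM mulnb -[LHS](rmorph_nat (real_complex R)) /=.
  by case: (x) (y) => [x1 x2] [y1 y2]; rewrite xpair_eqE.
rewrite /p0_deriv -/d1 -/d2 -/J1 -/J2 -!(rmorphM, rmorphD, rmorphXn) /=.
congr (_%:C); ring.
Qed.

(** Forms are built from 1 by variables and one-forms. The group acts multiplicatively, so
    [first_order_step] propagates the expansion through both kinds of generators. *)
Lemma form_act_first_order phi : expands phi (lie_form phi).
Proof.
have lin t : linear (form_act (g t) : E -> E) by move=> c u v; rewrite linearP.
elim/ext_ind: phi => [c phi psi IH1 IH2|f|x phi IH].
- rewrite lie_form_is_linear; apply: first_orderP IH1 IH2 => //.
  + exact: bounded_formD.
  exact: bounded_formZ.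
- elim/fock_ind: f => [c f h IH1 IH2||i j f IH].
  + rewrite linearP lie_form_is_linear; apply: first_orderP IH1 IH2 => //.
    * exact: bounded_formD.
    exact: bounded_formZ.
  + exists (fun=> 0); first exact: bounded_form_cst.
    move=> t t0 t1; rewrite lie_form_mono0 scaler0 addr0 /form_act ext_act_mono0 /= fock_act1.
    rewrite /lie_fock !big1 ?linear0 ?scaler0 ?addr0 // => l _.
    by rewrite big1 // => i _; rewrite euler1 scaler0.
  rewrite -ext_map_mono.
  have -> : lie_form (ext_map (zmul i j) (ext_mono set0 f)) =
      ext_map (zmul i j) (lie_form (ext_mono set0 f)) +
      \sum_l (J l i)%:C *: ext_map (zmul l j) (ext_mono set0 f).
    rewrite ext_map_mono !lie_form_mono0 lie_fock_zmul linearD /= ext_map_mono.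
    congr (_ + _); rewrite linear_sum; apply: eq_bigr => l _.
    by rewrite ext_map_mono linearZ.
  apply: (@first_order_step R E bounded_form bounded_formD bounded_formZ
    bounded_form_cst _ i (fun l => ext_map (zmul l j) : {linear E -> E}) _
    (fun t l => (g t l i)%:C) _ (fun t l => (beta t l i)%:C)) => //.
  + by move=> l u bu; apply: bounded_form_zmul.
  + move=> t l _ _; rewrite gE -!(rmorphM, rmorphXn) /= !rmorphD /=.
    by rewrite -[(_ == _)%:R in RHS](rmorph_nat (real_complex R)).
  move=> t t0 t1; apply: ext_act_map => h.
  by rewrite /= fock_act_zmul //; apply: gK.
(* The remainders are known for each [y] separately; choice assembles them into one function of [t]
   and [y]. *)
have [b bb coadE'] : exists2 b : R -> I -> R[i], (forall y, bounded01 (b^~ y)) &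
    forall t y, 0 < t -> t <= 1 ->
    coad (g t) x y = (y == x)%:R + t%:C * p0_deriv x y + t%:C ^+ 2 * b t y.
  have [b bP] := choice (fun y => let: ex_intro2 b bb bE := coad_first_order x y in
    ex_intro (fun b => bounded01 b /\ forall t, 0 < t -> t <= 1 ->
      coad (g t) x y = (y == x)%:R + t%:C * p0_deriv x y + t%:C ^+ 2 * b t) b (conj bb bE)).
  by exists (fun t y => b y t) => [y|t y t0 t1]; have [bb bE] := bP y; [exact: bb|exact: bE].
rewrite lie_form_mulb.
apply: (@first_order_step R E bounded_form bounded_formD bounded_formZ
  bounded_form_cst _ x (fun y => ext_mulb y : {linear E -> E}) _
  (fun t y => coad (g t) x y) _ b) => //.
- by move=> y u bu; apply: bounded_form_mulb.
by move=> t t0 t1; apply: ext_act_mulb.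
Qed.

(** Invariance leaves [t v + t^2 r = 0]; after one division by [t], boundedness of [r] forces
    [v = 0]. *)
Lemma lie_form_invariant phi : invariant phi -> lie_form phi = 0.
Proof.
move=> phiK; have [r br rE] := form_act_first_order phi.
move: (lie_form phi) rE => v rE.
apply/ffunP=> S; rewrite [RHS]ffunE; apply/mpolyP=> m; rewrite mcoeff0.
apply: (bounded01_eq0 (br S m)) => t t0 t1.
have e0 : t%:C *: v + t%:C ^+ 2 *: r t = 0.
  by apply: (addrI phi); rewrite addr0 addrA -rE // phiK //; apply: gK.
have tn0 : t%:C != 0 by rewrite (inj_eq (@complexI R)) gt_eqF.
apply: (mulfI tn0); rewrite mulr0.
have := congr1 (fun psi : E => (psi S)@_m) e0.
by rewrite /= !ffunE mcoeffD !mcoeffZ mcoeff0 mulrDr mulrA -expr2.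
Qed.
End Infinitesimal.

(** * Rotations in a coordinate plane *)

Section Rotation.
Variables (R : realType) (n : nat) (i j : 'I_n).
Hypothesis neq_ij : i != j.

Definition plane : 'M[R]_n := delta_mx i j - delta_mx j i.
Local Notation K := plane.
Local Notation K2 := (plane *m plane).

Lemma plane_tr : K^T = - K.
Proof. by rewrite /plane linearB /= !trmx_delta opprB. Qed.

Lemma plane2E : K2 = - (delta_mx i i + delta_mx j j).
Proof.
rewrite /plane mulmxBl !mulmxBr !mul_delta_mx_cond !eqxx eq_sym (negbTE neq_ij).
by rewrite !mulr1n !mulr0n sub0r subr0 opprD.
Qed.

(** The relation K^3 = -K makes 1, K and K^2 span an algebra, in which [rotM] computes products. *)
Lemma plane2K : K2 *m K = - K.
Proof.
rewrite plane2E mulNmx /plane mulmxDl !mulmxBr !mul_delta_mx_cond !eqxx.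
rewrite (negbTE neq_ij) [j == i]eq_sym (negbTE neq_ij).
by rewrite !mulr1n !mulr0n subr0 sub0r.
Qed.

Definition rot (a b : R) : 'M[R]_n := 1%:M + a *: K + b *: K2.

Lemma rotM a b c d :
  rot a b *m rot c d = rot (a + c - a * d - b * c) (b + d + a * c - b * d).
Proof.
suff gen (A B : 'M[R]_n) : A *m A = B -> A *m B = - A -> B *m A = - A ->
    B *m B = - B -> (1%:M + a *: A + b *: B) *m (1%:M + c *: A + d *: B) =
    1%:M + (a + c - a * d - b * c) *: A + (b + d + a * c - b * d) *: B.
  by apply: gen => //; rewrite ?mulmxA plane2K ?mulNmx.
move=> AA AB BA BB.
rewrite !mulmxDl !mulmxDr !mul1mx !mulmx1 -!scalemxAl -!scalemxAr.
rewrite AA AB BA BB !scalerN !scalerA.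
rewrite !addrA [LHS](ACl (1*((2*4)*(6*8))*((3*7)*(5*9)))) /=.
rewrite -!scaleNr -!scalerDl.
by congr (_ + _ *: _ + _ *: _); ring.
Qed.

Lemma rot_tr a b : (rot a b)^T = rot (- a) b.
Proof.
rewrite /rot; move: K plane_tr => A At.
rewrite !linearD !linearZ /= trmx1 trmx_mul At mulNmx mulmxN opprK.
by rewrite scaleNr scalerN.
Qed.

(* The square of the Cayley transform: a rational curve of rotations, of
   determinant 1 because it is a square.                                      *)
Lemma rotation_family : exists a b : R -> 'M[R]_n,
  [/\ forall t, inSO (a t),
      forall t, a t = 1%:M + t *: K + t ^+ 2 *: b t
    & forall l m, bounded01 (fun t => (b t l m)%:C)].
Proof.
(* [h] is the Cayley transform of [u K], with first-order term [2 u K]; its square has [4 u K],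
   whence u = t / 4. *)
pose u t : R := t / 4%:R; pose w t : R := (1 + u t ^+ 2)^-1.
have wK t : w t * (1 + u t ^+ 2) = 1.
  by rewrite mulVf // gt_eqF // ltr_pwDl ?ltr01 ?sqr_ge0.
have w_neq0 t : 1 + u t ^+ 2 != 0.
  by rewrite gt_eqF // ltr_pwDl ?ltr01 ?sqr_ge0.
pose h t := rot (2%:R * u t * w t) (2%:R * u t ^+ 2 * w t).
exists (fun t => h t *m h t).
(* The coefficients of K and K^2 in the square of [h t], less the term t K, divided by t^2. *)
exists (fun t => (- (u t / 4%:R * (3%:R + u t ^+ 2) * w t ^+ 2)) *: K
   + (w t ^+ 2 / 2%:R) *: K2).
(* With s and c the coefficients of K and K^2, this is 2 c = s^2 + c^2, the condition for [rot s c]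
   to be orthogonal. *)
have rel t : 2%:R * (2%:R * u t ^+ 2 * w t) =
    (2%:R * u t * w t) ^+ 2 + (2%:R * u t ^+ 2 * w t) ^+ 2.
  transitivity (4%:R * u t ^+ 2 * w t * (w t * (1 + u t ^+ 2))); last by ring.
  by rewrite wK; ring.
have hh t : h t *m (h t)^T = 1%:M.
  rewrite /h rot_tr rotM /rot; move: (rel t); move: (2%:R * u t * w t) (2%:R * u t ^+ 2 * w t).
  move=> s c sc.
  have -> : s + - s - s * c - c * - s = 0 by ring.
  have -> : c + c + s * - s - c * c = 0 by rewrite -(subrr (2%:R * c)) {2}sc; ring.
  by rewrite !scale0r !addr0.
split=> [t|t|l m].
- split; first by rewrite trmx_mul mulmxA -(mulmxA (h t)) hh mulmx1 hh.
  rewrite det_mulmx; have := congr1 determinant (hh t).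
  by rewrite det_mulmx det_tr det1.
- have [v ->] : exists v, t = 4%:R * v.
    by exists (u t); rewrite /u mulrC divfK // pnatr_eq0.
  have uE : u (4%:R * v) = v by rewrite /u mulrAC divff ?mul1r // pnatr_eq0.
  have := w_neq0 (4%:R * v); rewrite /h rotM /rot /w uE => v0.
  move: K K2 => A B.
  rewrite scalerDr !scalerA addrA -[_ + (4%:R * v) *: A + _]addrA -scalerDl.
  by congr (_ + _ *: _ + _ *: _); field.
have bw : bounded01 (fun t => (w t)%:C).
  exists 1 => t _ _; rewrite ger0_norm ?lecR ?invr_ge0 ?addr_ge0 ?ler01 ?sqr_ge0 //.
  by rewrite invf_le1 ?lerDl ?sqr_ge0 // ltr_pwDl ?ltr01 ?sqr_ge0.
have bu : bounded01 (fun t => (u t)%:C).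
  under eq_fun => t do rewrite /u rmorphM.
  by apply: bounded01M; [apply: bounded01_id|apply: bounded01_cst].
have cb := @bounded01_cst R.
move: K K2 => A B.
have -> : (fun t => ((- (u t / 4%:R * (3%:R + u t ^+ 2) * w t ^+ 2) *: A
      + (w t ^+ 2 / 2%:R) *: B) l m)%:C) =
    fun t => (-1)%:C * (((u t)%:C * (4%:R^-1)%:C) * ((3%:R : R)%:C
      + (u t)%:C * (u t)%:C) * ((w t)%:C * (w t)%:C)) * (A l m)%:C
      + ((w t)%:C * (w t)%:C) * (2%:R^-1)%:C * (B l m)%:C.
  by apply/funext => t; rewrite !mxE -!(rmorphM, rmorphD) /=; congr (_%:C); ring.
by repeat (apply: bounded01D || apply: bounded01M).
Qed.
End Rotation.

Lemma plane_sum (R : realType) n (i j : 'I_n) (W : lmodType R[i])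
    (X : 'I_n -> 'I_n -> W) :
  \sum_l \sum_m (plane R i j l m)%:C *: X l m = X i j - X j i.
Proof.
have delta_sum (i0 j0 : 'I_n) :
    \sum_l \sum_m ((delta_mx i0 j0 : 'M[R]_n) l m)%:C *: X l m = X i0 j0.
  rewrite (bigD1 i0) //= [X in _ + X]big1 ?addr0 => [|l neq_l]; last first.
    by rewrite big1 // => m _; rewrite mxE (negbTE neq_l) scale0r.
  rewrite (bigD1 j0) //= big1 ?addr0 => [|m neq_m].
    by rewrite mxE !eqxx scale1r.
  by rewrite mxE (negbTE neq_m) andbF scale0r.
rewrite -[X i j]delta_sum -[X j i]delta_sum -sumrB; apply: eq_bigr => l _.
rewrite -sumrB; apply: eq_bigr => m _.
by rewrite -scalerBl -rmorphB /= [in LHS]/plane !mxE.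
Qed.

Section ExtDerivationProduct.
Variables (F : comNzRingType) (p q : nat) (M : lmodType F).
Local Notation I := ('I_p * 'I_q)%type.
Implicit Types (phi : ext I M).

Lemma eq_ext_deriv (a a' : I -> I -> F) phi :
  (forall x y, a x y = a' x y) -> ext_deriv a phi = ext_deriv a' phi.
Proof.
by move=> aa'; apply: eq_bigr => x _; apply: eq_bigr => y _; rewrite aa'.
Qed.

Lemma ext_deriv_left (al : 'I_p -> 'I_p -> F) phi :
  ext_deriv (fun x y => al y.1 x.1 * (y.2 == x.2)%:R) phi =
  \sum_l \sum_i al l i *: \sum_n ext_mulb (l, n) (ext_iotab (i, n) phi).
Proof.
rewrite /ext_deriv.
transitivity (\sum_i \sum_n \sum_l \sum_n' (al l i * (n' == n)%:R)
    *: ext_mulb (l, n') (ext_iotab (i, n) phi)).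
  rewrite [RHS]pair_bigA; apply: eq_bigr => -[i n] _ /=.
  by rewrite [RHS]pair_bigA; apply: eq_bigr => -[l n'] _.
rewrite [RHS]exchange_big; apply: eq_bigr => i _ /=.
under [RHS]eq_bigr => l _ do rewrite scaler_sumr.
rewrite [RHS]exchange_big; apply: eq_bigr => n _ /=.
apply: eq_bigr => l _; rewrite (bigD1 n) //= big1 ?addr0 => [|n' neq_n].
  by rewrite eqxx mulr1.
by rewrite (negbTE neq_n) !mulr0 scale0r.
Qed.

Lemma ext_deriv_right (al : 'I_q -> 'I_q -> F) phi :
  ext_deriv (fun x y => (y.1 == x.1)%:R * al y.2 x.2) phi =
  \sum_l \sum_i al l i *: \sum_n ext_mulb (n, l) (ext_iotab (n, i) phi).
Proof.
rewrite /ext_deriv.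
transitivity (\sum_n \sum_i \sum_n' \sum_l ((n' == n)%:R * al l i)
    *: ext_mulb (n', l) (ext_iotab (n, i) phi)).
  rewrite [RHS]pair_bigA; apply: eq_bigr => -[n i] _ /=.
  by rewrite [RHS]pair_bigA; apply: eq_bigr => -[n' l] _.
rewrite exchange_big [RHS]exchange_big; apply: eq_bigr => i _ /=.
under [RHS]eq_bigr => l _ do rewrite scaler_sumr.
rewrite [RHS]exchange_big; apply: eq_bigr => n _ /=.
rewrite (bigD1 n) //= [X in _ + X]big1 ?addr0 => [|n' neq_n].
  by apply: eq_bigr => l _; rewrite eqxx mul1r.
by rewrite big1 // => l _; rewrite (negbTE neq_n) !mul0r scale0r.
Qed.
End ExtDerivationProduct.

(** * Relations satisfied by K-invariant forms *)

Section LieRelations.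
Variables (R : realType) (p q k : nat).
Local Notation P := (fock R p q k).
Local Notation I := ('I_p * 'I_q)%type.
Local Notation E := (ext I P).
Implicit Types (phi : E).

Lemma inSO1 n : inSO (1%:M : 'M[R]_n).
Proof. by split; rewrite ?det1 // trmx1 mulmx1. Qed.

Lemma lie_form_so_p (b a : 'I_p) phi : b != a -> invariant phi ->
  lie_form (block_mx (plane R b a) 0 0 0) phi = 0.
Proof.
move=> neq_ba phiK; have [h [c [hSO hE cb]]] := rotation_family R neq_ba.
apply: (@lie_form_invariant R p q k _ (fun t => block_mx (h t) 0 0 1%:M)
  (fun t => block_mx (c t) 0 0 0)) => // [t _ _|t l i|l i].
- by exists (h t), 1%:M; split=> //; apply: inSO1.
- case: (split_ordP l) => [l' ->|l' ->]; case: (split_ordP i) => [i' ->|i' ->].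
  + by rewrite !block_mxEul hE !mxE eq_lshift.
  + by rewrite !block_mxEur !mxE eq_lrshift !mulr0 !addr0.
  + by rewrite !block_mxEdl !mxE eq_rlshift !mulr0 !addr0.
  by rewrite !block_mxEdr !mxE eq_rshift !mulr0 !addr0.
case: (split_ordP l) => [l' ->|l' ->]; case: (split_ordP i) => [i' ->|i' ->].
- by under eq_fun => t do rewrite block_mxEul.
- by under eq_fun => t do rewrite block_mxEur mxE; apply: bounded01_cst.
- by under eq_fun => t do rewrite block_mxEdl mxE; apply: bounded01_cst.
by under eq_fun => t do rewrite block_mxEdr mxE; apply: bounded01_cst.
Qed.

Lemma lie_form_so_q (b a : 'I_q) phi : b != a -> invariant phi ->
  lie_form (block_mx 0 0 0 (plane R b a)) phi = 0.
Proof.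
move=> neq_ba phiK; have [h [c [hSO hE cb]]] := rotation_family R neq_ba.
apply: (@lie_form_invariant R p q k _ (fun t => block_mx 1%:M 0 0 (h t))
  (fun t => block_mx 0 0 0 (c t))) => // [t _ _|t l i|l i].
- by exists 1%:M, (h t); split=> //; apply: inSO1.
- case: (split_ordP l) => [l' ->|l' ->]; case: (split_ordP i) => [i' ->|i' ->].
  + by rewrite !block_mxEul !mxE eq_lshift !mulr0 !addr0.
  + by rewrite !block_mxEur !mxE eq_lrshift !mulr0 !addr0.
  + by rewrite !block_mxEdl !mxE eq_rlshift !mulr0 !addr0.
  by rewrite !block_mxEdr hE !mxE eq_rshift.
case: (split_ordP l) => [l' ->|l' ->]; case: (split_ordP i) => [i' ->|i' ->].
- by under eq_fun => t do rewrite block_mxEul mxE; apply: bounded01_cst.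
- by under eq_fun => t do rewrite block_mxEur mxE; apply: bounded01_cst.
- by under eq_fun => t do rewrite block_mxEdl mxE; apply: bounded01_cst.
by under eq_fun => t do rewrite block_mxEdr.
Qed.

(** The action of the matrix unit [(b, a)] of gl(p) on forms. Its difference with [(a, b)] belongs
    to so(p), so invariance becomes a symmetry in the two indices. *)
Definition lie_p (b a : 'I_p) phi : E :=
  ext_map (@euler R p q k (lshift q b) (lshift q a)) phi +
  \sum_n ext_mulb (b, n) (ext_iotab (a, n) phi).

Definition lie_q (n m : 'I_q) phi : E :=
  ext_map (@euler R p q k (rshift p n) (rshift p m)) phi +
  \sum_b ext_mulb (b, n) (ext_iotab (b, m) phi).

Lemma lie_p_invariant (b a : 'I_p) phi : b != a -> invariant phi ->
  lie_p b a phi = lie_p a b phi.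
Proof.
move=> neq_ba phiK; apply/eqP; rewrite -subr_eq0; apply/eqP.
rewrite -(lie_form_so_p neq_ba phiK) /lie_form /lie_p opprD addrACA.
congr (_ + _).
  apply/ffunP=> S; rewrite !ffunE /= /lie_fock big_split_ord /=.
  rewrite [X in _ = _ + X]big1 ?addr0 => [|l _]; last first.
    rewrite big_split_ord /= big1 => [|i _]; last by rewrite block_mxEdl mxE scale0r.
    by rewrite add0r big1 // => i _; rewrite block_mxEdr mxE scale0r.
  rewrite -(plane_sum b a (fun l i => euler (lshift q l) (lshift q i) (phi S))).
  apply: eq_bigr => l _; rewrite big_split_ord /= [X in _ = _ + X]big1 ?addr0 => [|i _].
    by apply: eq_bigr => i _; rewrite block_mxEul.
  by rewrite block_mxEur mxE scale0r.
rewrite /lie_ext (eq_ext_deriv (a' := fun x y => (plane R b a y.1 x.1)%:C * (y.2 == x.2)%:R)).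
  rewrite (ext_deriv_left (fun l i => (plane R b a l i)%:C)).
  exact/esym/(plane_sum b a (fun l i => \sum_n ext_mulb (l, n) (ext_iotab (i, n) phi))).
have z0 n (l i : 'I_n) : (0 : 'M[R]_n) l i = 0 by rewrite mxE.
move=> x y; rewrite /p0_deriv block_mxEul block_mxEdr z0 mulr0 addr0 rmorphM.
by rewrite -[(_ == _)%:R in RHS](rmorph_nat (real_complex R)).
Qed.

Lemma lie_q_invariant (b a : 'I_q) phi : b != a -> invariant phi ->
  lie_q b a phi = lie_q a b phi.
Proof.
move=> neq_ba phiK; apply/eqP; rewrite -subr_eq0; apply/eqP.
rewrite -(lie_form_so_q neq_ba phiK) /lie_form /lie_q opprD addrACA.
congr (_ + _).
  apply/ffunP=> S; rewrite !ffunE /= /lie_fock big_split_ord /=.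
  rewrite [X in _ = X + _]big1 ?add0r => [|l _]; last first.
    rewrite big_split_ord /= big1 => [|i _]; last by rewrite block_mxEul mxE scale0r.
    by rewrite add0r big1 // => i _; rewrite block_mxEur mxE scale0r.
  rewrite -(plane_sum b a (fun l i => euler (rshift p l) (rshift p i) (phi S))).
  apply: eq_bigr => l _; rewrite big_split_ord /= [X in _ = X + _]big1 ?add0r => [|i _].
    by apply: eq_bigr => i _; rewrite block_mxEdr.
  by rewrite block_mxEdl mxE scale0r.
rewrite /lie_ext (eq_ext_deriv (a' := fun x y => (y.1 == x.1)%:R * (plane R b a y.2 x.2)%:C)).
  rewrite (ext_deriv_right (fun l i => (plane R b a l i)%:C)).
  exact/esym/(plane_sum b a (fun l i => \sum_n ext_mulb (n, l) (ext_iotab (n, i) phi))).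
have z0 n (l i : 'I_n) : (0 : 'M[R]_n) l i = 0 by rewrite mxE.
move=> x y; rewrite /p0_deriv block_mxEul block_mxEdr z0 mul0r add0r rmorphM.
by rewrite -[(_ == _)%:R in RHS](rmorph_nat (real_complex R)).
Qed.
End LieRelations.

Section CurvatureCancellation.
Variables (K : numFieldType) (W : lmodType K) (p q : nat).
Local Notation I := ('I_p * 'I_q)%type.
Variable A : I -> {linear W -> W}.
Hypothesis aA : anticomm A.

Lemma eq_opp0 (w : W) : w = - w -> w = 0.
Proof.
move/eqP; rewrite -addr_eq0 -mulr2n -scaler_nat scaler_eq0 pnatr_eq0 /=.
by move/eqP.
Qed.

Lemma sym_sum0 (n : nat) (x : 'I_n -> I) (F : 'I_n -> 'I_n -> W) :
  (forall i j, i != j -> F i j = F j i) ->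
  \sum_i \sum_j A (x i) (A (x j) (F i j)) = 0.
Proof.
have [AA AC] := aA; move=> FC; apply: eq_opp0.
rewrite {1}exchange_big -sumrN; apply: eq_bigr => i _.
rewrite -sumrN; apply: eq_bigr => j _ /=; rewrite AC.
by have [->|neq_ij] := eqVneq i j; rewrite ?AA ?oppr0 // FC // eq_sym.
Qed.

(* By antisymmetry each of the two sums is a sum cubic in A, and the cubic sums
   are opposite to each other.                                                *)
Lemma curvature_cancel (ep : 'I_p -> 'I_p -> W) (eq : 'I_q -> 'I_q -> W)
    (io : I -> W) :
  (forall b a, b != a -> ep b a + \sum_n A (b, n) (io (a, n)) =
                         ep a b + \sum_n A (a, n) (io (b, n))) ->
  (forall n m, n != m -> eq n m + \sum_b A (b, n) (io (b, m)) =
                         eq m n + \sum_b A (b, m) (io (b, n))) ->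
  \sum_a \sum_m \sum_n A (a, m) (A (a, n) (eq n m)) +
  \sum_m \sum_a \sum_b A (a, m) (A (b, m) (ep b a)) = 0.
Proof.
move=> hp hq; have [AA AC] := aA.
have Eq : \sum_a \sum_m \sum_n A (a, m) (A (a, n) (eq n m)) =
    - \sum_a \sum_m \sum_n \sum_b A (a, m) (A (a, n) (A (b, n) (io (b, m)))).
  apply/eqP; rewrite -addr_eq0 -big_split /=; apply/eqP; apply: big1 => a _.
  rewrite -big_split /= -[RHS](@sym_sum0 _ (fun m => (a, m))
    (fun m n => eq n m + \sum_b A (b, n) (io (b, m)))); last first.
    by move=> m n neq_mn; apply: hq; rewrite eq_sym.
  apply: eq_bigr => m _; rewrite -big_split; apply: eq_bigr => n _ /=.
  by rewrite !linearD !linear_sum.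
have Ep : \sum_m \sum_a \sum_b A (a, m) (A (b, m) (ep b a)) =
    - \sum_m \sum_a \sum_b \sum_n A (a, m) (A (b, m) (A (b, n) (io (a, n)))).
  apply/eqP; rewrite -addr_eq0 -big_split /=; apply/eqP; apply: big1 => m _.
  rewrite -big_split /= -[RHS](@sym_sum0 _ (fun a => (a, m))
    (fun a b => ep b a + \sum_n A (b, n) (io (a, n)))); last first.
    by move=> a b neq_ab; apply: hp; rewrite eq_sym.
  apply: eq_bigr => a _; rewrite -big_split; apply: eq_bigr => b _ /=.
  by rewrite !linearD !linear_sum.
rewrite Eq Ep -opprD; apply/eqP; rewrite oppr_eq0 addr_eq0 -sumrN; apply/eqP.
transitivity (\sum_n \sum_b \sum_a \sum_m A (a, m) (A (a, n) (A (b, n) (io (b, m))))).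
  rewrite exchange_big /=; under eq_bigr => m _ do rewrite exchange_big /=.
  rewrite exchange_big; apply: eq_bigr => n _ /=.
  under eq_bigr => m _ do rewrite exchange_big /=.
  by rewrite exchange_big; apply: eq_bigr => b _ /=; rewrite exchange_big.
apply: eq_bigr => n _; rewrite -sumrN; apply: eq_bigr => b _.
rewrite -sumrN; apply: eq_bigr => a _; rewrite -sumrN; apply: eq_bigr => m _.
rewrite [LHS]AC [A (a, m) (A (b, n) _)]AC [A (a, n) (- _)]linearN opprK /=.
by rewrite [LHS]AC.
Qed.

(** The argument has the shape of the commutator of [lap x] and [qmul y]. Its scalar term occurs for
    x = y only, where [A x] is applied twice and gives 0. *)
Lemma curvature_sum (ep : 'I_p -> 'I_p -> W) (eq : 'I_q -> 'I_q -> W) (c : K)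
    (w : W) :
  \sum_x \sum_y A x (A y ((x.1 == y.1)%:R *: eq y.2 x.2
      + (x.2 == y.2)%:R *: ep y.1 x.1 + ((x == y)%:R * c) *: w)) =
  \sum_a \sum_m \sum_n A (a, m) (A (a, n) (eq n m)) +
  \sum_m \sum_a \sum_b A (a, m) (A (b, m) (ep b a)).
Proof.
have [AA _] := aA.
rewrite [X in _ = _ + X]exchange_big -big_split /=.
transitivity (\sum_a \sum_m \sum_b \sum_n A (a, m) (A (b, n)
    ((a == b)%:R *: eq n m + (m == n)%:R *: ep b a))).
  rewrite [RHS]pair_bigA; apply: eq_bigr => -[a m] _ /=.
  rewrite [RHS]pair_bigA; apply: eq_bigr => -[b n] _ /=.
  rewrite [A (b, n) _]linearD [A (a, m) _]linearD /=.
  have [[-> ->]|] := eqVneq (a, m) (b, n); last first.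
    by rewrite mul0r scale0r !linear0 addr0.
  by rewrite !AA ?addr0.
apply: eq_bigr => a _; rewrite -big_split; apply: eq_bigr => m _ /=.
under eq_bigr => b _ do under eq_bigr => n _ do
  rewrite [A (b, n) _]linearD [A (a, m) _]linearD /= !linearZ /=.
under eq_bigr => b _ do rewrite big_split.
rewrite big_split; congr (_ + _).
  rewrite (bigD1 a) //= [X in _ + X]big1 ?addr0 => [|b neq_b].
    by apply: eq_bigr => n _; rewrite eqxx scale1r.
  by rewrite big1 // => n _; rewrite eq_sym (negbTE neq_b) scale0r.
apply: eq_bigr => b _; rewrite (bigD1 m) //= eqxx scale1r big1 ?addr0 // => n neq_n.
by rewrite eq_sym (negbTE neq_n) scale0r.
Qed.
End CurvatureCancellation.

Lemma ext_map_comm (F : comNzRingType) (I : finType) (M : lmodType F)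
    (u v s t : M -> M) a b c (phi : ext I M) :
  (forall f, u (v f) = v (u f) + (a *: s f + b *: t f + c *: f)) ->
  ext_map u (ext_map v phi) - ext_map v (ext_map u phi) =
  a *: ext_map s phi + b *: ext_map t phi + c *: phi.
Proof.
by move=> uv; apply/ffunP=> S; rewrite !ffunE uv [v _ + _]addrC addrK.
Qed.

(** * The Weil differential *)

Section SquareZero.
Variables (R : realType) (p q k : nat).
Local Notation P := (fock R p q k).
Local Notation I := ('I_p * 'I_q)%type.
Local Notation E := (ext I P).
Implicit Types (x y : I) (f : P) (phi : E).

Fact delta_key : unit. Proof. exact: tt. Qed.
Definition delta : E -> E := locked_with delta_key (mulop (@lap R p q k)).

Lemma deltaE phi : delta phi = mulop (@lap R p q k) phi.
Proof. by rewrite /delta unlock. Qed.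

Lemma delta_is_linear : linear delta.
Proof. by move=> c u v; rewrite !deltaE linearP. Qed.
HB.instance Definition _ := GRing.isLinear.Build R[i] E E _ delta delta_is_linear.

Lemma weil_opE x j f : weil_op x j f =
  zder (lshift q x.1) j (zder (rshift p x.2) j f) -
  zmul (lshift q x.1) j (zmul (rshift p x.2) j f).
Proof. by rewrite !zderE !zmulE /weil_op mulrA. Qed.

Lemma weil_dE phi : weil_d phi = delta phi - kappa phi.
Proof.
rewrite deltaE kappaE /mulop -sumrB /weil_d.
under eq_bigr => j _ do rewrite pair_bigA /=.
rewrite exchange_big; apply: eq_bigr => -[a m] _ /=.
rewrite -linearB -linear_sum; congr (ext_mulb _ _); apply/ffunP=> S.
rewrite sum_ffunE !ffunE /lap /qmul /contract -sumrB.
by apply: eq_bigr => j _; rewrite ffunE weil_opE.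
Qed.

Lemma zderl_zmull a j b i f :
  zder (lshift q a) j (zmul (lshift q b) i f) =
  ((a == b) && (i == j))%:R *: f + zmul (lshift q b) i (zder (lshift q a) j f) :> P.
Proof. by rewrite zder_zmul eq_lshift [b == a]eq_sym. Qed.

Lemma zderr_zmulr m j n i f :
  zder (rshift p m) j (zmul (rshift p n) i f) =
  ((m == n) && (i == j))%:R *: f + zmul (rshift p n) i (zder (rshift p m) j f) :> P.
Proof. by rewrite zder_zmul eq_rshift [n == m]eq_sym. Qed.

Lemma zderl_zmulr a j n i f :
  zder (lshift q a) j (zmul (rshift p n) i f) =
  zmul (rshift p n) i (zder (lshift q a) j f) :> P.
Proof. by rewrite zder_zmul eq_rlshift scale0r add0r. Qed.

Lemma zderr_zmull m j b i f :
  zder (rshift p m) j (zmul (lshift q b) i f) =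
  zmul (lshift q b) i (zder (rshift p m) j f) :> P.
Proof. by rewrite zder_zmul eq_lrshift scale0r add0r. Qed.

(** Normal ordering: one contraction leaves an Euler operator of the p- or the q-block, two
    contractions leave a scalar, collected once for each of the k vectors. *)
Lemma lap_qmul x y f : lap x (qmul y f) = qmul y (lap x f) +
  ((x.1 == y.1)%:R *: euler (rshift p y.2) (rshift p x.2) f +
   (x.2 == y.2)%:R *: euler (lshift q y.1) (lshift q x.1) f +
   ((x == y)%:R * k%:R) *: f).
Proof.
pose cross i : P :=
  (x.1 == y.1)%:R *: zmul (rshift p y.2) i (zder (rshift p x.2) i f)
  + (x.2 == y.2)%:R *: zmul (lshift q y.1) i (zder (lshift q x.1) i f)
  + (x == y)%:R *: f.
have step i j : zder (lshift q x.1) j (zder (rshift p x.2) j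
      (zmul (lshift q y.1) i (zmul (rshift p y.2) i f))) =
    zmul (lshift q y.1) i (zmul (rshift p y.2) i
      (zder (lshift q x.1) j (zder (rshift p x.2) j f))) +
    (i == j)%:R *: cross i.
  rewrite zderr_zmull zderr_zmulr zderl_zmull.
  rewrite [zder (lshift q x.1) j (_ + _)]linearD /= zderl_zmulr.
  rewrite [zder (lshift q x.1) j (_ *: _)]linearZ /=.
  rewrite [zmul (lshift q y.1) i (_ + _)]linearD /=.
  rewrite [zmul (lshift q y.1) i (_ *: _)]linearZ /=.
  have [<-{j}|_] := eqVneq i j; last first.
    by rewrite !andbF !scale0r !add0r addr0.
  rewrite !andbT scale1r /cross.
  have -> : (x == y)%:R = (x.1 == y.1)%:R * (x.2 == y.2)%:R :> R[i].
    by rewrite -natrM mulnb -xpair_eqE -!surjective_pairing.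
  by rewrite scalerDr scalerA !addrA [LHS](ACl (4*2*3*1)).
rewrite /lap /qmul /contract.
under eq_bigr => j _.
  rewrite !linear_sum /=.
  under eq_bigr => i _ do rewrite step.
  rewrite big_split /=.
  over.
rewrite big_split /=; congr (_ + _).
  rewrite exchange_big; apply: eq_bigr => i _ /=.
  by rewrite !linear_sum.
rewrite exchange_big /=.
transitivity (\sum_i cross i).
  apply: eq_bigr => i _; rewrite (bigD1 i) //= eqxx scale1r big1 ?addr0 // => j neq_j.
  by rewrite eq_sym (negbTE neq_j) scale0r.
rewrite /cross !big_split /= /euler !scaler_sumr; congr (_ + _ + _).
by rewrite sumr_const card_ord -scaler_nat scalerA mulrC.
Qed.

Lemma weil_d_homog l phi : ext_homog l phi -> ext_homog l.+1 (weil_d phi).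
Proof.
move=> phil S Sl.
have dl : ext_homog l.+1 (delta phi) by rewrite deltaE; apply: mulop_homog.
have kl : ext_homog l.+1 (kappa phi) by apply: kappa_homog.
have -> : weil_d phi S = delta phi S - kappa phi S.
  by rewrite weil_dE; move: (delta phi) (kappa phi) => u v; rewrite !ffunE.
by rewrite dl // kl // subrr.
Qed.

Lemma weil_d_invariant phi : invariant phi -> invariant (weil_d phi).
Proof.
move=> phiK g gK; rewrite !weil_dE.
have -> : form_act g (delta phi - kappa phi) =
    form_act g (delta phi) - form_act g (kappa phi) by rewrite linearB.
congr (_ - _); last by rewrite -kappa_act // phiK.
rewrite -{2}(phiK g gK) !deltaE; symmetry.
by apply: mulop_act => y f; apply: lap_act.
Qed.

Lemma delta_delta phi : delta (delta phi) = 0.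
Proof.
rewrite !deltaE; apply: mulop_sq0 => x y f.
by apply: contractC => *; apply: zderC.
Qed.

(* The anticommutator of delta and kappa is a combination of infinitesimal
   rotations of k, which kill invariant forms; d^2 need not be 0 elsewhere.    *)
Lemma weil_d_sq phi : invariant phi -> weil_d (weil_d phi) = 0.
Proof.
move=> phiK; rewrite !weil_dE.
have dB (u v : E) : delta (u - v) = delta u - delta v by apply: linearB.
have kB (u v : E) : kappa (u - v) = kappa u - kappa v by apply: linearB.
rewrite (dB (delta phi) (kappa phi)) (kB (delta phi) (kappa phi)).
rewrite (delta_delta phi) (kappa_kappa phi) sub0r subr0.
apply/eqP; rewrite -opprD oppr_eq0; apply/eqP.
rewrite kappaE !deltaE kappaE mulop_anticomm.
have commE x y : ext_map (lap x) (ext_map (qmul y) phi) -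
    ext_map (qmul y) (ext_map (lap x) phi) =
    (x.1 == y.1)%:R *: ext_map (euler (rshift p y.2) (rshift p x.2)) phi +
    (x.2 == y.2)%:R *: ext_map (euler (lshift q y.1) (lshift q x.1)) phi +
    ((x == y)%:R * k%:R) *: phi.
  by apply: ext_map_comm => f; apply: lap_qmul.
transitivity (\sum_x \sum_y ext_mulb x (ext_mulb y
    ((x.1 == y.1)%:R *: ext_map (@euler R p q k (rshift p y.2) (rshift p x.2)) phi +
    (x.2 == y.2)%:R *: ext_map (@euler R p q k (lshift q y.1) (lshift q x.1)) phi +
    ((x == y)%:R * k%:R) *: phi))).
  by apply: eq_bigr => x _; apply: eq_bigr => y _; rewrite commE.
have aA := @ext_mulb_anticomm R[i] I P.
rewrite (curvature_sum aA (fun b a => ext_map (@euler R p q k (lshift q b) (lshift q a)) phi)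
  (fun n m => ext_map (@euler R p q k (rshift p n) (rshift p m)) phi)).
apply: (curvature_cancel aA (io := fun x => ext_iotab x phi)) => [b a neq_ba|n m neq_nm].
  exact: lie_p_invariant.
exact: lie_q_invariant.
Qed.
End SquareZero.

(** * Lowering the polynomial degree of a primitive *)

Section DegreeReduction.
Variables (R : realType) (p q k : nat).
Hypothesis le_kq_p : (k * q <= p)%N.
Local Notation P := (fock R p q k).
Local Notation I := ('I_p * 'I_q)%type.
Local Notation E := (ext I P).
Implicit Types (x y : I) (f : P) (phi psi chi : E).

Lemma pihomog_zmul d i j f :
  pihomog mdeg d.+1 (zmul i j f) = zmul i j (pihomog mdeg d f) :> P.
Proof. by rewrite !zmulE pihomog_XM. Qed.

Lemma pihomog_act g d f : inK g ->
  pihomog mdeg d (fock_act g f) = fock_act g (pihomog mdeg d f) :> P.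
Proof.
move=> gK; pose G : {linear P -> P} := fock_act g.
have actP c u v : fock_act g (c *: u + v) = c *: fock_act g u + fock_act g v :> P.
  exact: (linearP G).
elim/fock_ind: f d => [c f h IHf IHh|| i j f IH] d.
- have piP (u v : P) : pihomog mdeg d (c *: u + v) =
      c *: pihomog mdeg d u + pihomog mdeg d v :> P by apply: pihomog_is_linear.
  by rewrite (actP c f h) (piP f h) (piP _ _) (actP c) -(IHf d) -(IHh d).
- rewrite fock_act1 pihomog1; case: ifP => _; first exact/esym/fock_act1.
  exact/esym/(linear0 G).
rewrite fock_act_zmul // linear_sum.
case: d => [|d].
  rewrite zmulE pihomog0_XM big1 => [|l _]; first exact/esym/(linear0 G).
  by rewrite linearZ /= zmulE pihomog0_XM scaler0.
rewrite pihomog_zmul fock_act_zmul //; apply: eq_bigr => l _.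
by rewrite linearZ /= pihomog_zmul IH.
Qed.

Definition deg_lt (N : nat) phi : Prop :=
  forall S (m : 'X_{1..(p + q) * k}), (N <= mdeg m)%N -> (phi S)@_m = 0.

Definition form_part (N : nat) phi : E := ext_map (fun f => pihomog mdeg N f : P) phi.

Lemma form_part_coef N phi S m :
  (form_part N phi S)@_m = if mdeg m == N then (phi S)@_m else 0.
Proof. by rewrite ffunE mcoeff_pihomog. Qed.

Lemma form_part_pol_homog N phi : pol_homog 0 N (form_part N phi).
Proof. by move=> S m; rewrite addn0 form_part_coef => /negbTE ->. Qed.

Lemma form_part_homog l N phi : ext_homog l phi -> ext_homog l (form_part N phi).
Proof. by move=> phil S Sl; rewrite ffunE phil // linear0. Qed.

Lemma form_part_invariant N phi : invariant phi -> invariant (form_part N phi).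
Proof.
move=> phiK g gK; rewrite -{2}(phiK g gK) /form_part /form_act.
pose pi : {linear P -> P} := pihomog mdeg N.
rewrite (@ext_act_map _ _ _ (coad g) (fock_act g : {linear P -> P}) unit (fun=> 1) pi (fun=> pi)).
  by rewrite (bigD1 tt) //= big1 => [|[]]; rewrite // addr0 scale1r.
move=> f; rewrite (bigD1 tt) //= big1 => [|[]]; rewrite // addr0 scale1r.
exact/esym/pihomog_act.
Qed.

Lemma delta_coef0 phi S (m : 'X_{1..(p + q) * k}) :
    (forall T (m' : 'X_{1..(p + q) * k}), mdeg m' = (mdeg m).+2 -> (phi T)@_m' = 0) ->
  (delta phi S)@_m = 0.
Proof.
move=> phi0; rewrite deltaE /mulop sum_ffunE raddf_sum big1 // => x _.
rewrite !ffunE /=; case: ifP => _; last by rewrite mcoeff0.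
rewrite mcoeffZ /lap /contract raddf_sum big1 ?mulr0 // => j _ /=.
rewrite !zderE !mcoeff_mderiv phi0 ?mul0rn //.
by rewrite !mdegD !mdeg1 !addn1.
Qed.

Lemma kappa_form_part N phi S m : mdeg m = N.+2 ->
  (kappa (form_part N phi) S)@_m = (kappa phi S)@_m.
Proof.
move=> mN; rewrite !kappa_coef; apply: eq_bigr => y _; congr (_ * _).
apply: eq_bigr => j _; case: ifP => // le_m; rewrite form_part_coef.
rewrite ifT //; apply/eqP/succn_inj/succn_inj; rewrite -mN -{2}(submK le_m).
by rewrite mdegD mdeg_zidx2 addn2.
Qed.

(** In degree N + 2 only [kappa] of the top part of [psi] contributes to [weil_d psi], so the top
    part is a [kappa]-cocycle. Its primitive has degree N - 2, and [delta] maps that to a still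
    lower degree, so removing the top part creates no new one. *)
Lemma degree_step l N psi : (l < k * q)%N -> ext_homog l psi -> invariant psi ->
    deg_lt N.+1 psi ->
    (forall S (m : 'X_{1..(p + q) * k}), mdeg m = N.+2 -> (weil_d psi S)@_m = 0) ->
  exists chi, [/\ invariant chi, deg_lt N (psi - weil_d chi)
    & if l is l'.+1 then ext_homog l' chi else chi = 0].
Proof.
move=> lt_l psil psiK psiN dpsi.
have [||||chi [partE chiN chiK chil]] :=
    @invariant_primitive R p q k l N (form_part N psi) le_kq_p lt_l.
- exact: form_part_homog.
- exact: form_part_pol_homog.
- exact: form_part_invariant.
- apply/ffunP=> S; rewrite [RHS]ffunE; apply/mpolyP=> m; rewrite mcoeff0.
  have [mN|mN] := eqVneq (mdeg m) N.+2; last first.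
    have kN := kappa_pol_homog (@form_part_pol_homog N psi).
    by apply: kN; rewrite addn0.
  rewrite kappa_form_part //; apply/eqP; rewrite -oppr_eq0; apply/eqP.
  rewrite -(dpsi S m mN) weil_dE; have d0 := @delta_coef0 psi S m.
  have -> : ((delta psi - kappa psi) S)@_m = (delta psi S)@_m - (kappa psi S)@_m.
    by move: (delta psi) (kappa psi) => u v; rewrite !ffunE mcoeffB.
  rewrite d0 ?sub0r // => T m' m'E; apply: psiN.
  by rewrite m'E mN; lia.
(* The sign accounts for [weil_d] being [delta] minus [kappa]. *)
exists (- chi); split.
- move=> g gK; have oppE (u : E) : - u = (-1) *: u + 0 by rewrite scaleN1r addr0.
  rewrite oppE; apply: invariantP => // h hK.
  by rewrite [LHS](linear0 (form_act h : {linear E -> E})).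
- move=> S m leN; have -> : psi - weil_d (- chi) = psi - form_part N psi + delta chi.
    rewrite weil_dE partE !linearN /=; move: (kappa chi) (delta chi) => u v.
    by rewrite opprB opprK addrA.
  have -> : ((psi - form_part N psi + delta chi) S)@_m =
      (psi S)@_m - (form_part N psi S)@_m + (delta chi S)@_m.
    by move: (form_part N psi) (delta chi) => u v; rewrite !ffunE mcoeffD mcoeffB.
  rewrite (@delta_coef0 chi) ?addr0 => [|T m' m'E]; last first.
    by apply: chiN; rewrite m'E; lia.
  rewrite form_part_coef; case: eqP => [_|/eqP mN]; first by rewrite subrr.
  by rewrite subr0; apply: psiN; rewrite ltn_neqAle eq_sym mN.
case: (l) chil => [->|l' chil]; first by rewrite oppr0.
by move=> S Sl; rewrite ffunE chil // oppr0.
Qed.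

Lemma deg_lt_exists phi : exists N, deg_lt N phi.
Proof.
exists (\max_S \max_(m <- msupp (phi S)) (mdeg m).+1)%N => S m leN.
apply/memN_msupp_eq0/negP => mS.
have := leq_trans (leq_trans (leq_bigmax_seq _ mS isT) (leq_bigmax S)) leN.
by rewrite ltnn.
Qed.

(** [psi] is traded for a form of low degree with the same differential; for a cocycle, N0 = 0
    leaves nothing. That the differential is unchanged rests on [weil_d_sq], hence on invariance at
    every step. *)
Lemma degree_reduction l N0 psi : (l < k * q)%N -> ext_homog l psi ->
    invariant psi -> deg_lt N0.+2 (weil_d psi) ->
  exists chi, [/\ invariant chi, deg_lt N0 (psi - weil_d chi)
    & if l is l'.+1 then ext_homog l' chi else chi = 0].
Proof.
move=> lt_l psil psiK dpsi; have [N psiN] := deg_lt_exists psi.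
have {}psiN : deg_lt (N0 + N) psi.
  by move=> S m leN; apply: psiN; apply: leq_trans leN; apply: leq_addl.
elim: N psi psil psiK dpsi psiN => [|N IHN] psi psil psiK dpsi psiN.
  exists 0; split; last by case: (l) => [|l'] // S _; rewrite ffunE.
    by move=> g gK; apply: (linear0 (form_act g : {linear E -> E})).
  by rewrite linear0 subr0 -[N0]addn0.
rewrite addnS in psiN.
have [|chi [chiK chiN chil]] := degree_step lt_l psil psiK psiN.
  by move=> S m mN; apply: dpsi; rewrite mN !ltnS leq_addr.
have dl : ext_homog l (weil_d chi).
  case: (l) chil => [->|l' chil]; last exact: weil_d_homog.
  by rewrite linear0 => S _; rewrite ffunE.
have subE (u v : E) : u - v = (-1) *: v + u by rewrite scaleN1r addrC.
have [||||chi' [chi'K chi'N chi'l]] := IHN (psi - weil_d chi).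
- by rewrite subE; apply: ext_homogP.
- by rewrite subE; apply: invariantP => //; apply: weil_d_invariant.
- rewrite (linearB (@weil_d R p q k : {linear E -> E})) /=.
  by rewrite weil_d_sq // subr0.
- exact: chiN.
have addE (u v : E) : u + v = 1 *: u + v by rewrite scale1r.
exists (chi + chi'); split.
- by rewrite addE; apply: invariantP.
- by rewrite (linearD (@weil_d R p q k : {linear E -> E})) /= opprD addrA.
case: (l) chil chi'l => [-> ->|l' chil chi'l]; first by rewrite addr0.
by rewrite addE; apply: ext_homogP.
Qed.

Lemma weil_d_exact l phi : (l < k * q)%N -> ext_homog l phi -> invariant phi ->
    weil_d phi = 0 ->
  exists chi, [/\ invariant chi, phi = weil_d chi
    & if l is l'.+1 then ext_homog l' chi else chi = 0].
Proof.
move=> lt_l phil phiK dphi.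
have [|chi [chiK chi0 chil]] := @degree_reduction l 0 phi lt_l phil phiK.
  by move=> S m _; rewrite dphi ffunE mcoeff0.
exists chi; split=> //; apply/eqP; rewrite -subr_eq0; apply/eqP/ffunP=> S.
by rewrite [RHS]ffunE; apply/mpolyP=> m; rewrite chi0 // mcoeff0.
Qed.
End DegreeReduction.

(** * The class in degree pq *)

Section Gaussian.
Variables (n : nat) (C : numFieldType).
Implicit Types (f : {mpoly C[n]}) (i : 'I_n) (m : 'X_{1..n}).

(** Moments of the standard Gaussian; through them the integral is a purely algebraic functional. *)
Fixpoint gauss_moment (d : nat) : C :=
  match d with
  | 0 => 1
  | 1 => 0
  | d'.+2 => d'.+1%:R * gauss_moment d'
  end.

Definition gauss : {mpoly C[n]} -> C^o :=
  mlift (fun m => \prod_i gauss_moment (m i) : C^o).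
HB.instance Definition _ := GRing.Linear.on gauss.

Lemma gaussX m : gauss 'X_[m] = \prod_i gauss_moment (m i).
Proof. by rewrite /gauss mliftX. Qed.

(* Integration by parts: E[X f(X)] = E[f'(X)] for a standard Gaussian X.     *)
Lemma gauss_XM i f : gauss ('X_i * f) = gauss f^`M(i).
Proof.
elim/mpolyind: f => [|c m f _ _ IH]; first by rewrite mulr0 mderiv0.
rewrite mulrDr -scalerAr [gauss (_ + _)]linearP /= IH mderivD mderivZ.
rewrite [RHS]linearP /=; congr (_ *: _ + _).
rewrite -mpolyXD mderivX linearZ /= !gaussX.
rewrite (bigD1 i) //= [in RHS](bigD1 i) //= [RHS]mulrA; congr (_ * _); last first.
  apply: eq_bigr => j neq_j.
  by rewrite mnmDE mnmBE mnm1E eq_sym (negbTE neq_j) subn0.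
rewrite mnmDE mnmBE mnm1E eqxx add1n.
by case: (m i) => [|d]; rewrite ?mul0r // subSS subn0.
Qed.

Lemma gauss1 : gauss 1 = 1.
Proof.
by rewrite -mpolyX0 gaussX big1 // => i _; rewrite mnm0E.
Qed.
End Gaussian.

Lemma foldr_flatten_map (T J S : Type) (h : T -> S -> S) (t : J -> seq T) v s :
  foldr h v (flatten [seq t i | i <- s]) = foldr (fun i w => foldr h w (t i)) v s.
Proof. by elim: s => //= i s IHs; rewrite foldr_cat IHs. Qed.

Lemma det_realC (R : realType) n (a : 'M[R]_n) : \det a = 1 ->
  \det (map_mx (real_complex R) a)^T = 1.
Proof. by move=> a1; rewrite det_tr det_map_mx a1 rmorph1. Qed.

Lemma eq_foldr (T S : Type) (h h' : T -> S -> S) :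
  (forall i w, h i w = h' i w) -> forall w s, foldr h w s = foldr h' w s.
Proof. by move=> eq_h w; elim=> //= i s ->. Qed.

Lemma foldr_det1 (F : comNzRingType) (W : lmodType F) (J : Type) (n : nat)
    (X : J * 'I_n -> {linear W -> W}) (A : 'M[F]_n) w s :
    anticomm X -> \det A = 1 ->
  foldr (fun i u => foldr (fun a v => \sum_b A a b *: X (i, b) v) u (enum 'I_n)) w s =
  foldr (fun i u => foldr (fun a => X (i, a)) u (enum 'I_n)) w s.
Proof.
move=> aX det1; elim: s => //= i s ->.
rewrite (@foldr_det _ _ _ (fun a => X (i, a))) ?det1 ?scale1r //.
exact: (anticomm_comp (fun a => (i, a)) aX).
Qed.

Section TopClass.
Variables (R : realType) (p q k : nat).
Local Notation P := (fock R p q k).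
Local Notation I := ('I_p * 'I_q)%type.
Local Notation E := (ext I P).
Implicit Types (x y : I) (f : P) (phi psi : E).

Definition gauss_fock (f : P) : R[i] := gauss f.

Lemma gauss_fockD f h : gauss_fock (f + h) = gauss_fock f + gauss_fock h.
Proof. exact: (linearD (@gauss _ _)). Qed.

Lemma gauss_fockZ c f : gauss_fock (c *: f) = c * gauss_fock f.
Proof. by rewrite /gauss_fock linearZ. Qed.

Lemma gauss_fock0 : gauss_fock 0 = 0.
Proof. exact: (linear0 (@gauss _ _)). Qed.

Lemma gauss_fock_sum n (F : 'I_n -> P) :
  gauss_fock (\sum_j F j) = \sum_j gauss_fock (F j).
Proof. exact: (big_morph gauss_fock gauss_fockD gauss_fock0). Qed.

Lemma gauss_fock_zmul i j f : gauss_fock (zmul i j f) = gauss_fock (zder i j f).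
Proof. by rewrite zmulE zderE; apply: gauss_XM. Qed.

(** Two integrations by parts; the two variables of each summand are distinct, so the multiplication
    by one commutes with the derivative in the other. *)
Lemma gauss_fock_lap x f : gauss_fock (lap x f) = gauss_fock (qmul x f).
Proof.
rewrite /lap /qmul /contract !gauss_fock_sum; apply: eq_bigr => j _.
by rewrite gauss_fock_zmul zderl_zmulr gauss_fock_zmul zderC.
Qed.

Lemma gauss_weil_d psi : gauss_fock (weil_d psi setT) = 0.
Proof.
have mulopE (D : I -> {linear P -> P}) phi : phi = mulop D psi ->
    gauss_fock (phi setT) =
    \sum_x (-1) ^+ ext_below x setT * gauss_fock (D x (psi (setT :\ x))).
  move=> ->; rewrite /mulop sum_ffunE (big_morph gauss_fock gauss_fockD gauss_fock0).
  by apply: eq_bigr => x _; rewrite !ffunE inE gauss_fockZ.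
have -> : weil_d psi setT = delta psi setT + (-1) *: kappa psi setT.
  rewrite weil_dE; move: (delta psi) (kappa psi) => u v.
  by rewrite !ffunE scaleN1r.
rewrite (gauss_fockD (delta psi setT)) (gauss_fockZ (-1) (kappa psi setT)) mulN1r.
rewrite (mulopE _ _ (deltaE psi)) (mulopE _ _ (kappaE psi)).
apply/eqP; rewrite subr_eq0; apply/eqP; apply: eq_bigr => x _.
by rewrite /= gauss_fock_lap.
Qed.

Definition top_form : E := ext_mono setT (1 : P).

Lemma top_form_homog : ext_homog (p * q) top_form.
Proof.
move=> S Sl; rewrite ffunE; case: eqP => // S1; move: Sl.
by rewrite S1 cardsT card_prod !card_ord eqxx.
Qed.

Lemma ext_homog_gt l phi : (p * q < l)%N -> ext_homog l phi -> phi = 0.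
Proof.
move=> lt_l phil; apply/ffunP=> S; rewrite ffunE phil //.
have := max_card (mem S); rewrite card_prod !card_ord => le_S.
by rewrite neq_ltn (leq_ltn_trans le_S lt_l).
Qed.

Lemma weil_d_top : weil_d top_form = 0.
Proof. by apply: (@ext_homog_gt (p * q).+1) => //; apply/weil_d_homog/top_form_homog. Qed.

(** The factors of the volume form may be taken in any order; [top_form_invariant] uses them by rows
    and by columns. *)
Lemma top_form_list (s : seq I) : uniq s -> (forall x, x \in s) ->
  exists c : R[i], top_form = c *: foldr (@ext_mulb R[i] I P) (ext_mono set0 (1 : P)) s.
Proof.
move=> us sT; have /(@perm_foldr_sign R[i] E)[b bE] : perm_eq (enum [set: I]) s.
  by apply: uniq_perm; rewrite ?enum_uniq // => x; rewrite mem_enum inE sT.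
exists ((-1) ^+ b); rewrite -(bE _ _ (@ext_mulb_anticomm R[i] I P)).
by rewrite /top_form ext_monoE.
Qed.

(** [coad g] is the Kronecker product of [a] and [b]. With the factors grouped by rows, each row is
    multiplied by det b; grouped by columns, each column by det a. *)
Lemma top_form_invariant : invariant top_form.
Proof.
move=> g gK; have [a [b [aS bS gE]]] := gK.
have [_ det_a] := aS; have [_ det_b] := bS.
(* [coad g] with [b] replaced by the identity, the stage between the two groupings. *)
pose c1 (x y : I) : R[i] := (a y.1 x.1)%:C * (y.2 == x.2)%:R.
pose rho : {linear P -> P} := fock_act g.
have rho1 : rho 1 = 1 by apply: fock_act1.
pose s1 := flatten [seq [seq (i, m) | m <- enum 'I_q] | i <- enum 'I_p].
pose s2 := flatten [seq [seq (i, m) | i <- enum 'I_p] | m <- enum 'I_q].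
have [d1 top1] : exists d1 : R[i],
    top_form = d1 *: foldr (@ext_mulb R[i] I P) (ext_mono set0 (1 : P)) s1.
  apply: top_form_list => [|[i m]].
    by apply: allpairs_uniq; rewrite ?enum_uniq // => -[? ?] [? ?].
  by apply/allpairsP; exists (i, m); rewrite !mem_enum.
have [d2 top2] : exists d2 : R[i],
    top_form = d2 *: foldr (@ext_mulb R[i] I P) (ext_mono set0 (1 : P)) s2.
  apply: top_form_list => [|[i m]].
    apply: (allpairs_uniq (f := fun m i => (i, m))); rewrite ?enum_uniq // => -[? ?] [? ?] _ _ /=.
    by case=> -> ->.
  by apply/allpairsP; exists (m, i); rewrite !mem_enum.
have actZ (c : I -> I -> R[i]) d (phi : E) : ext_act c rho (d *: phi) = d *: ext_act c rho phi.
  by rewrite linearZ.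
have step1 : ext_act (coad g) rho top_form = ext_act c1 rho top_form.
  rewrite top1 !actZ !ext_act_foldr !ext_act_mono0 rho1 /s1 !foldr_flatten_map.
  congr (_ *: _).
  under eq_foldr => i w do rewrite foldr_map.
  under [RHS]eq_foldr => i w do rewrite foldr_map.
  rewrite -(@foldr_det1 _ E 'I_p q
    (fun x => ext_mul (c1 x) : {linear E -> E}) _ _ _ _ (det_realC det_b)); last first.
    exact: ext_mul_anticomm.
  apply: eq_foldr => i w; apply: eq_foldr => m {}w /=.
  rewrite /ext_mul; under [RHS]eq_bigr => n _ do rewrite scaler_sumr.
  rewrite exchange_big; apply: eq_bigr => y _ /=.
  under [RHS]eq_bigr => n _ do rewrite scalerA.
  rewrite -scaler_suml; congr (_ *: _).
  rewrite (bigD1 y.2) //= big1 => [|n neq_n]; last first.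
    by rewrite /c1 /= [y.2 == n]eq_sym (negbTE neq_n) !mulr0.
  by rewrite gE coadE // !mxE /c1 /= eqxx mulr1 addr0 -rmorphM mulrC.
rewrite /form_act step1 top2 !actZ !ext_act_foldr !ext_act_mono0 rho1 /s2 !foldr_flatten_map.
congr (_ *: _).
under eq_foldr => i w do rewrite foldr_map.
under [RHS]eq_foldr => i w do rewrite foldr_map.
rewrite -(@foldr_det1 _ E 'I_q p
    (fun x : 'I_q * 'I_p => ext_mulb (x.2, x.1) : {linear E -> E})
    _ _ _ _ (det_realC det_a)) /=; last first.
  exact: (anticomm_comp (fun x : 'I_q * 'I_p => (x.2, x.1)) (@ext_mulb_anticomm _ _ _)).
apply: eq_foldr => m w; apply: eq_foldr => i {}w /=.
have -> : ext_mul (c1 (i, m)) w =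
    \sum_i' \sum_n c1 (i, m) (i', n) *: ext_mulb (i', n) w.
  by rewrite pair_bigA; apply: eq_bigr => -[].
apply: eq_bigr => i' _; rewrite (bigD1 m) //= big1 => [|n neq_n].
  by rewrite /c1 /= eqxx mulr1 addr0 !mxE.
by rewrite /c1 /= (negbTE neq_n) mulr0 scale0r.
Qed.

Lemma top_form_nonexact psi : top_form <> weil_d psi.
Proof.
move=> topE; have := gauss_weil_d psi; rewrite -topE ffunE eqxx => /eqP.
by rewrite /gauss_fock gauss1 oner_eq0.
Qed.
End TopClass.

(** * The class in degree kq *)

Section KudlaMillson.
Variables (R : realType) (p q k : nat).
Local Notation P := (fock R p q k).
Local Notation I := ('I_p * 'I_q)%type.
Local Notation B := ('I_k * 'I_q)%type.
Local Notation E := (ext I P).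
Implicit Types (x y : I) (b : B) (f : P) (phi psi : E) (bs : seq B).

(* eta (j, m) is exterior multiplication by \sum_i z_(i, j) omega_(i, m).    *)
Definition eta_coef b x f : P := (x.2 == b.2)%:R *: zmul (lshift q x.1) b.1 f.

Lemma eta_coef_is_linear b x : linear (eta_coef b x).
Proof.
by move=> c u v; rewrite /eta_coef linearP scalerDr !scalerA mulrC.
Qed.
HB.instance Definition _ b x :=
  GRing.isLinear.Build R[i] P P _ (eta_coef b x) (eta_coef_is_linear b x).

Lemma eta_coefC b x b' y f :
  eta_coef b x (eta_coef b' y f) = eta_coef b' y (eta_coef b x f).
Proof. by rewrite /eta_coef !linearZ /= !scalerA mulrC zmulC. Qed.

Fact eta_key : unit. Proof. exact: tt. Qed.
Definition eta b : E -> E := locked_with eta_key (mulop (eta_coef b)).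

Lemma etaE b phi : eta b phi = mulop (eta_coef b) phi.
Proof. by rewrite /eta unlock. Qed.

Lemma eta_is_linear b : linear (eta b).
Proof. by move=> c u v; rewrite !etaE linearP. Qed.
HB.instance Definition _ b := GRing.isLinear.Build R[i] E E _ (eta b) (eta_is_linear b).

Lemma eta_anticomm : anticomm (fun b => eta b : {linear E -> E}).
Proof.
split=> [b phi|b b' phi] /=; rewrite !etaE.
  by apply: mulop_sq0 => x y f; apply: eta_coefC.
apply/eqP; rewrite -addr_eq0 mulop_anticomm; apply/eqP.
rewrite big1 // => x _; rewrite big1 // => y _.
have -> : ext_map (eta_coef b x) (ext_map (eta_coef b' y) phi) =
    ext_map (eta_coef b' y) (ext_map (eta_coef b x) phi).
  by apply/ffunP=> S; rewrite !ffunE; apply: eta_coefC.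
by rewrite subrr !linear0.
Qed.

Lemma eta_sum b phi :
  eta b phi = \sum_i ext_mulb (i, b.2) (ext_map (zmul (lshift q i) b.1) phi).
Proof.
rewrite etaE /mulop.
transitivity (\sum_i \sum_m ext_mulb (i, m) (ext_map (eta_coef b (i, m)) phi)).
  by rewrite pair_bigA; apply: eq_bigr => -[].
apply: eq_bigr => i _; rewrite (bigD1 b.2) //= big1 ?addr0 => [|m neq_m].
  congr ext_mulb; apply/ffunP=> S; rewrite !ffunE /=.
  by rewrite /eta_coef /= eqxx scale1r.
suff -> : ext_map (eta_coef b (i, m)) phi = 0 by rewrite linear0.
by apply/ffunP=> S; rewrite !ffunE /= /eta_coef /= (negbTE neq_m) scale0r.
Qed.

Lemma ext_map_eta (u : {linear P -> P}) b phi :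
    (forall i f, u (zmul (lshift q i) b.1 f) = zmul (lshift q i) b.1 (u f)) ->
  ext_map u (eta b phi) = eta b (ext_map u phi).
Proof.
move=> uC; rewrite !eta_sum linear_sum; apply: eq_bigr => i _ /=.
rewrite ext_map_mulb; congr ext_mulb; apply/ffunP=> S; rewrite !ffunE /=.
exact: uC.
Qed.

Definition eta_form bs : E := foldr eta (ext_mono set0 (1 : P)) bs.

Lemma ext_map_eta_form (u : {linear P -> P}) bs :
    (forall i j f, u (zmul (lshift q i) j f) = zmul (lshift q i) j (u f)) ->
  ext_map u (eta_form bs) = foldr eta (ext_mono set0 (u 1)) bs.
Proof.
move=> uC; elim: bs => [|b bs IHbs] /=; first exact: ext_map_mono.
by rewrite ext_map_eta ?IHbs.
Qed.

Lemma eta_form_homog bs : ext_homog (size bs) (eta_form bs).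
Proof.
elim: bs => [|b bs IHbs] /=; last by rewrite etaE; apply: mulop_homog.
move=> S S_neq0; rewrite ffunE; case: eqP => // S0.
by move: S_neq0; rewrite S0 cards0.
Qed.

(** [kappa] is a combination of the operators [eta b], each of which kills a product that already
    contains it; this gives [kappa_eta_form]. *)
Lemma kappa_eta phi :
  kappa phi = \sum_b eta b (ext_map (zmul (rshift p b.2) b.1) phi).
Proof.
rewrite kappaE /mulop; under [RHS]eq_bigr => b _ do rewrite etaE /mulop.
rewrite exchange_big; apply: eq_bigr => x _ /=.
rewrite -linear_sum; congr ext_mulb; apply/ffunP=> S.
rewrite sum_ffunE ffunE /= /qmul /contract.
transitivity (\sum_j \sum_m eta_coef (j, m) x (zmul (rshift p m) j (phi S))).
  apply: eq_bigr => j _; rewrite (bigD1 x.2) //= big1 ?addr0 => [|m neq_m].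
    by rewrite /eta_coef eqxx scale1r.
  by rewrite /eta_coef eq_sym (negbTE neq_m) scale0r.
by rewrite pair_bigA; apply: eq_bigr => -[j m] _; rewrite !ffunE.
Qed.

Lemma kappa_eta_form bs : (forall b, b \in bs) -> kappa (eta_form bs) = 0.
Proof.
move=> bsT; rewrite kappa_eta big1 // => b _.
rewrite -ext_map_eta => [|i f]; last by rewrite /= zmulC.
have /= -> := anticomm_foldr_mem (ext_mono set0 (1 : P)) eta_anticomm (bsT b).
exact: linear0.
Qed.

(** The coefficients involve only variables of the first p rows, and every term of [lap x]
    differentiates in one of the last q. *)
Lemma delta_eta_form bs : delta (eta_form bs) = 0.
Proof.
rewrite deltaE /mulop big1 // => x _.
suff -> : ext_map (lap x) (eta_form bs) = 0 by exact: linear0.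
apply/ffunP=> S; rewrite !ffunE /= /lap /contract big1 // => j _ /=.
suff -> : zder (rshift p x.2) j (eta_form bs S) = 0 by exact: linear0.
have -> : zder (rshift p x.2) j (eta_form bs S) =
    ext_map (zder (rshift p x.2) j) (eta_form bs) S by rewrite ffunE.
rewrite (ext_map_eta_form (u := zder (rshift p x.2) j)) => [|i j' f]; last first.
  by rewrite /= zder_zmul eq_lrshift scale0r add0r.
rewrite /= zder1 linear0; elim: bs S => [|b bs IHbs] S /=; first by rewrite ffunE.
suff -> : foldr eta 0 bs = 0 by rewrite linear0 ffunE.
by apply/ffunP=> T; rewrite IHbs ffunE.
Qed.

Lemma weil_d_eta_form bs : (forall b, b \in bs) -> weil_d (eta_form bs) = 0.
Proof. by move=> bsT; rewrite weil_dE delta_eta_form kappa_eta_form // subrr. Qed.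

Lemma mcoeff_eta b phi S (m : 'X_{1..(p + q) * k}) : (eta b phi S)@_m =
  \sum_x if [&& x \in S, x.2 == b.2 & m (mxvec_index (lshift q x.1) b.1) != 0%N]
    then (-1) ^+ ext_below x S
      * (phi (S :\ x))@_(m - U_(mxvec_index (lshift q x.1) b.1))
    else 0.
Proof.
rewrite etaE /mulop sum_ffunE raddf_sum /=; apply: eq_bigr => x _.
rewrite !ffunE /=; case: (x \in S) => /=; last by rewrite mcoeff0.
rewrite mcoeffZ /eta_coef mcoeffZ zmulE mcoeff_XM.
case: (x.2 == b.2) => /=; last by rewrite mul0r mulr0.
by rewrite mul1r; case: eqP => /=; rewrite ?mulr0.
Qed.

Lemma eta_form_pol_homog bs : pol_homog 0 (size bs) (eta_form bs).
Proof.
elim: bs => [|b bs IHbs] S m; rewrite addn0 /= => mN.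
  rewrite ffunE; case: ifP => _; last by rewrite mcoeff0.
  by rewrite mcoeff1 -mdeg_eq0 (negbTE mN).
rewrite mcoeff_eta big1 // => x _; case: ifP => // /and3P[_ _ mx].
rewrite IHbs ?mulr0 // addn0; apply: contra mN => /eqP <-.
by rewrite -{1}(@submK _ U_(mxvec_index (lshift q x.1) b.1)%MM m) ?lep1mP // mdegD mdeg1 addn1.
Qed.


(** The sum over [i] pairs two vectors of SO(p) and is invariant; what remains is a vector of SO(q)
    in the index [m]. *)
Lemma form_act_eta g (a : 'M[R]_p) (c : 'M[R]_q) j m phi :
    inSO a -> inSO c -> g = block_mx a 0 0 c ->
  form_act g (eta (j, m) phi) =
  \sum_n (c n m)%:C *: eta (j, n) (form_act g phi).
Proof.
move=> aS cS gE; have gK : inK g by exists a, c.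
have aa i i' : \sum_l a i l * a i' l = (i == i')%:R.
  have [/(congr1 (fun M : 'M_p => M i i')) aa _] := aS.
  by rewrite !mxE in aa; rewrite -aa; apply: eq_bigr => l _; rewrite mxE.
pose Z i := ext_map (zmul (lshift q i) j) (form_act g phi) : E.
have ZE i : form_act g (ext_map (zmul (lshift q i) j) phi) =
    \sum_l (a l i)%:C *: Z l.
  rewrite /form_act (@ext_act_map _ _ _ (coad g) (fock_act g : {linear P -> P})
    'I_(p + q) (fun l => (g l (lshift q i))%:C) (zmul (lshift q i) j : {linear P -> P})
    (fun l => zmul l j : {linear P -> P})); last by move=> f; apply: fock_act_zmul.
  rewrite big_split_ord /= [X in _ + X]big1 ?addr0 => [|l _]; last first.
    have -> : g (rshift p l) (lshift q i) = 0 by rewrite gE block_mxEdl mxE.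
    by rewrite scale0r.
  apply: eq_bigr => l _; congr (_%:C *: _).
  by rewrite gE block_mxEul.
have act_mulb x psi :
    form_act g (ext_mulb x psi) = ext_mul (coad g x) (form_act g psi).
  exact: (ext_act_mulb (coad g) (fock_act g : {linear P -> P})).
have {}ZE i : form_act g (ext_mulb (i, m) (ext_map (zmul (lshift q i) j) phi)) =
    \sum_l \sum_n (a l i * c n m)%:C *: ext_mulb (l, n) (\sum_l' (a l' i)%:C *: Z l').
  rewrite act_mulb (ZE i) pair_bigA.
  by apply: eq_bigr => -[l n] _; congr (_ *: _); rewrite gE coadE.
rewrite eta_sum linear_sum /=; under eq_bigr => i _ do rewrite ZE.
rewrite exchange_big /=; under [RHS]eq_bigr => n _ do rewrite eta_sum scaler_sumr.
rewrite [RHS]exchange_big; apply: eq_bigr => l _ /=.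
rewrite exchange_big; apply: eq_bigr => n _ /=.
under eq_bigr => i _ do rewrite -linearZ /=.
rewrite -linear_sum -linearZ; congr ext_mulb => /=.
under eq_bigr => i _.
  rewrite scaler_sumr.
  under eq_bigr => l' _ do rewrite scalerA -rmorphM /= mulrAC.
  over.
rewrite exchange_big (bigD1 l) //= [X in _ + X]big1 ?addr0 => [|l' neq_l].
  by rewrite -scaler_suml -rmorph_sum -mulr_suml aa eqxx mul1r.
by rewrite -scaler_suml -rmorph_sum -mulr_suml aa eq_sym (negbTE neq_l) mul0r scale0r.
Qed.

(** The [q] factors with the same [j] stand together, so that [foldr_det1] applies to each block. *)
Definition km_list : seq B := flatten [seq [seq (j, m) | m <- enum 'I_q] | j <- enum 'I_k].

Lemma mem_km_list b : b \in km_list.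
Proof. by case: b => j m; apply/allpairsP; exists (j, m); rewrite !mem_enum. Qed.

Lemma km_list_uniq : uniq km_list.
Proof. by apply: allpairs_uniq; rewrite ?enum_uniq // => -[? ?] [? ?]. Qed.

Lemma size_km_list : size km_list = (k * q)%N.
Proof. by rewrite size_allpairs -!cardE !card_ord. Qed.

Definition km_form : E := eta_form km_list.

Lemma km_form_invariant : invariant km_form.
Proof.
move=> g gK; have [a [c [aS cS gE]]] := gK; have [_ det_c] := cS.
rewrite /km_form /eta_form !foldr_flatten_map.
under [in RHS]eq_foldr => j w do rewrite foldr_map.
rewrite -(@foldr_det1 _ E 'I_k q (fun b => eta b : {linear E -> E}) _ _ _
  eta_anticomm (det_realC det_c)) /=.
elim: (enum 'I_k) => [|j s IHs] /=.
  by rewrite /form_act ext_act_mono0 /= fock_act1.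
rewrite -[in RHS]IHs; move: (foldr _ _ s) => w.
elim: (enum 'I_q) => //= m t IHt.
rewrite (form_act_eta _ _ _ aS cS gE) -IHt; apply: eq_bigr => n _.
by rewrite !mxE.
Qed.

Section NonExactness.
Hypothesis le_kq_p : (k * q <= p)%N.

(** With [km_mnm], the position of the coefficient that obstructs exactness: the diagonal choice in
    each factor. *)
Definition km_set bs : {set I} := [set diag le_kq_p b | b in bs].
Definition km_mnm bs : 'X_{1..(p + q) * k} :=
  (\sum_(b <- bs) U_(mxvec_index (lshift q (diag le_kq_p b).1) b.1))%MM.

Lemma km_mnmE bs i j : km_mnm bs (mxvec_index i j) =
  count (fun b => (lshift q (diag le_kq_p b).1 == i) && (b.1 == j)) bs.
Proof.
rewrite /km_mnm mnm_sumE -sum1_count [RHS]big_mkcond; apply: eq_bigr => b _.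
rewrite mnm1E (inj_eq (can_inj (cast_ordK _))) (inj_eq enum_rank_inj) xpair_eqE.
by case: ifP.
Qed.

(** In the outer factor [eta b] only [diag b] can contribute: the one-form fixes the second index,
    and the row of the variable fixes the first, as its quotient by [q]. *)
Lemma eta_form_lead bs : uniq bs ->
  exists e : nat, (eta_form bs (km_set bs))@_(km_mnm bs) = (-1) ^+ e.
Proof.
elim: bs => [_|b bs IHbs] /=.
  exists 0%N; rewrite ffunE /km_mnm big_nil ifT ?mcoeff1 ?eqxx //.
  by apply/eqP/setP=> x; rewrite inE; apply/imsetP=> -[].
move=> /andP[b_bs /IHbs[e eE]].
have bS : diag le_kq_p b \in km_set (b :: bs) by apply: imset_f; rewrite mem_head.
exists (ext_below (diag le_kq_p b) (km_set (b :: bs)) + e)%N.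
rewrite mcoeff_eta (bigD1 (diag le_kq_p b)) //= bS eqxx big1 => [|x neq_x].
  have -> : km_mnm (b :: bs) =
      (U_(mxvec_index (lshift q (diag le_kq_p b).1) b.1) + km_mnm bs)%MM.
    by rewrite /km_mnm big_cons.
  rewrite mnmDE mnm1E eqxx /= addr0 exprD addmC addmK -eE.
  congr (_ * (eta_form bs _)@_ _); apply/setP=> x; rewrite !inE.
  apply/andP/imsetP => [[neq_x /imsetP[b' b's xE]]|[b' b's ->]].
    exists b' => //; move: b's; rewrite inE; case/orP => // /eqP b'E.
    by rewrite xE b'E eqxx in neq_x.
  rewrite (inj_eq (@diag_inj p q k le_kq_p)); split.
    by apply: contraNneq b_bs => <-.
  by apply: imset_f; rewrite inE b's orbT.
case: ifP => // /and3P[/imsetP[b' _ xE] /eqP x2 xm].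
move: xm; rewrite km_mnmE -lt0n -has_count => /hasP[b'' _ /andP[/eqP/lshift_inj x1 b1]].
case/negP: neq_x; rewrite xE; apply/eqP; congr diag; rewrite xE in x1 x2.
have := diag_div le_kq_p b'; rewrite -x1 diag_div => b'1.
case: b b' b'' b1 b'1 x2 {b_bs bS xE x1} => [j m] [j' m'] [j'' m''] /= /eqP <- j'E ->.
by congr (_, _); apply: val_inj.
Qed.

Lemma km_form_nonexact l psi : (l < k * q)%N -> ext_homog l psi ->
  invariant psi -> km_form <> weil_d psi.
Proof.
move=> lt_l psil psiK kmE.
have N_gt0 : (0 < k * q)%N by apply: leq_ltn_trans lt_l.
(* kq - 1 is the least [N0] for which [N0.+2] exceeds the degree kq of [km_form]. *)
have [|chi [chiK chiN _]] := @degree_reduction R p q k le_kq_p l (k * q).-1 psi lt_l psil psiK.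
  rewrite -kmE => S m leN; have kmN := @eta_form_pol_homog km_list; apply: kmN.
  rewrite size_km_list addn0 gtn_eqF //.
  by move: leN; rewrite prednK.
have [e] := eta_form_lead km_list_uniq; rewrite -/km_form.
set m := km_mnm _; set S := km_set _.
have degm : mdeg m = (k * q)%N.
  rewrite /m /km_mnm mdeg_sum (eq_bigr (fun=> 1%N)) => [|b _]; last exact: mdeg1.
  by rewrite big_const_seq iter_addn_0 mul1n count_predT size_km_list.
pose psi' := psi - weil_d chi.
have {kmE} kmE : km_form = delta psi' - kappa psi'.
  rewrite -weil_dE /psi' (linearB (@weil_d R p q k : {linear E -> E})) /=.
  by rewrite weil_d_sq // subr0.
have -> : (km_form S)@_m = (delta psi' S)@_m - (kappa psi' S)@_m.
  by rewrite kmE; move: (delta psi') (kappa psi') => u v; rewrite !ffunE mcoeffB.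
(* [delta] could reach [m] only from degree kq + 2, above the degree of [psi']. *)
rewrite (@delta_coef0 R p q k psi') => [|T m' m'E]; last first.
  by apply: chiN; rewrite m'E degm; lia.
have -> : (kappa psi' S)@_m = 0.
  rewrite kappa_coef big1 // => y _; rewrite big1 ?mulr0 // => j _.
  case: ifP => // /mnm_lepP /(_ (mxvec_index (rshift p y.2) j)).
  rewrite mnmDE !mnm1E eqxx /m km_mnmE (eq_count (a2 := pred0)) ?count_pred0 ?addn1 // => b.
  by rewrite /= eq_lrshift.
by move=> /eqP; rewrite subrr eq_sym signr_eq0.
Qed.
End NonExactness.
End KudlaMillson.

(** * Cohomology *)

Section Cohomology.
Variables (R : realType) (p q k : nat).
Local Notation E := (form R p q k).
Implicit Types (phi psi : E).

Lemma cohomology_class_eq0 l (z : cocycles R p q k l) :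
  \pi_(cohomology R p q k l)%qT z = 0 :> cohomology R p q k l <->
  if l is m.+1 then exists2 psi, cochain m psi & weil_d psi = z else z = 0.
Proof.
have -> : (0 : cohomology R p q k l) = \pi_(cohomology R p q k l)%qT 0.
  by rewrite /cohomology; apply/esym; rewrite piE.
split=> [/eqP|].
  by rewrite -Quotient.idealrBE subr0 unfold_in => /asboolP.
move=> zB; apply/eqP; rewrite -Quotient.idealrBE subr0 unfold_in.
exact/asboolP.
Qed.

Lemma cohomology_eq0 l :
    (forall phi, cochain l phi -> weil_d phi = 0 ->
      if l is m.+1 then exists2 psi, cochain m psi & weil_d psi = phi
      else phi = 0) ->
  forall x : cohomology R p q k l, x = 0.
Proof.
move=> exact_l x; rewrite -[x]reprK; apply/cohomology_class_eq0.
case: (repr x) => phi phiZ; have /asboolP[phiC dphi] := phiZ.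
case: (l) exact_l phiZ phiC => [|m] exact_l phiZ phiC; last exact: exact_l.
by apply/val_inj; apply: exact_l.
Qed.

Lemma cohomology_neq0 l phi : cochain l.+1 phi -> weil_d phi = 0 ->
    (forall psi, cochain l psi -> phi <> weil_d psi) ->
  exists x : cohomology R p q k l.+1, x <> 0.
Proof.
move=> phiC dphi phi_nex; have phiZ : is_cocycle l.+1 phi by apply/asboolP.
exists (\pi_(cohomology R p q k l.+1)%qT (Cocycle phiZ)).
by move/cohomology_class_eq0 => [psi psiC /esym]; apply: phi_nex.
Qed.
End Cohomology.

Theorem theorem1p0p4 (R : realType) (p q k : nat)
  (p_ge1 : (1 <= p)%N) (q_ge1 : (1 <= q)%N) (k_ge1 : (1 <= k)%N)
  (le_kq_p : (k * q <= p)%N) :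
  [/\ exists x : cohomology R p q k (k * q), x <> 0,
      exists x : cohomology R p q k (p * q), x <> 0,
      forall l : nat, (l < k * q)%N ->
        forall x : cohomology R p q k l, x = 0
    & forall l : nat, (p * q < l)%N ->
        forall x : cohomology R p q k l, x = 0].
Proof.
split=> [||l lt_l|l lt_l].
- have kq_gt0 : (0 < k * q)%N by rewrite muln_gt0 k_ge1.
  have kmC : cochain (k * q) (km_form R p q k).
    split; last exact: km_form_invariant.
    by rewrite -(size_km_list q k); apply: eta_form_homog.
  have dkm : weil_d (km_form R p q k) = 0.
    by apply: weil_d_eta_form; apply: mem_km_list.
  have kmN l psi : (l < k * q)%N -> cochain l psi -> km_form R p q k <> weil_d psi.
    by move=> lt_l [psil psiK]; apply: km_form_nonexact lt_l psil psiK.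
  (* Coboundaries are defined by cases on the degree, which therefore has to be exposed as a
     successor. *)
  case: (k * q)%N kq_gt0 kmC kmN => // l _ kmC kmN.
  by apply: (cohomology_neq0 kmC dkm) => psi; apply: kmN.
- have pq_gt0 : (0 < p * q)%N by rewrite muln_gt0 p_ge1.
  have topC : cochain (p * q) (top_form R p q k).
    by split; [apply: top_form_homog|apply: top_form_invariant].
  have dtop := weil_d_top R p q k.
  case: (p * q)%N pq_gt0 topC => // l _ topC.
  by apply: (cohomology_neq0 topC dtop) => psi _; apply: top_form_nonexact.
- apply: cohomology_eq0 => phi [phil phiK] dphi.
  have [chi [chiK phiE chil]] := weil_d_exact le_kq_p lt_l phil phiK dphi.
  case: l chil {lt_l phil} => [chi0|l chil]; last by exists chi.
  by rewrite phiE chi0 linear0.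
apply: cohomology_eq0 => phi [phil phiK] dphi.
have -> : phi = 0 by apply: ext_homog_gt lt_l phil.
case: l lt_l {phil} => // l _; exists 0; first exact: cochain0.
exact: linear0.
Qed.
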